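(* Let $K$ be any balanced maximum cap (with rotation angle $\pi/2$). Then on the interval $t\in[0,\pi/2)$ we have the inequality of measures $\sigma_K\le k_0(g_K^+(t))\,\mathrm{d}t$, i.e. $\sigma_K(X)\le\int_Xk_0(g_K^+(t))\,dt$ for every Borel set $X\subseteq[0,\pi/2)$, where $k_0:\mathbb{R}_{\ge0}\to\mathbb{R}$ is given by $k_0(x)=\max\bigl(|x-1|,\ (|x-1|+1)/2\bigr)$.
   Context: $|X|$ is area. $u_t=(\cos t,\sin t)$, $v_t=(-\sin t,\cos t)$, $S^1=\mathbb{R}/2\pi\mathbb{Z}$. For a convex body $K$ (nonempty compact convex subset of $\mathbb{R}^2$), $h_K(t)=\sup_{p\in K}p\cdot u_t$, $e_K(t)=\{p\in K:p\cdot u_t=h_K(t)\}$, $v_K^{+}(t)$ is the endpoint of $e_K(t)$ farthest in direction $v_t$, and $\sigma_K$ is the surface area measure of $K$ on $S^1$. $\mathcal{K}^{\mathrm c}$ is the set of caps with rotation angle $\pi/2$: convex bodies $K$ with $h_K(\pi/2)=1$, $h_K(3\pi/2)=0$, which are intersections of closed half-planes $\{p:p\cdot u_t\le c\}$ with $t\in[0,\pi]\cup\{3\pi/2\}$. For $K\in\mathcal{K}^{\mathrm c}$ and $t\in[0,\pi/2]$: $\mathbf{y}_K(t)=h_K(t)u_t+h_K(t+\pi/2)v_t$ and $g_K^+(t)=(\mathbf{y}_K(t)-v_K^+(t+\pi/2))\cdot u_t$. Let $Q_K^-(t)=\{p:p\cdot u_t<h_K(t)-1,\ p\cdot v_t<h_K(t+\pi/2)-1\}$.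 For a nonempty finite $\Theta\subset(0,\pi/2)$, let $\mathcal{K}^{\mathrm c}_\Theta$ be the set of $K\in\mathcal{K}^{\mathrm c}$ that are intersections of closed half-planes $\{p\cdot u_t\le c\}$ with $t\in\Theta\cup(\Theta+\pi/2)\cup\{\pi/2,3\pi/2\}$. For $K\in\mathcal{K}^{\mathrm c}_\Theta$ let $\mathcal{N}_\Theta(K)=\{(x,y):y\ge0\}\cap\bigcup_{t\in\Theta}Q_K^-(t)$ and $\mathcal{A}_\Theta(K)=|K|-|\mathcal{N}_\Theta(K)|$. A maximum polygon cap with angle set $\Theta$ is a $K\in\mathcal{K}^{\mathrm c}_\Theta$ containing $(0,1)$ and maximizing $\mathcal{A}_\Theta$ over $\mathcal{K}^{\mathrm c}_\Theta$. A balanced maximum cap (rotation angle $\pi/2$) is a $K\in\mathcal{K}^{\mathrm c}$ for which there are powers of two $1<n_1<n_2<\cdots$ and, for each $i\ge 1$, a maximum polygon cap $K_i$ with angle set $\{(\pi/2)j/n_i:1\le j<n_i\}$, such that $K_i\to K$ in Hausdorff distance. *)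

(* Defs.v *)
From mathcomp Require Export all_boot all_order all_algebra.
From mathcomp Require Export all_classical all_reals all_analysis.

Set Implicit Arguments.
Unset Strict Implicit.
Unset Printing Implicit Defensive.

Import Order.TTheory GRing.Theory Num.Theory.
Import numFieldNormedType.Exports.

Local Open Scope classical_set_scope.
Local Open Scope ring_scope.

Section Plane.
Context {R : realType}.
Implicit Types (p q : R * R) (t c r : R) (K A B : set (R * R)) (T : set R).

Definition dot p q : R := p.1 * q.1 + p.2 * q.2.

(* The library norm on [R * R] is the sup norm; distances here are Euclidean. *)
Definition edist p q : R := Num.sqrt (dot (p - q) (p - q)).

Definition uvec t : R * R := (cos t, sin t).
Definition vvec t : R * R := (- sin t, cos t).

Definition area_measure A : \bar R :=
  ((@lebesgue_measure R) \x (@lebesgue_measure R))%E A.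

(* Real-valued, hence meaningful only for sets of finite area. *)
Definition area A : R := fine (area_measure A).

Definition convex_body K : Prop := [/\ K !=set0, compact K & convex_set K].

Definition supp K t : R := sup [set dot p (uvec t) | p in K].

Definition edge K t : set (R * R) :=
  [set p | K p /\ dot p (uvec t) = supp K t].

Definition vplus K t : R * R :=
  get [set p | edge K t p /\
               forall q, edge K t q -> dot q (vvec t) <= dot p (vvec t)].

(* Subsets of the circle R/2piZ are given by sets of angles; everything below
   depends only on the angles modulo 2pi. *)

(* The points p outside K, at distance at most r from K, such that the unit
   vector from the nearest point q of K to p is u_t for some t in T: the pair
   (q, t) is such a nearest point/direction pair exactly when q is in the
   edge of K with outer normal u_t. *)
Definition local_parallel_set K r T : set (R * R) :=
  [set p | exists t q s,
     [/\ T t, edge K t q, 0 < s <= r & p = q + s *: uvec t]].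

(* Schneider's surface area measure S_1(K, .): the linear coefficient in the
   local Steiner formula
     |local_parallel_set K r T| = r S_1(K, T) + (r^2 / 2) |T|.
   For K with interior points it is the length of the part of the boundary
   having an outer normal in T; for a segment both sides are counted. *)
Definition surface_area K T : \bar R :=
  lim ((r^-1)%:E * area_measure (local_parallel_set K r T) @[r --> 0^'+])%E.

Definition dist_to A p : R := inf [set edist p q | q in A].

Definition hausdorff_dist A B : R :=
  Num.max (sup [set dist_to B p | p in A]) (sup [set dist_to A p | p in B]).

Definition halfplane t c : set (R * R) := [set p | dot p (uvec t) <= c].

Definition halfplane_intersection T K : Prop :=
  exists F : set (R * R),
    (forall tc, F tc -> T tc.1) /\
    K = \bigcap_(tc in F) halfplane tc.1 tc.2.

Definition cap K : Prop :=
  [/\ convex_body K,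
      supp K (pi / 2) = 1,
      supp K (3 * pi / 2) = 0 &
      halfplane_intersection (`[0, pi] `|` [set 3 * pi / 2]) K].

Definition ycorner K t : R * R :=
  supp K t *: uvec t + supp K (t + pi / 2) *: vvec t.

Definition gplus K t : R :=
  dot (ycorner K t - vplus K (t + pi / 2)) (uvec t).

Definition Qminus K t : set (R * R) :=
  [set p | dot p (uvec t) < supp K t - 1 /\
           dot p (vvec t) < supp K (t + pi / 2) - 1].

Implicit Type Theta : set R.

Definition angle_set Theta : Prop :=
  [/\ Theta !=set0, finite_set Theta & Theta `<=` `]0, pi / 2[].

Definition polygon_cap Theta K : Prop :=
  cap K /\
  halfplane_intersection
    (Theta `|` [set t + pi / 2 | t in Theta] `|` [set pi / 2; 3 * pi / 2]) K.

Definition niche Theta K : set (R * R) :=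
  [set p | 0 <= p.2] `&` \bigcup_(t in Theta) Qminus K t.

Definition area_functional Theta K : R := area K - area (niche Theta K).

Definition maximum_polygon_cap Theta K : Prop :=
  [/\ angle_set Theta, polygon_cap Theta K, K (0, 1) &
      forall K', polygon_cap Theta K' ->
        area_functional Theta K' <= area_functional Theta K].

Definition uniform_angles (n : nat) : set R :=
  [set pi / 2 * (j%:R / n%:R) | j in [set j : nat | (1 <= j < n)%N]].

Definition balanced_maximum_cap K : Prop :=
  cap K /\
  exists (n : nat -> nat) (Ki : nat -> set (R * R)),
    [/\ forall i, exists m : nat, n i = (2 ^ m)%N,
        (1 < n 0%N)%N,
        forall i, (n i < n i.+1)%N,
        forall i, maximum_polygon_cap (uniform_angles (n i)) (Ki i) &
        hausdorff_dist (Ki i) K @[i --> \oo] --> 0].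

Definition k0 (x : R) : R := Num.max `|x - 1| ((`|x - 1| + 1) / 2).

End Plane.

(* Main.v *)
From HB Require Import structures.
Require Import Defs.
From mathcomp Require Import measurable_realfun ring lra.
Import Order.TTheory GRing.Theory Num.Theory.
Import numFieldNormedType.Exports.
Set Implicit Arguments.
Unset Strict Implicit.
Unset Printing Implicit Defensive.
Local Open Scope classical_set_scope.
Local Open Scope ring_scope.

(** The proof follows one side of a polygon cap under a first variation, passes
    to the limit along the caps that approximate [K], and reads the resulting
    inequality between increments as one between measures.

    Let [A] be a maximum polygon cap with support function [h] whose angles have
    step [d], and push its side with normal [u_t] outward by [e]. The cap gains at least [e] times the
    length of the side, up to [O(e^2)]. The niche grows only in the strip of
    width [e] along the line [p . u_t = h t - 1], and only where the two
    neighbouring quadrants do not already cover it; besides a piece of length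
    [2 tan (d / 2) - side], when this is positive, this is the part of the line
    by which the quadrant of [t] overhangs its neighbours. Maximality therefore
    gives [side <= overhang + max (0, 2 tan (d / 2) - side)]
    ([side_le_overhang]). To first order the overhang is [d] times
    [max (g - 1, 1 - g)], where [g] is the arm length, and [2 tan (d / 2)] is
    [d]; according to whether the side is longer than [2 tan (d / 2)] or not,
    it is at most [d |g - 1|] or [d (|g - 1| + 1) / 2], which is the function
    [k0] ([side_bound]).

    Summing the sides between two angles [a <= b] telescopes: the sum of their
    lengths is the increment of the position [p . v_t] of the boundary point
    plus the integral of the support function. The arm length depends on the
    extreme points of edges, which are not stable under Hausdorff convergence.
    It is bracketed by difference quotients of the support function on a scale
    [w]; these are stable, their spread is the side length of [K] on the scale
    [w], and the integral of the spread is [O(w)]. Letting [A] tend to [K] and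
    then [w] to [0] yields [edge_increment]: the arc length of the boundary
    between the normals [a] and [b] is at most the integral of [k0 (gplus K t)].
    With [a = b] this shows that the edges of [K] in the directions of
    [[0, pi / 2[] are points, and that the arc length is a Lipschitz function
    of the direction, as [k0 (gplus K t)] is bounded.

    Over a short arc the local parallel set is squeezed between two rotated
    rectangles; subdividing gives Steiner's bounds for the directions in []a, b]]
    ([parallel_area_bounds]). The area of the local parallel set is a Borel
    measure in the set of directions ([parallel_measure]), and an inequality
    between Borel measures on half-open intervals extends to all Borel sets
    ([measure_le_oo]). Hence [r^-1] times the area over [X] is at most
    [\int_X k0 + r |X|] and is monotone in [r] up to [r |X|], so that it
    converges as [r] tends to [0], to a limit that is at most [\int_X k0]. The
    direction [0] contributes a segment, which has no area. *)

(** * Trigonometric estimates *)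
Section Trig.
Context {R : realType}.
Implicit Types (x y : R).

Lemma sin_le x : 0 <= x -> sin x <= x.
Proof.
rewrite le_eqVlt => /orP[/eqP<-|x0]; first by rewrite sin0.
have [c _] := MVT x0 (fun y _ => is_derive_sin y)
  (continuous_subspaceT (@continuous_sin R)).
rewrite sin0 !subr0 => ->.
by rewrite ler_piMl ?cos_le1// ltW.
Qed.

Lemma sin_ge x : 0 <= x <= pi -> x * cos x <= sin x.
Proof.
case/andP; rewrite le_eqVlt => /orP[/eqP<-|x0 xpi]; first by rewrite sin0 mul0r.
have [c] := MVT x0 (fun y _ => is_derive_sin y)
  (continuous_subspaceT (@continuous_sin R)).
rewrite in_itv/= => /andP[c0 cx].
rewrite sin0 !subr0 => ->; rewrite mulrC ler_wpM2r// ?(ltW x0)//.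
rewrite leNgt ltr_cos ?in_itv/= ?(ltW c0) ?(ltW x0) ?(le_trans (ltW cx))//.
by rewrite -leNgt ltW.
Qed.

Lemma cos_lip x y : `|cos x - cos y| <= `|x - y|.
Proof.
wlog xy : x y / x < y.
  move=> H; have [xy|yx|->] := ltgtP x y; last by rewrite !subrr normr0.
    exact: H.
  by rewrite distrC (distrC x); exact: H.
have [c _] := MVT xy (fun y _ => is_derive_cos y)
  (continuous_subspaceT (@continuous_cos R)).
rewrite distrC => ->; rewrite normrM (distrC x) ler_piMl//.
by rewrite normrN sin_max.
Qed.

Lemma sin_lip x y : `|sin x - sin y| <= `|x - y|.
Proof.
have := cos_lip (x - pi / 2) (y - pi / 2).
by rewrite !cosBpihalf opprB addrA subrK.
Qed.

Lemma cos_ge1B x : 0 <= x -> 1 - x <= cos x.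
Proof.
move=> x0; have := cos_lip 0 x.
by rewrite cos0 sub0r normrN (ger0_norm x0) ler_norml => /andP[_]; lra.
Qed.

(** By the half-angle formula. The quadratic order is what survives the
    division by [sin w] in the estimate of second differences. *)
Lemma cos_ge1B2 x : 1 - x ^+ 2 / 2 <= cos x.
Proof.
have -> : cos x = 1 - 2 * sin (x / 2) ^+ 2.
  have {1}-> : x = (x / 2) *+ 2 by rewrite mulr2n; lra.
  rewrite cos_mulr2n cos2sin2 mulr2n; ring.
have h : `|sin (x / 2)| <= `|x / 2|.
  by have := sin_lip (x / 2) 0; rewrite sin0 !subr0.
have : sin (x / 2) ^+ 2 <= (x / 2) ^+ 2.
  by rewrite -[leLHS]real_normK ?num_real// -[leRHS]real_normK ?num_real// lerXn2r ?nnegrE.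
rewrite expr_div_n; lra.
Qed.

Lemma lip_continuous (L : R) (f : R -> R) : 0 < L ->
  (forall x y, `|f x - f y| <= L * `|x - y|) -> continuous f.
Proof.
move=> L0 hf t; apply/cvgrPdist_lt => e e0; near=> s.
rewrite (le_lt_trans (hf _ _))// -ltr_pdivlMl//.
near: s; suff : nbhs t (ball t (L^-1 * e)) by [].
by apply: nbhsx_ballx; rewrite mulr_gt0// invr_gt0.
Unshelve. all: by end_near. Qed.

Lemma pi2_gt0 : 0 < pi / 2 :> R.
Proof. by rewrite divr_gt0// pi_gt0. Qed.

Lemma cos_gt0_acute x : 0 <= x -> x < pi / 2 -> 0 < cos x.
Proof.
by move=> x0 x2; rewrite cos_gt0_pihalf// x2 andbT (lt_le_trans _ x0)// oppr_lt0 pi2_gt0.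
Qed.

Lemma sin_gt0_acute x : 0 < x -> x <= pi / 2 -> 0 < sin x.
Proof.
move=> x0 x2; rewrite sin_gt0_pi// x0/= (le_lt_trans x2)//.
have := @pi_gt0 R; lra.
Qed.

End Trig.

(** * Dot products in rotated frames and support functions *)
Section Support.
Context {R : realType}.
Implicit Types (p q : R * R) (s t x : R) (K : set (R * R)) (B : R).

Definition du p t : R := dot p (uvec t).
Definition dv p t : R := dot p (vvec t).

Lemma duE p t : du p t = p.1 * cos t + p.2 * sin t. Proof. by []. Qed.
Lemma dvE p t : dv p t = - p.1 * sin t + p.2 * cos t.
Proof. by rewrite /dv /dot /= mulrN mulNr. Qed.

Lemma du_rot p t x : du p (t + x) = cos x * du p t + sin x * dv p t.
Proof. rewrite !duE !dvE cosD sinD; ring. Qed.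
Lemma dv_rot p t x : dv p (t + x) = cos x * dv p t - sin x * du p t.
Proof. rewrite !duE !dvE cosD sinD; ring. Qed.
Lemma du_rotN p t x : du p (t - x) = cos x * du p t - sin x * dv p t.
Proof. by rewrite du_rot cosN sinN mulNr. Qed.
Lemma dv_rotN p t x : dv p (t - x) = cos x * dv p t + sin x * du p t.
Proof. by rewrite dv_rot cosN sinN mulNr opprK. Qed.
Lemma du_pihalf p t : du p (t + pi / 2) = dv p t.
Proof. by rewrite du_rot cos_pihalf sin_pihalf mul0r add0r mul1r. Qed.
Lemma dv_pihalf p t : dv p (t + pi / 2) = - du p t.
Proof. by rewrite dv_rot cos_pihalf sin_pihalf mul0r add0r mul1r. Qed.
Lemma duD p q t : du (p + q) t = du p t + du q t.
Proof. rewrite !duE /=; ring. Qed.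
Lemma duB p q t : du (p - q) t = du p t - du q t.
Proof. rewrite !duE /=; ring. Qed.
Lemma duZ x q t : du (x *: q) t = x * du q t.
Proof. rewrite !duE /= /GRing.scale/=; ring. Qed.
Lemma dvD p q t : dv (p + q) t = dv p t + dv q t.
Proof. rewrite !dvE /=; ring. Qed.
Lemma dvB p q t : dv (p - q) t = dv p t - dv q t.
Proof. rewrite !dvE /=; ring. Qed.
Lemma dvZ x q t : dv (x *: q) t = x * dv q t.
Proof. rewrite !dvE /= /GRing.scale/=; ring. Qed.
Lemma du_uvec s t : du (uvec s) t = cos (t - s).
Proof. by rewrite duE /= cosB; ring. Qed.
Lemma dv_uvec s t : dv (uvec s) t = - sin (t - s).
Proof. by rewrite dvE /= sinB; ring. Qed.

Lemma point_eq p q t : du p t = du q t -> dv p t = dv q t -> p = q.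
Proof.
rewrite !duE !dvE => h1 h2; have h := cos2Dsin2 t.
apply/eqP; rewrite -subr_eq0; apply/eqP.
case: p q h1 h2 => [a b] [c d] /= h1 h2.
have e1 : a - c = 0.
  have -> : a - c = cos t * ((a * cos t + b * sin t) - (c * cos t + d * sin t))
     - sin t * ((- a * sin t + b * cos t) - (- c * sin t + d * cos t)) +
     (a - c) * (1 - (cos t ^+ 2 + sin t ^+ 2)) by ring.
  by rewrite h1 h2 h !subrr !mulr0 subr0 addr0.
have e2 : b - d = 0.
  have -> : b - d = sin t * ((a * cos t + b * sin t) - (c * cos t + d * sin t))
     + cos t * ((- a * sin t + b * cos t) - (- c * sin t + d * cos t)) +
     (b - d) * (1 - (cos t ^+ 2 + sin t ^+ 2)) by ring.
  by rewrite h1 h2 h !subrr !mulr0 !addr0.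
by apply/eqP; rewrite -pair_eqE /pair_eq /= e1 e2 !eqxx.
Qed.

Definition frame t x s : R * R := x *: uvec t + s *: vvec t.

Lemma du_frame t x s : du (frame t x s) t = x.
Proof.
rewrite duE /= /GRing.scale/=.
transitivity (x * (cos t ^+ 2 + sin t ^+ 2)); first ring.
by rewrite cos2Dsin2 mulr1.
Qed.

Lemma du_continuous t : continuous (du ^~ t).
Proof.
move=> p; rewrite /du /dot /=.
apply: cvgD; apply: cvgM; try exact: cvg_cst; [exact: cvg_fst|exact: cvg_snd].
Qed.
Lemma dv_continuous t : continuous (dv ^~ t).
Proof.
move=> p; rewrite /dv /dot /=.
apply: cvgD; apply: cvgM; try exact: cvg_cst; [exact: cvg_fst|exact: cvg_snd].
Qed.

Lemma compact_max K (f : R * R -> R) : K !=set0 -> compact K -> continuous f ->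
  exists2 p, K p & forall q, K q -> f q <= f p.
Proof.
move=> K0 cK cf.
have [c Kc h] := @compact_EVT_max (R * R)%type R f K K0 cK
  (continuous_subspaceT cf).
by exists c => [|q Kq]; [exact: set_mem|apply: h; exact: mem_set].
Qed.

Lemma edge_ex K t : convex_body K -> exists p, edge K t p.
Proof.
case=> K0 cK _.
have [p Kp hp] := compact_max K0 cK (@du_continuous t).
exists p; split => //; apply/eqP; rewrite eq_le; apply/andP; split.
  apply: ub_le_sup; last by exists p.
  by exists (du p t) => _ [q Kq <-]; exact: hp.
by apply: ge_sup; [case: K0 => q Kq; exists (du q t), q|move=> _ [q Kq <-]; exact: hp].
Qed.

Lemma supp_ge K p t : convex_body K -> K p -> du p t <= supp K t.
Proof.
move=> cK Kp; have [K0 cmp _] := cK.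
have [p' Kp' hp'] := compact_max K0 cmp (@du_continuous t).
by apply: ub_le_sup; [exists (du p' t) => _ [q Kq <-]; exact: hp'|exists p].
Qed.

Lemma supp_le K t c : K !=set0 -> (forall p, K p -> du p t <= c) -> supp K t <= c.
Proof.
move=> [q Kq] h; apply: ge_sup; first by exists (du q t), q.
by move=> _ [p Kp <-]; exact: h.
Qed.

(** Edges are compact, so the choice defining [vplus] succeeds. *)
Lemma vplus_edge K t : convex_body K -> edge K t (vplus K t).
Proof.
move=> bK; rewrite /vplus.
set P := [set p | _]; suff /getPex[] : exists p, P p by [].
have [p0 ep0] := edge_ex t bK; have [K0 cK _] := bK.
have ecmp : compact (edge K t).
  have -> : edge K t = K `&` (du ^~ t @^-1` [set supp K t]) by [].
  apply: compact_closedI => //.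
  by apply: preimage_closed => [p _|]; [exact: du_continuous|exact: closed_eq].
have [p ep hp] := compact_max (ex_intro _ _ ep0) ecmp (@dv_continuous t).
by exists p.
Qed.

Lemma norm_bound K : convex_body K ->
  exists2 B, 0 < B & forall p, K p -> `|p.1| <= B /\ `|p.2| <= B.
Proof.
case=> [[k Kk] /compact_bounded [M [Mr hM]] _].
have M0 : M < `|M| + 1 by rewrite (le_lt_trans (ler_norm _))// ltrDl.
exists (`|M| + 1) => [|p Kp]; first by rewrite ltr_wpDl.
by have := hM _ M0 p Kp; rewrite /Num.norm /= ge_max => /andP[].
Qed.

Lemma du_le B p t : `|p.1| <= B -> `|p.2| <= B -> `|du p t| <= 2 * B.
Proof.
move=> h1 h2; rewrite duE (le_trans (ler_normD _ _))// !normrM.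
have := cos_max t; have := sin_max t; have := normr_ge0 p.1; have := normr_ge0 p.2.
have := normr_ge0 (cos t); have := normr_ge0 (sin t); nra.
Qed.

Lemma dv_le B p t : `|p.1| <= B -> `|p.2| <= B -> `|dv p t| <= 2 * B.
Proof. by move=> ? ?; rewrite -du_pihalf; exact: du_le. Qed.

Lemma du_lip B p t s : `|p.1| <= B -> `|p.2| <= B ->
  `|du p t - du p s| <= 2 * B * `|t - s|.
Proof.
move=> h1 h2; rewrite !duE.
have -> : p.1 * cos t + p.2 * sin t - (p.1 * cos s + p.2 * sin s) =
  p.1 * (cos t - cos s) + p.2 * (sin t - sin s) by ring.
rewrite (le_trans (ler_normD _ _))// !normrM.
have := cos_lip t s; have := sin_lip t s.
have := normr_ge0 p.1; have := normr_ge0 p.2.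
have := normr_ge0 (cos t - cos s); have := normr_ge0 (sin t - sin s).
have := normr_ge0 (t - s); nra.
Qed.

Section Body.
Variables (K : set (R * R)) (bK : convex_body K).
Notation h := (supp K).

Lemma supp_norm B t : (forall p, K p -> `|p.1| <= B /\ `|p.2| <= B) ->
  `|h t| <= 2 * B.
Proof.
move=> hB; have [p [Kp <-]] := edge_ex t bK.
by have [] := hB _ Kp; exact: du_le.
Qed.

Lemma supp_lip B t s : (forall p, K p -> `|p.1| <= B /\ `|p.2| <= B) ->
  `|h t - h s| <= 2 * B * `|t - s|.
Proof.
move=> hB; rewrite ler_norml; apply/andP; split.
  have [p [Kp e]] := edge_ex s bK; have := supp_ge t bK Kp.
  have [h1 h2] := hB _ Kp; have := du_lip t s h1 h2.
  rewrite ler_norml => /andP[+ _]; rewrite -e -/(du p s); lra.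
have [p [Kp e]] := edge_ex t bK; have := supp_ge s bK Kp.
have [h1 h2] := hB _ Kp; have := du_lip t s h1 h2.
rewrite ler_norml => /andP[_]; rewrite -e -/(du p t); lra.
Qed.

Lemma supp_continuous : continuous h.
Proof.
have [B B0 hB] := norm_bound bK.
by apply: (@lip_continuous _ (2 * B)) => [|x y]; [rewrite mulr_gt0|exact: supp_lip].
Qed.

(** A point of the edge at [t] satisfies the constraints at [t - x] and
    [t + y], and [sin (x + y) u_t = sin y u_(t - x) + sin x u_(t + y)]. *)
Lemma supp3 t x y : 0 <= sin x -> 0 <= sin y ->
  sin (x + y) * h t <= sin y * h (t - x) + sin x * h (t + y).
Proof.
move=> sx sy; have [p [Kp e]] := edge_ex t bK.
have := supp_ge (t - x) bK Kp; have := supp_ge (t + y) bK Kp.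
rewrite -e -/(du p t) sinD du_rot du_rotN => h1 h2.
have := ler_wpM2l sx h1; have := ler_wpM2l sy h2; nra.
Qed.

End Body.
End Support.

(** * Hausdorff distance and support functions *)
Section Hausdorff.
Context {R : realType}.
Implicit Types (p q : R * R) (t : R) (A B : set (R * R)).

Lemma du_edist p q t : du p t - du q t <= edist p q.
Proof.
rewrite -duB /edist; set w := p - q.
have h : du w t ^+ 2 <= dot w w.
  have <- : du w t ^+ 2 + dv w t ^+ 2 = dot w w.
    rewrite duE dvE /dot.
    transitivity ((w.1 * w.1 + w.2 * w.2) * (cos t ^+ 2 + sin t ^+ 2)); first ring.
    by rewrite cos2Dsin2 mulr1.
  by rewrite lerDl sqr_ge0.
rewrite (le_trans (ler_norm _))// -sqrtr_sqr ler_wsqrtr//.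
Qed.

Lemma edist_le b p q : `|p.1| <= b -> `|p.2| <= b -> `|q.1| <= b -> `|q.2| <= b ->
  edist p q <= 4 * b.
Proof.
move=> h1 h2 h3 h4; have b0 : 0 <= b := le_trans (normr_ge0 _) h1.
rewrite /edist -[leRHS]ger0_norm ?mulr_ge0// -sqrtr_sqr ler_wsqrtr// /dot /=.
move: h1 h2 h3 h4; rewrite !ler_norml => /andP[? ?] /andP[? ?] /andP[? ?] /andP[? ?].
have l1 : (p.1 - q.1) ^+ 2 <= (2 * b) ^+ 2.
  by rewrite -[leLHS]real_normK ?num_real// lerXn2r ?nnegrE ?mulr_ge0// ler_norml; lra.
have l2 : (p.2 - q.2) ^+ 2 <= (2 * b) ^+ 2.
  by rewrite -[leLHS]real_normK ?num_real// lerXn2r ?nnegrE ?mulr_ge0// ler_norml; lra.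
have := sqr_ge0 b; move: l1 l2; rewrite !expr2; lra.
Qed.

Lemma dist_to_has_inf B p : B !=set0 -> has_inf [set edist p q | q in B].
Proof.
move=> [q Bq]; split; first by exists (edist p q), q.
by exists 0 => _ [q' _ <-]; exact: sqrtr_ge0.
Qed.

(** A point of [A] that is extreme in the direction [u_t] exceeds a point of
    [B] by at most their distance. *)
Lemma supp_le_dist A B t : convex_body A -> convex_body B ->
  supp A t <= supp B t + sup [set dist_to B p | p in A].
Proof.
move=> bA bB; have [p [Ap <-]] := edge_ex t bA.
have [B0 _ _] := bB; have [a a0 hA] := norm_bound bA; have [b b0 hB] := norm_bound bB.
have h1 : dist_to B p <= sup [set dist_to B p | p in A].
  apply: ub_le_sup; last by exists p.
  case: B0 => q Bq; exists (4 * (a + b)) => _ [p' Ap' <-].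
  rewrite /dist_to; apply: (@le_trans _ _ (edist p' q)).
    by apply: ge_inf; [exact: (dist_to_has_inf _ (ex_intro _ _ Bq)).2|exists q].
  have [? ?] := hA _ Ap'; have [? ?] := hB _ Bq.
  by apply: edist_le; lra.
rewrite -/(du p t) -lerBlDl (le_trans _ h1)//.
apply: lb_le_inf; first exact: (dist_to_has_inf p B0).1.
move=> _ [q Bq <-]; have := supp_ge t bB Bq; have := du_edist p q t; lra.
Qed.

Lemma supp_hausdorff A B t : convex_body A -> convex_body B ->
  `|supp A t - supp B t| <= hausdorff_dist A B.
Proof.
move=> bA bB; have := supp_le_dist t bA bB; have := supp_le_dist t bB bA.
rewrite /hausdorff_dist => h1 h2.
rewrite ler_norml le_max; apply/andP; split.
  rewrite lerNl le_max; apply/orP; right; lra.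
apply/orP; left; lra.
Qed.
End Hausdorff.

(** * Area of rectangles in rotated position *)
Section Area.
Context {R : realType}.
Notation mu := (@lebesgue_measure R).
Notation mu2 := (mu \x mu)%E.
Implicit Types (A I J : set R).

Lemma image_measure d d' (T1 : measurableType d) (T2 : measurableType d')
    (m : {measure set T1 -> \bar R}) (f : T1 -> T2) : measurable_fun setT f ->
  exists m' : {measure set T2 -> \bar R}, forall X, m' X = m (f @^-1` X).
Proof.
move=> mf.
by exists (measure_function_pushforward__canonical__measure_function_Measure m mf).
Qed.

Lemma affine_measurable (a b : R) : measurable_fun setT (fun x : R => a * x + b).
Proof. by apply: measurable_funD => //; exact: mulrl_measurable. Qed.

Lemma measure_eq_itv (m1 m2 : {measure set (measurableTypeR R) -> \bar R}) :
  (forall a b : R, a < b -> m1 (`]a, b]%classic : set R) = m2 (`]a, b]%classic : set R)) ->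
  (forall a b : R, (m1 (`]a, b]%classic : set R) < +oo)%E) ->
  forall A, measurable A -> m1 A = m2 A.
Proof.
move=> h12 hoo A mA.
apply: (@measure_unique _ R (measurableTypeR R) (@ocitv R)
  (fun n => `](- n%:R), n%:R]%classic) _ _ _ _ m1 m2) => //.
- exact: ocitvI.
- by move=> n; exact: is_ocitv.
- apply/seteqP; split=> // x _ /=; exists (Num.bound x) => //=.
  by rewrite in_itv/= ltrNl unstable.ltrNbound ltW// unstable.ltr_bound.
- by move=> X /ocitvP[->|[[c d] /= cd ->]]; [rewrite !measure0|exact: h12].
Qed.

Lemma lebesgue_affine (a b : R) A : 0 < a -> measurable A ->
  mu [set x | A (a * x + b)] = (a^-1%:E * mu A)%E.
Proof.
move=> a0 mA.
have [m mE] := @image_measure _ _ (measurableTypeR R) (measurableTypeR R) mu _ (@affine_measurable a b).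
pose ms : {measure set _ -> \bar R} := mscale (NngNum (ltW a0)) m.
suff h : mu A = (a%:E * mu [set x | A (a * x + b)%R])%E.
  by rewrite h muleA -EFinM mulVf ?gt_eqF// mul1e.
have -> : mu A = ms A.
  apply: (@measure_eq_itv mu ms) => // [c d cd|c d]; last first.
    rewrite /= lebesgue_measure_itv; by case: ifP => _; rewrite ?ltry.
  rewrite /ms /= /mscale /= mE.
  have -> : (fun x : R => a * x + b) @^-1` `]c, d]%classic =
            `](c - b) / a, (d - b) / a]%classic.
    apply/seteqP; split=> x /=; rewrite !in_itv/= => /andP[h1 h2]; apply/andP; split.
    - by rewrite ltr_pdivrMr// mulrC; lra.
    - by rewrite ler_pdivlMr// mulrC; lra.
    - by move: h1; rewrite ltr_pdivrMr// mulrC; lra.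
    - by move: h2; rewrite ler_pdivlMr// mulrC; lra.
  rewrite /= !lebesgue_measure_itv/= !lte_fin cd.
  rewrite ltr_pM2r ?invr_gt0// ltrD2r cd -!EFinB -EFinM.
  by congr (_%:E); field; rewrite gt_eqF.
by rewrite /ms /= /mscale /= mE.
Qed.

Lemma measurable_du t : measurable_fun setT (fun p : R * R => du p t).
Proof.
apply: measurable_funD.
- apply: measurable_funM; [exact: measurable_fst|exact: measurable_cst].
- apply: measurable_funM; [exact: measurable_snd|exact: measurable_cst].
Qed.

Lemma measurable_dv t : measurable_fun setT (fun p : R * R => dv p t).
Proof.
apply: measurable_funD.
- apply: measurable_funM; [exact: measurable_fst|exact: measurable_cst].
- apply: measurable_funM; [exact: measurable_snd|exact: measurable_cst].
Qed.

Lemma measurable_preimage d d' (T1 : measurableType d) (T2 : measurableType d')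
  (f : T1 -> T2) (X : set T2) : measurable_fun setT f -> measurable X ->
  measurable (f @^-1` X).
Proof. by move=> mf mA; rewrite -[X in measurable X]setTI; exact: mf. Qed.

Definition box t I J : set (R * R) := [set p | I (du p t) /\ J (dv p t)].

Lemma measurable_box t I J : measurable I -> measurable J -> measurable (box t I J).
Proof.
move=> mI mJ; apply: (@measurableI _ _ [set p | I (du p t)] [set p | J (dv p t)]).
- exact: (measurable_preimage (measurable_du t)).
- exact: (measurable_preimage (measurable_dv t)).
Qed.

Lemma area_ysection (A : set (R * R)) : measurable A ->
  mu2 A = (\int[mu]_y mu (ysection A y))%E.
Proof.
move=> mA; have := indic_fubini_tonelli mu mu mA.
by rewrite indic_fubini_tonelli_FE// indic_fubini_tonelli_GE.
Qed.

(** Rotation invariance of the area of rectangles, from the effect of affine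
    maps on one-dimensional sections: the horizontal section at height [y] is
    carried by [x |-> c x + s y] to a section of a parallelogram, whose
    vertical sections are affine images of [J]. *)
Lemma area_box t I J : 0 < cos t -> measurable I -> measurable J ->
  mu2 (box t I J) = (mu I * mu J)%E.
Proof.
move=> c0 mI mJ; set c := cos t; set s := sin t.
have cn : c != 0 by rewrite gt_eqF.
pose B : set (R * R) := [set p | I p.1 /\ J ((p.2 - s * p.1) / c)].
have mf : measurable_fun setT (fun p : R * R => (p.2 - s * p.1) / c).
  apply: measurable_funM; last exact: measurable_cst.
  apply: measurable_funB; first exact: measurable_snd.
  apply: measurable_funM; [exact: measurable_cst|exact: measurable_fst].
have mB : measurable B.
  apply: (@measurableI _ _ [set p | I p.1] [set p | J ((p.2 - s * p.1) / c)]).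
    exact: (measurable_preimage measurable_fst).
  exact: (measurable_preimage mf).
rewrite area_ysection; last exact: measurable_box.
transitivity (\int[mu]_y (c^-1%:E * mu (ysection B y)))%E.
  apply: eq_integral => y _.
  rewrite -(@lebesgue_affine c (s * y))//; last exact: measurable_ysection.
  congr (mu _); apply/seteqP; split=> x /=; rewrite /ysection /= !inE /box /B /= !duE !dvE /= -/c -/s.
    move=> [h1 h2]; split; first by rewrite (mulrC c) (mulrC s).
    congr J: h2; have := cos2Dsin2 t; rewrite -/c -/s => h.
    apply: (mulIf cn); rewrite divfK//.
    transitivity (y * (c ^+ 2 + s ^+ 2) - s * (c * x + s * y)); first ring.
    by rewrite h mulr1.
  move=> [h1 h2]; split; first by rewrite (mulrC _ c) (mulrC _ s).
  congr J: h2; have := cos2Dsin2 t; rewrite -/c -/s => h.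
  apply: (mulIf cn); rewrite divfK//.
  transitivity (y * (c ^+ 2 + s ^+ 2) - s * (c * x + s * y)); last ring.
  by rewrite h mulr1.
rewrite ge0_integralZl//; last 2 first.
- exact: (measurable_fun_ysection mu mB).
- by rewrite lee_fin invr_ge0 ltW.
rewrite -area_ysection// /product_measure1.
transitivity (c^-1%:E * \int[mu]_(x in I) (c%:E * mu J))%E.
  congr (_ * _)%E; rewrite [RHS]integral_mkcond; apply: eq_integral => x _ /=.
  rewrite patchE; case: ifPn => [|xI].
    rewrite inE => xI.
    transitivity (mu [set y | J (c^-1 * y + - (s * x / c))]).
      congr (mu _); apply/seteqP; split=> y /=; rewrite /xsection /= inE /B /=.
        by move=> [_]; rewrite mulrBl mulrC.
      by move=> h; split=> //; rewrite mulrBl [y / c]mulrC.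
    by rewrite lebesgue_affine ?invr_gt0// invrK.
  rewrite (_ : xsection B x = set0) ?measure0//.
  apply/seteqP; split=> y //=; rewrite /xsection /= inE /B /= => -[+ _].
  by move: xI; rewrite notin_setE.
by rewrite integral_cst// -(muleA c%:E) (muleA (c^-1)%:E) -EFinM mulVf// mul1e muleC.
Qed.

End Area.

(** * Borel sets and areas in the plane *)
Section PlaneMeasure.
Context {R : realType}.
Notation mu := (@lebesgue_measure R).
Notation mu2 := (mu \x mu)%E.
Implicit Types (A B C : set (R * R)).

(** An open set is the union of the rational squares that it contains. *)
Lemma open_measurable_plane A : open A -> measurable A.
Proof.
move=> oA.
pose c (n : nat) (a b : rat) : set (R * R) :=
  ball (ratr a : R) n.+1%:R^-1 `*` ball (ratr b : R) n.+1%:R^-1.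
pose F n a b := if `[< c n a b `<=` A >] then c n a b else set0.
have -> : A = \bigcup_n \bigcup_a \bigcup_b F n a b.
  apply/seteqP; split => [p Ap|p [n _ [a _ [b _]]]]; last first.
    by rewrite /F; case: asboolP => // + ?; exact.
  have /nbhs_ballP[e /= e0 he] := open_nbhs_nbhs (conj oA Ap).
  have [n hn] := ltr_add_invr (divr_gt0 e0 (@ltr0n R 2)).
  rewrite add0r in hn; set r := n.+1%:R^-1 in hn.
  have r0 : 0 < r by rewrite invr_gt0.
  have ap x : exists a : rat, `|x - ratr a| < r.
    have /rat_in_itvoo[a] : x - r < x + r by rewrite ltrD2l gtrN.
    by rewrite in_itv/= => h; exists a; rewrite ltr_distl; lra.
  have [a ha] := ap p.1; have [b hb] := ap p.2.
  exists n => //; exists a => //; exists b => //; rewrite /F.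
  have hp : c n a b p by split; rewrite /ball /= distrC.
  case: asboolP => // -[] q [q1 q2]; apply: he; split; rewrite /= /ball /=.
    move: q1; rewrite /ball /= => q1.
    rewrite (le_lt_trans (ler_distD (ratr a) _ _))//; rewrite -/r in q1; lra.
  move: q2; rewrite /ball /= => q2.
  rewrite (le_lt_trans (ler_distD (ratr b) _ _))//; rewrite -/r in q2; lra.
apply: bigcupT_measurable => n; apply: bigcupT_measurable_rat => a.
apply: bigcupT_measurable_rat => b; rewrite /F; case: ifP => // _.
by apply: measurableX; exact: measurable_ball.
Qed.

Lemma closed_measurable_plane A : closed A -> measurable A.
Proof.
by move=> cA; rewrite -[A]setCK; apply: measurableC; apply: open_measurable_plane; exact: closed_openC.
Qed.

Lemma compact_measurable_plane A : compact A -> measurable A.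
Proof.
by move=> /compact_closed cA; apply: closed_measurable_plane; apply: cA; exact: norm_hausdorff.
Qed.

Definition bounded_plane A :=
  exists b : R, forall p, A p -> `|p.1| <= b /\ `|p.2| <= b.

Lemma bounded_area_lty A : measurable A -> bounded_plane A -> (mu2 A < +oo)%E.
Proof.
move=> mA [b hb].
have mI : measurable (`[- b, b] : set R) by [].
apply: (@le_lt_trans _ _ (mu2 (`[- b, b] `*` `[- b, b]))).
  apply: le_measure; rewrite ?inE//; first exact: measurableX.
  by move=> p /hb[]; rewrite !ler_norml /= !in_itv/=.
rewrite product_measure1E//= lebesgue_measure_itv/=; case: ifP => _; last by rewrite mul0e.
by rewrite -EFinB -EFinM ltry.
Qed.

Lemma areaE A : measurable A -> bounded_plane A -> (area A)%:E = mu2 A.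
Proof.
by move=> mA bA; rewrite /area fineK// ge0_fin_numE ?measure_ge0//; exact: bounded_area_lty.
Qed.

Lemma area_disjoint_ge A B C : measurable A -> measurable B -> measurable C ->
  bounded_plane C -> A `<=` C -> B `<=` C -> A `&` B = set0 ->
  area A + area B <= area C.
Proof.
move=> mA mB mC bC AC BC AB.
have sub D : D `<=` C -> bounded_plane D by move=> DC; case: bC => b hb; exists b => p /DC; exact: hb.
rewrite -lee_fin EFinD !areaE//; [|exact: sub..].
rewrite -[X in (X <= _)%E](measureU mu2)//.
apply: le_measure; rewrite ?inE//; first exact: measurableU.
by move=> p [/AC|/BC].
Qed.

Lemma area_cover_le A B1 B2 C : measurable A -> measurable B1 -> measurable B2 ->
  measurable C -> bounded_plane A -> bounded_plane B1 -> bounded_plane B2 ->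
  bounded_plane C -> C `<=` A `|` (B1 `|` B2) ->
  area C <= area A + (area B1 + area B2).
Proof.
move=> mA mB1 mB2 mC bA bB1 bB2 bC CAB.
rewrite -lee_fin !EFinD !areaE//.
have mB : measurable (B1 `|` B2) by exact: measurableU.
apply: (le_trans (y := mu2 (A `|` (B1 `|` B2)))).
  by apply: le_measure; rewrite ?inE//; exact: measurableU.
by apply: (le_trans (measureU2 mu2 mA mB)); rewrite leeD2l// measureU2.
Qed.

Lemma bounded_box t (a b c d : R) : bounded_plane (box t `[a, b] `[c, d]).
Proof.
exists (`|a| + `|b| + (`|c| + `|d|)) => p [/=].
rewrite !in_itv/= => /andP[h1 h2] /andP[h3 h4].
have e1 : p.1 = cos t * du p t - sin t * dv p t.
  by rewrite -du_rotN subrr duE cos0 sin0 mulr1 mulr0 addr0.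
have e2 : p.2 = cos t * dv p t + sin t * du p t.
  by rewrite -dv_rotN subrr dvE cos0 sin0 mulr1 mulr0 add0r.
have n1 : `|du p t| <= `|a| + `|b|.
  rewrite ler_norml; have := ler_norm b; have := ler_norm (- a); have := normr_ge0 a; have := normr_ge0 b; rewrite normrN; lra.
have n2 : `|dv p t| <= `|c| + `|d|.
  rewrite ler_norml; have := ler_norm d; have := ler_norm (- c); have := normr_ge0 c; have := normr_ge0 d; rewrite normrN; lra.
have g x y : `|x| <= 1 -> `|x * y| <= `|y| by move=> hx; rewrite normrM ler_piMl.
split.
  rewrite e1 (le_trans (ler_normB _ _))//; apply: lerD.
    by apply: le_trans n1; apply: g; exact: cos_max.
  by apply: le_trans n2; apply: g; exact: sin_max.
rewrite e2 addrC (le_trans (ler_normD _ _))//; apply: lerD.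
  by apply: le_trans n1; apply: g; exact: sin_max.
by apply: le_trans n2; apply: g; exact: cos_max.
Qed.

Lemma area_boxE t (a b c d : R) : 0 < cos t -> a <= b ->
  area (box t `[a, b] `[c, d]) = (b - a) * Num.max 0 (d - c).
Proof.
move=> t0 ab; apply: EFin_inj; rewrite areaE; last 2 first.
- exact: measurable_box.
- exact: bounded_box.
rewrite area_box// !lebesgue_measure_itv/= !lte_fin.
have [cd|dc] := ltP c d; last first.
  by rewrite mule0 max_l ?mulr0// subr_le0.
rewrite max_r ?subr_ge0 ?(ltW cd)//.
move: ab; rewrite le_eqVlt => /orP[/eqP->|ab].
  by rewrite ltxx mul0e subrr mul0r.
by rewrite ab -!EFinB -EFinM.
Qed.

Lemma area_box_itv t (I I' J J' : interval R) : 0 < cos t ->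
  mu [set` I] = mu [set` I'] -> mu [set` J] = mu [set` J'] ->
  area (box t [set` I] [set` J]) = area (box t [set` I'] [set` J']).
Proof.
move=> t0 eI eJ.
have boxE (i j : interval R) := @area_box R t _ _ t0 (measurable_itv i) (measurable_itv j).
by rewrite /area /area_measure (boxE I J) (boxE I' J') eI eJ.
Qed.

(** The rectangles added to a cap are open on the side of their support line,
    to be disjoint from the cap. *)
Lemma area_box_openE t (a b c d : R) : 0 < cos t -> a <= b ->
  area (box t `]a, b] `[c, d]) = (b - a) * Num.max 0 (d - c).
Proof.
move=> t0 ab; rewrite -(area_boxE c d t0 ab).
by apply: area_box_itv => //; rewrite !lebesgue_measure_itv.
Qed.

End PlaneMeasure.

(** * Pushing one side of a polygon cap outward *)
Section Push.
Context {R : realType}.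
Implicit Types (p q : R * R) (K : set (R * R)) (Th T : set R) (t e : R).

Definition cap_angles Th : set R :=
  Th `|` [set t + pi / 2 | t in Th] `|` [set pi / 2; 3 * pi / 2].

(** Half-planes containing [K] may be shrunk to supporting ones. *)
Lemma halfplanes_supp T K : K !=set0 -> convex_body K -> halfplane_intersection T K ->
  forall p, (forall t, T t -> du p t <= supp K t) -> K p.
Proof.
move=> K0 bK [F [FT KE]] p hp; rewrite KE => tc Ftc.
rewrite /halfplane /=; apply: (le_trans (hp _ (FT _ Ftc))).
apply: supp_le => // q; rewrite {1}KE; exact.
Qed.

Lemma polygon_capP Th K p : polygon_cap Th K ->
  K p <-> forall t, cap_angles Th t -> du p t <= supp K t.
Proof.
move=> [[bK _ _ _] hK]; split => [Kp t _|]; first exact: supp_ge.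
by apply: halfplanes_supp hK _ => //; case: bK.
Qed.

Lemma angleP Th t : angle_set Th -> Th t -> 0 < t < pi / 2.
Proof. by case=> _ _ h /h /=; rewrite in_itv. Qed.

Lemma cap_angles_itv Th t : angle_set Th -> cap_angles Th t ->
  (0 < t < pi) \/ t = 3 * pi / 2.
Proof.
move=> aTh; have p0 := @pi_gt0 R.
case=> [[/(angleP aTh)|[s /(angleP aTh) + <-]]|[->|->]]; [left; lra|left; lra|left; lra|by right].
Qed.

Lemma supp_subset K1 K2 t : convex_body K1 -> convex_body K2 -> K1 `<=` K2 ->
  supp K1 t <= supp K2 t.
Proof. by move=> [? _ _] b2 h; apply: supp_le => // p /h; exact: supp_ge. Qed.

(** Only the constraint at [t] is relaxed, so that the other sides stay on
    their lines ([supp_push]). *)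
Definition push Th K t e : set (R * R) :=
  [set p | forall s, cap_angles Th s -> du p s <= supp K s + (if s == t then e else 0)].

Section PushCap.
Variables (Th : set R) (K : set (R * R)) (t e : R).
Hypotheses (aTh : angle_set Th) (pK : polygon_cap Th K) (Tht : Th t) (e0 : 0 <= e).

Let bK : convex_body K. Proof. by case: pK => -[]. Qed.
Let K0 : K !=set0. Proof. by case: bK. Qed.

Lemma sub_push : K `<=` push Th K t e.
Proof.
move=> p Kp s _; apply: (le_trans (supp_ge s bK Kp)).
by rewrite lerDl; case: ifP.
Qed.

(** The constraints at [t], [t + pi / 2], [pi / 2] and [3 * pi / 2] already
    confine the push to a bounded region. *)
Lemma push_bounded : bounded_plane (push Th K t e).
Proof.
have [h1 h2] := andP (angleP aTh Tht).
have s0 : 0 < sin t by rewrite sin_gt0_pihalf ?h1.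
have c0 : 0 < cos t by rewrite cos_gt0_pihalf ?h2 ?andbT// (lt_trans _ h1)// oppr_lt0 pi2_gt0.
set A := supp K t + e; set B := supp K (t + pi / 2) + e.
pose a := `|A| / cos t + `|B| / sin t.
exists (1 + e + a) => p Pp.
have kA : `|A| = `|A| / cos t * cos t by rewrite divfK// gt_eqF.
have kB : `|B| = `|B| / sin t * sin t by rewrite divfK// gt_eqF.
have a1 : 0 <= `|A| / cos t by rewrite divr_ge0// ltW.
have b1 : 0 <= `|B| / sin t by rewrite divr_ge0// ltW.
have := Pp t (or_introl (or_introl Tht)); rewrite eqxx -/A duE => hA.
have hB : du p (t + pi / 2) <= B.
  apply: (le_trans (Pp (t + pi / 2) _)); last by rewrite lerD2l; case: ifP.
  by left; right; exists t.
rewrite du_pihalf dvE in hB.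
have u1 : p.2 <= 1 + e.
  have := Pp (pi / 2) (or_intror (or_introl erefl)).
  rewrite duE cos_pihalf sin_pihalf mulr0 add0r mulr1.
  case: pK => -[_ -> _ _] _ h; apply: (le_trans h); rewrite lerD2l.
  by case: ifP.
have l1 : 0 <= p.2.
  have := Pp (3 * pi / 2) (or_intror (or_intror erefl)).
  case: pK => -[_ _ -> _] _; rewrite add0r duE.
  have -> : 3 * pi / 2 = pi / 2 + pi :> R by field.
  rewrite cosDpi sinDpi cos_pihalf sin_pihalf oppr0 mulr0 add0r mulrN1.
  rewrite ifF ?oppr_le0//; apply/negP => /eqP E.
  by have := pi_gt0 R; rewrite -E in h2; lra.
split; rewrite ler_norml; last by rewrite /a; lra.
have := ler_norm A; have := ler_norm B; rewrite kA kB => nB nA.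
apply/andP; split.
  rewrite lerNl -(ler_pM2r s0) /a.
  have : p.2 * cos t >= 0 by rewrite mulr_ge0// ltW.
  have : 0 <= (1 + e + `|A| / cos t) * sin t by rewrite mulr_ge0 ?addr_ge0// ltW.
  by nra.
rewrite -(ler_pM2r c0) /a.
have : p.2 * sin t >= 0 by rewrite mulr_ge0// ltW.
have : 0 <= (1 + e + `|B| / sin t) * cos t by rewrite mulr_ge0 ?addr_ge0// ltW.
by nra.
Qed.

Lemma push_closed : closed (push Th K t e).
Proof.
have -> : push Th K t e = \bigcap_(s in cap_angles Th)
   ((du ^~ s) @^-1` [set x | x <= supp K s + (if s == t then e else 0)]).
  by [].
apply: closed_bigI => s _; apply: preimage_closed => [p _|].
  exact: du_continuous.
exact: closed_le.
Qed.

Lemma push_body : convex_body (push Th K t e).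
Proof.
split.
- by case: K0 => p /sub_push; exists p.
- have [b hb] := push_bounded.
  apply: (@subclosed_compact _ _ (`[- b, b] `*` `[- b, b])).
  + exact: push_closed.
  + by apply: compact_setX; exact: segment_compact.
  + by move=> p /hb []; rewrite !ler_norml /= !in_itv.
- move=> p q l; rewrite !inE => hp hq s Ts.
  have [l0 l1] : 0 <= l%:inum /\ l%:inum <= 1 by split.
  have -> : du (conv l p q) s = l%:inum * du p s + (1 - l%:inum) * du q s.
    by rewrite -!duZ -duD.
  have := hp s Ts; have := hq s Ts; nra.
Qed.

Lemma supp_push s : cap_angles Th s -> s != t ->
  supp (push Th K t e) s = supp K s.
Proof.
move=> Ts st; apply/eqP; rewrite eq_le; apply/andP; split; last first.
  by apply: supp_subset => //; [exact: push_body|exact: sub_push].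
apply: supp_le => [|p /(_ s Ts)]; last by rewrite (negbTE st) addr0.
by have [] := push_body.
Qed.

Lemma supp_push_le : supp (push Th K t e) t <= supp K t + e.
Proof.
apply: supp_le => [|p /(_ t)]; first by have [] := push_body.
by rewrite eqxx; apply; left; left.
Qed.

Lemma push_polygon_cap : polygon_cap Th (push Th K t e).
Proof.
have [h1 h2] := andP (angleP aTh Tht).
have [[_ k1 k2 _] _] := pK; have p0 := @pi_gt0 R.
have hI T : cap_angles Th `<=` T -> halfplane_intersection T (push Th K t e).
  move=> hT; exists [set sc | cap_angles Th sc.1 /\
     sc.2 = supp K sc.1 + (if sc.1 == t then e else 0)]; split.
    by move=> tc [/hT].
  apply/seteqP; split => [p hp [s c] /= [Ts ->]|p hp s Ts]; first exact: hp.
  exact: (hp (s, supp K s + (if s == t then e else 0))).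
split; last exact: hI.
split.
- exact: push_body.
- rewrite supp_push//; first by right; left.
  by apply/negP => /eqP E; rewrite -E ltxx in h2.
- rewrite supp_push//; first by right; right.
  by apply/negP => /eqP E; lra.
- apply: hI => s /(cap_angles_itv aTh)[/andP[s1 s2]|->]; last by right.
  by left; rewrite /= in_itv/= !ltW.
Qed.

End PushCap.

Lemma body_closed K : convex_body K -> closed K.
Proof. by case=> _ /compact_closed h _; apply: h; exact: norm_hausdorff. Qed.

Lemma body_bounded K : convex_body K -> bounded_plane K.
Proof. by move=> /norm_bound[b _ hb]; exists b. Qed.

Lemma body_measurable K : convex_body K -> measurable K.
Proof. by move=> /body_closed; exact: closed_measurable_plane. Qed.

Lemma measurable_Qminus K t : measurable (Qminus K t).
Proof.
have -> : Qminus K t = box t `]-oo, supp K t - 1[ `]-oo, supp K (t + pi / 2) - 1[.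
  by apply/seteqP; split => p; rewrite /box /= !in_itv/=.
exact: measurable_box.
Qed.

Lemma measurable_niche Th K : finite_set Th -> measurable (niche Th K).
Proof.
move=> fTh; apply: measurableI.
  have -> : [set p : R * R | 0 <= p.2] = snd @^-1` `[0, +oo[.
    by apply/seteqP; split => p; rewrite /= in_itv/= andbT.
  exact: (measurable_preimage measurable_snd).
by apply: fin_bigcup_measurable => // s _; exact: measurable_Qminus.
Qed.

(** Each quadrant opens downward, so that it meets the half-plane [0 <= y] in
    a triangle. *)
Lemma niche_bounded Th K : angle_set Th -> bounded_plane (niche Th K).
Proof.
move=> aTh; have [_ fTh _] := aTh.
suff [b hb] : exists b, forall s, Th s -> forall p, 0 <= p.2 -> Qminus K s p ->
    `|p.1| <= b /\ `|p.2| <= b.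
  by exists b => p [p2 [s Ths Qp]]; exact: (hb s).
have each s : Th s -> exists b, forall p, 0 <= p.2 -> Qminus K s p ->
    `|p.1| <= b /\ `|p.2| <= b.
  move=> Ths; have [h1 h2] := andP (angleP aTh Ths).
  have s0 : 0 < sin s by rewrite sin_gt0_pihalf ?h1.
  have c0 : 0 < cos s by rewrite cos_gt0_pihalf ?h2 ?andbT// (lt_trans _ h1)// oppr_lt0 pi2_gt0.
  set A := supp K s - 1; set B := supp K (s + pi / 2) - 1.
  pose a := `|A| / cos s + `|B| / sin s + (`|A| + `|B|).
  exists a => p p2 [/= hA hB].
  have kA : `|A| = `|A| / cos s * cos s by rewrite divfK// gt_eqF.
  have kB : `|B| = `|B| / sin s * sin s by rewrite divfK// gt_eqF.
  have a1 : 0 <= `|A| / cos s by rewrite divr_ge0// ltW.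
  have b1 : 0 <= `|B| / sin s by rewrite divr_ge0// ltW.
  rewrite -/A -/(du p s) duE in hA; rewrite -/B -/(dv p s) dvE in hB.
  have nA0 := normr_ge0 A; have nB0 := normr_ge0 B.
  have := ler_norm A; have := ler_norm B => nB nA.
  split; rewrite ler_norml.
    apply/andP; split.
      rewrite lerNl -(ler_pM2r s0) /a.
      have : p.2 * cos s >= 0 by rewrite mulr_ge0// ltW.
      have : 0 <= (`|A| / cos s + (`|A| + `|B|)) * sin s by rewrite mulr_ge0 ?addr_ge0// ltW.
      by rewrite {1}kB in nB; nra.
    rewrite -(ler_pM2r c0) /a.
    have : p.2 * sin s >= 0 by rewrite mulr_ge0// ltW.
    have : 0 <= (`|B| / sin s + (`|A| + `|B|)) * cos s by rewrite mulr_ge0 ?addr_ge0// ltW.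
    by rewrite {1}kA in nA; nra.
  apply/andP; split.
    by rewrite (le_trans _ p2)// oppr_le0 /a !addr_ge0.
  have E : p.2 = sin s * (p.1 * cos s + p.2 * sin s) + cos s * (- p.1 * sin s + p.2 * cos s).
    transitivity (p.2 * (cos s ^+ 2 + sin s ^+ 2)); last ring.
    by rewrite cos2Dsin2 mulr1.
  have i1 := sin_le1 s; have i2 := cos_le1 s.
  have j1 : sin s * (p.1 * cos s + p.2 * sin s) <= `|A|.
    apply: (@le_trans _ _ (sin s * `|A|)); last by rewrite ler_piMl.
    by rewrite ler_pM2l//; lra.
  have j2 : cos s * (- p.1 * sin s + p.2 * cos s) <= `|B|.
    apply: (@le_trans _ _ (cos s * `|B|)); last by rewrite ler_piMl.
    by rewrite ler_pM2l//; lra.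
  by rewrite E /a; lra.
have /choice[f hf] : forall s, exists b, Th s -> forall p, 0 <= p.2 -> Qminus K s p ->
    `|p.1| <= b /\ `|p.2| <= b.
  move=> s; have [/each[b hb]|nTh] := pselect (Th s); first by exists b.
  by exists 0.
exists (\sum_(s \in Th) `|f s|) => s Ths p p2 Qp.
have [g1 g2] := hf s Ths p p2 Qp.
have le : f s <= \sum_(s \in Th) `|f s|.
  rewrite (le_trans (ler_norm _))// (fsbigD1 s)//= lerDl.
  by apply: fsumr_ge0 => // i _.
by split; [exact: (le_trans g1)|exact: (le_trans g2)].
Qed.

End Push.

(** * First variation of a maximum polygon cap *)
Section Variation.
Context {R : realType}.
Implicit Types (p q : R * R) (K : set (R * R)) (Th : set R) (t e d : R).

(** For a polygon whose normals next to [u_t] are at angle [d], the length of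
    the edge at [t]: its ends are the intersections with the support lines at
    [t - d] and [t + d]. *)
Definition side K d t : R := (supp K (t + d) + supp K (t - d) - 2 * supp K t * cos d) / sin d.

(** A point beyond the support line at [t] but not beyond the one at [t + d]
    is not beyond any later one: [sin d u_s] is
    [sin (s - t) u_(t + d) - sin (s - t - d) u_t], and [supp3] compares the
    same combinations of support values. *)
Lemma du_le_right K p d s t : convex_body K -> 0 < sin d -> 0 <= sin (s - t) ->
  0 <= sin (s - t - d) -> supp K t <= du p t -> du p (t + d) <= supp K (t + d) ->
  du p s <= supp K s.
Proof.
move=> bK sd s1 s2 h1 h2; rewrite -(ler_pM2l sd).
have := supp3 bK (t + d) (ltW sd) s2.
have -> : t + d - d = t by ring.
have -> : t + d + (s - t - d) = s by ring.
have -> : d + (s - t - d) = s - t by ring.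
move=> h3.
suff : sin d * du p s = sin (s - t) * du p (t + d) - sin (s - t - d) * du p t by nra.
rewrite !duE; set c1 := cos s; set c2 := sin s.
rewrite !sinB !cosB !cosD !sinD -/c1 -/c2; have := cos2Dsin2 t; have := cos2Dsin2 d.
set C := cos t; set S := sin t; set c := cos d; set s' := sin d => E1 E2.
have : p.1 * c1 * s' * (1 - (C ^+ 2 + S ^+ 2)) + p.2 * c2 * s' * (1 - (C ^+ 2 + S ^+ 2)) = 0.
  by rewrite E2 subrr !mulr0 addr0.
by move=> E; apply/eqP; rewrite -subr_eq0 -E; apply/eqP; ring.
Qed.

Lemma du_le_left K p d s t : convex_body K -> 0 < sin d -> 0 <= sin (t - s) ->
  0 <= sin (t - s - d) -> supp K t <= du p t -> du p (t - d) <= supp K (t - d) ->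
  du p s <= supp K s.
Proof.
move=> bK sd s1 s2 h1 h2; rewrite -(ler_pM2l sd).
have := supp3 bK (t - d) s2 (ltW sd).
have -> : t - d + d = t by ring.
have -> : t - d - (t - s - d) = s by ring.
have -> : t - s - d + d = t - s by ring.
move=> h3.
suff : sin d * du p s = sin (t - s) * du p (t - d) - sin (t - s - d) * du p t by nra.
rewrite !duE; set c1 := cos s; set c2 := sin s.
rewrite !sinB !cosB -/c1 -/c2; have := cos2Dsin2 t; have := cos2Dsin2 d.
set C := cos t; set S := sin t; set c := cos d; set s' := sin d => E1 E2.
have : p.1 * c1 * s' * (1 - (C ^+ 2 + S ^+ 2)) + p.2 * c2 * s' * (1 - (C ^+ 2 + S ^+ 2)) = 0.
  by rewrite E2 subrr !mulr0 addr0.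
by move=> E; apply/eqP; rewrite -subr_eq0 -E; apply/eqP; ring.
Qed.

Section Discrete.
Variables (Th : set R) (K : set (R * R)) (t d : R).
Hypotheses (mK : maximum_polygon_cap Th K) (Tht : Th t) (Thd : Th (t + d)) (d0 : 0 < d).
(* At the first angle the half-plane [0 <= y] replaces the left neighbouring
   quadrant: its boundary is the [v]-side of a quadrant at angle [0]. *)
Hypothesis left_nbr : Th (t - d) \/ t - d = 0.
Hypothesis gap : forall s, Th s -> [\/ s <= t - d, s = t | t + d <= s].

Let h := supp K.
Let aTh : angle_set Th. Proof. by case: mK. Qed.
Let pK : polygon_cap Th K. Proof. by case: mK. Qed.
Let bK : convex_body K. Proof. by case: pK => -[]. Qed.
Let t0 : 0 < t. Proof. by have /andP[] := angleP aTh Tht. Qed.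
Let td2 : t + d < pi / 2. Proof. by have /andP[] := angleP aTh Thd. Qed.
Let td0 : 0 <= t - d.
Proof. by case: left_nbr => [/(angleP aTh)/andP[/ltW]|->]. Qed.
Let p0 : 0 < pi :> R. Proof. exact: pi_gt0. Qed.
Ltac slra := have := d0; have := t0; have := td2; have := td0; have := p0; lra.
Let sd : 0 < sin d. Proof. by rewrite sin_gt0_pihalf// d0/=; slra. Qed.
Let cd : 0 < cos d. Proof. by apply: cos_gt0_acute; slra. Qed.
Let ct : 0 < cos t. Proof. by apply: cos_gt0_acute; slra. Qed.

(** The strip of width [e] beyond the side, cut between the support lines at
    [t - d] and [t + d], contains this rectangle; the constraints at the other
    angles hold by [du_le_left] and [du_le_right]. *)
Lemma gain_sub e : 0 < e ->
  box t `]h t, h t + e]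
    `[((h t + e) * cos d - h (t - d)) / sin d, (h (t + d) - (h t + e) * cos d) / sin d]
  `<=` push Th K t e.
Proof.
move=> e0 p [/=]; rewrite !in_itv/= => /andP[u1 u2] /andP[v1 v2].
move: v1 v2; rewrite ler_pdivrMr// ler_pdivlMr// => v1 v2.
have r1 : du p (t + d) <= h (t + d).
  rewrite du_rot; have : cos d * du p t <= (h t + e) * cos d by rewrite mulrC ler_pM2r.
  by move: v2; rewrite mulrC; lra.
have l1 : du p (t - d) <= h (t - d).
  rewrite du_rotN; have : cos d * du p t <= (h t + e) * cos d by rewrite mulrC ler_pM2r.
  by move: v1; rewrite [_ * sin d]mulrC; lra.
have right s : t + d <= s -> s < pi -> du p s <= h s.
  move=> s1 s2; apply: (du_le_right bK sd _ _ (ltW u1) r1); apply: sin_ge0_pi; apply/andP; split; slra.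
have left s : 0 <= s -> s <= t - d -> du p s <= h s.
  move=> s1 s2; apply: (du_le_left bK sd _ _ (ltW u1) l1); apply: sin_ge0_pi; apply/andP; split; slra.
move=> s; case: eqP => [->//|/eqP st Ts]; rewrite addr0.
case: Ts => [[Ths|[s' /(angleP aTh) /andP[s1 s2] <-]]|[->|->]].
- have /andP[s1 s2] := angleP aTh Ths.
  case: (gap Ths) => [l|e'|r]; first by apply: left => //; exact: ltW.
    by rewrite e' eqxx in st.
  by apply: right => //; slra.
- by apply: right; slra.
- by apply: right; slra.
- have E x : sin (x - 3 * pi / 2) = sin (x + pi / 2).
    have -> : x - 3 * pi / 2 = x + pi / 2 - pi *+ 2 by rewrite mulr2n; field.
    by rewrite -[in RHS](subrK (pi *+ 2) (x + pi / 2)) sinD2pi.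
  apply: (du_le_left bK sd _ _ (ltW u1) l1).
    by rewrite E; apply: sin_ge0_pi; apply/andP; split; slra.
  by rewrite addrAC E; apply: sin_ge0_pi; apply/andP; split; slra.
Qed.

(* Along the line [p . u_t = h t - 1] the quadrant of [t] reaches the
   [v_t]-coordinate [sx]; the [v]-sides of the quadrants of [t - d] and
   [t + d] cross this line at [bl] and [br]. *)
Let sx := h (t + pi / 2) - 1.
Let bl := (h (t - d + pi / 2) - 1 - (h t - 1) * sin d) / cos d.
Let br := (h (t + d + pi / 2) - 1 + (h t - 1) * sin d) / cos d.

(** A point that enters the niche lies in the strip of width [e] and, for each
    neighbour, beyond the [u]-side or the [v]-side of its quadrant. If it is
    beyond one of the [v]-sides, its coordinate is at least about [bl] or
    [br], which is the first rectangle; otherwise it is beyond both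
    [u]-sides, which is the second. *)
Lemma loss_sub e : 0 < e ->
  niche Th (push Th K t e) `<=` niche Th K `|`
   (box t `[h t - 1, h t - 1 + e] `[Num.min br (bl - e * sin d / cos d), sx] `|`
    box t `[h t - 1, h t - 1 + e]
      `[(h (t + d) - 1 - (h t - 1 + e) * cos d) / sin d,
        ((h t - 1 + e) * cos d - (h (t - d) - 1)) / sin d]).
Proof.
move=> e0 p [p2 [s Ths [/= Q1 Q2]]].
have [Np|Np] := pselect (niche Th K p); [by left|right].
have supE x : cap_angles Th x -> x != t -> supp (push Th K t e) x = h x.
  by move=> Tx xt; rewrite supp_push// ltW.
have Thp x : Th x -> cap_angles Th (x + pi / 2) /\ x + pi / 2 != t.
  move=> Thx; split; first by left; right; exists x.
  by apply/negP => /eqP E; have /andP[] := angleP aTh Thx; slra.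
have [E|/eqP st] := pselect (s = t); last first.
  case: Np; split=> //; exists s => //; split => /=.
    by rewrite -[supp K s](supE s)//; left; left.
  by have [c1 c2] := Thp _ Ths; rewrite -[supp K (s + _)](supE (s + pi / 2)).
subst s.
have N x : Th x -> ~ Qminus K x p by move=> Thx Qx; apply: Np; split=> //; exists x.
have q1 : du p t < h t - 1 + e.
  have := @supp_push_le _ Th K t e aTh pK Tht (ltW e0).
  by move: Q1; rewrite -/(du p t) -/h; lra.
have q2 : dv p t < sx.
  by have [c1 c2] := Thp _ Tht; move: Q2; rewrite supE.
have q3 : h t - 1 <= du p t.
  rewrite leNgt; apply/negP => q3; apply: (N t Tht); split=> //.
have R1 : (h (t + d) - 1 <= du p (t + d)) \/ h (t + d + pi / 2) - 1 <= dv p (t + d).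
  have [|q4] := leP (h (t + d) - 1) (du p (t + d)); first by left.
  right; rewrite leNgt; apply/negP => q5; apply: (N _ Thd); split => //.
have L1 : (h (t - d) - 1 <= du p (t - d)) \/ h (t - d + pi / 2) - 1 <= dv p (t - d).
  case: left_nbr => [Thl|E].
    have [|q4] := leP (h (t - d) - 1) (du p (t - d)); first by left.
    right; rewrite leNgt; apply/negP => q5; apply: (N _ Thl); split => //.
  right; rewrite E add0r /h.
  case: pK => -[_ -> _ _] _; rewrite subrr dvE sin0 cos0 mulr0 add0r mulr1; exact: p2.
have in1 : `[h t - 1, h t - 1 + e]%classic (du p t) by rewrite /= in_itv/= q3 ltW.
have [A|A] := leP (Num.min br (bl - e * sin d / cos d)) (dv p t).
  by left; split => //=; rewrite in_itv/= A ltW.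
right; split => //=; rewrite in_itv/=.
move: A; rewrite lt_min => /andP[]; rewrite ltr_pdivlMr// => A1.
have -> : bl - e * sin d / cos d =
  (h (t - d + pi / 2) - 1 - (h t - 1) * sin d - e * sin d) / cos d by rewrite /bl; field; rewrite gt_eqF.
rewrite ltr_pdivlMr// => A2.
have m1 : (h t - 1) * sin d <= du p t * sin d by rewrite ler_pM2r.
have m2 : du p t * sin d <= (h t - 1 + e) * sin d by rewrite ler_pM2r// ltW.
have m3 : du p t * cos d <= (h t - 1 + e) * cos d by rewrite ler_pM2r// ltW.
rewrite ler_pdivlMr// ler_pdivrMr//; apply/andP; split.
  case: R1; rewrite ?du_rot ?dv_rot; lra.
case: L1; rewrite ?du_rotN ?dv_rotN; lra.
Qed.

Definition overhang : R := Num.max 0 (sx - Num.min br bl).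

(** The areas gained and lost by the push are compared and divided by [e]. *)
Lemma first_variation e : 0 < e ->
  side K d t - 2 * e * (cos d / sin d) <=
    overhang + Num.max 0 (2 * (1 - cos d) / sin d - side K d t) +
    e * (sin d / cos d + 2 * (cos d / sin d)).
Proof.
move=> e0; set K' := push Th K t e.
have bK' : convex_body K' by apply: push_body => //; exact: ltW.
have pK' : polygon_cap Th K' by apply: push_polygon_cap => //; exact: ltW.
have fTh : finite_set Th by case: aTh.
have [_ _ _ /(_ _ pK')] := mK; rewrite /area_functional => opt.
have gain : area K + e * Num.max 0 (side K d t - 2 * e * (cos d / sin d)) <= area K'.
  have := area_disjoint_ge (body_measurable bK) (@measurable_box _ t `]h t, h t + e]
       `[((h t + e) * cos d - h (t - d)) / sin d, (h (t + d) - (h t + e) * cos d) / sin d]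
    (measurable_itv _) (measurable_itv _)) (body_measurable bK')
    (body_bounded bK') (sub_push _ pK (ltW e0)) (gain_sub e0).
  rewrite area_box_openE//; last by rewrite lerDl ltW.
  have -> : h t + e - h t = e by ring.
  have -> : (h (t + d) - (h t + e) * cos d) / sin d -
     ((h t + e) * cos d - h (t - d)) / sin d = side K d t - 2 * e * (cos d / sin d).
    by rewrite /side /h; field; rewrite gt_eqF.
  apply; apply/seteqP; split => // p [Kp [/= + _]].
  by rewrite in_itv/= ltNge (supp_ge t bK Kp).
have loss := area_cover_le (measurable_niche K fTh)
  (@measurable_box _ t _ _ (measurable_itv _) (measurable_itv _))
  (@measurable_box _ t _ _ (measurable_itv _) (measurable_itv _))
  (measurable_niche K' fTh) (niche_bounded K aTh)
  (bounded_box _ _ _ _ _) (bounded_box _ _ _ _ _) (niche_bounded K' aTh)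
  (loss_sub e0).
move: opt gain loss; move: (area (niche Th K)) (area (niche Th K')) => N N' opt gain.
have areaB b c : area (box t `[h t - 1, h t - 1 + e] `[b, c]) = e * Num.max 0 (c - b).
  by rewrite area_boxE ?lerDl ?(ltW e0)//; congr (_ * _); ring.
rewrite !areaB => loss.
have E2 : ((h t - 1 + e) * cos d - (h (t - d) - 1)) / sin d -
   (h (t + d) - 1 - (h t - 1 + e) * cos d) / sin d =
   2 * (1 - cos d) / sin d - side K d t + 2 * e * (cos d / sin d).
  by rewrite /side /h; field; rewrite gt_eqF.
rewrite E2 in loss.
have : e * Num.max 0 (side K d t - 2 * e * (cos d / sin d)) <=
  e * (Num.max 0 (sx - Num.min br (bl - e * sin d / cos d)) +
       Num.max 0 (2 * (1 - cos d) / sin d - side K d t + 2 * e * (cos d / sin d))).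
  by lra.
rewrite ler_pM2l// => main.
have k1 : 0 <= e * (sin d / cos d) by rewrite mulr_ge0 ?divr_ge0// ltW.
have k2 : 0 <= e * (cos d / sin d) by rewrite mulr_ge0 ?divr_ge0// ltW.
have o1 : Num.max 0 (sx - Num.min br (bl - e * sin d / cos d)) <= overhang + e * (sin d / cos d).
  rewrite -mulrA ge_max; apply/andP; split.
    by rewrite addr_ge0// le_max lexx.
  have : sx - Num.min br bl <= overhang by rewrite le_max lexx orbT.
  have : Num.min br bl - e * (sin d / cos d) <= Num.min br (bl - e * (sin d / cos d)).
    rewrite le_min; apply/andP; split.
      have : Num.min br bl <= br by rewrite ge_min lexx.
      by move: k1; lra.
    have : Num.min br bl <= bl by rewrite ge_min lexx orbT.
    by lra.
  by lra.
have o2 : Num.max 0 (2 * (1 - cos d) / sin d - side K d t + 2 * e * (cos d / sin d)) <=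
   Num.max 0 (2 * (1 - cos d) / sin d - side K d t) + 2 * (e * (cos d / sin d)).
  rewrite ge_max; apply/andP; split.
    by rewrite addr_ge0 ?le_max ?lexx// mulr_ge0.
  have : 2 * (1 - cos d) / sin d - side K d t <= Num.max 0 (2 * (1 - cos d) / sin d - side K d t).
    by rewrite le_max lexx orbT.
  by lra.
have : side K d t - 2 * e * (cos d / sin d) <= Num.max 0 (side K d t - 2 * e * (cos d / sin d)).
  by rewrite le_max lexx orbT.
by lra.
Qed.

Lemma side_le_overhang :
  side K d t <= overhang + Num.max 0 (2 * (1 - cos d) / sin d - side K d t).
Proof.
apply/ler_addgt0Pr => e e0.
set c := sin d / cos d + 4 * (cos d / sin d).
have c0 : 0 < c by rewrite addr_gt0 ?mulr_gt0 ?invr_gt0.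
have := first_variation (divr_gt0 e0 c0).
have : e / c * (sin d / cos d + 2 * (cos d / sin d)) + 2 * (e / c) * (cos d / sin d) = e.
  transitivity (e / c * c); first by rewrite /c; ring.
  by rewrite divfK// gt_eqF.
by lra.
Qed.

(** The overhang in terms of the support function near [t + pi / 2], the
    direction of the [v]-sides. *)
Lemma overhang_le M : 0 <= M ->
  h (t + pi / 2) * cos d - h (t + pi / 2 - d) + (h t - 1) * sin d + (1 - cos d) <= M * cos d ->
  h (t + pi / 2) * cos d - h (t + pi / 2 + d) - (h t - 1) * sin d + (1 - cos d) <= M * cos d ->
  overhang <= M.
Proof.
move=> M0 h1 h2; rewrite ge_max M0/=.
have a1 : sx - bl <= M.
  rewrite lerBlDr -lerBlDl /bl ler_pdivlMr// mulrBl /sx.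
  have -> : t - d + pi / 2 = t + pi / 2 - d by ring.
  by lra.
have a2 : sx - br <= M.
  rewrite lerBlDr -lerBlDl /br ler_pdivlMr// mulrBl /sx.
  have -> : t + d + pi / 2 = t + pi / 2 + d by ring.
  by lra.
by rewrite minEle; case: ifP.
Qed.

End Discrete.
End Variation.

(** * One-sided difference quotients of support functions *)
Section Quotients.
Context {R : realType}.
Implicit Types (p q : R * R) (K : set (R * R)) (Th : set R) (s t x y d e : R).

(** Since [du p (s + x) = cos x * du p s + sin x * dv p s], these quotients are
    an upper and a lower bound for [dv p s] on the edge at [s]; they replace
    the one-sided derivatives of the support function, with no error term. *)
Definition fwd K x s : R := (supp K (s + x) - supp K s * cos x) / sin x.
Definition bwd K x s : R := (supp K s * cos x - supp K (s - x)) / sin x.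
Definition tan_half x : R := (1 - cos x) / sin x.

Lemma side_quotients K x s : side K x s = fwd K x s - bwd K x s.
Proof. by rewrite /side /fwd /bwd; ring. Qed.

Lemma fwd_bwd_step K x s :
  fwd K x s = bwd K x (s + x) + tan_half x * (supp K s + supp K (s + x)).
Proof. by rewrite /fwd /bwd /tan_half addrK; ring. Qed.

Section Body.
Variables (K : set (R * R)) (bK : convex_body K).

Lemma bwd_le_edge x s p : 0 < sin x -> edge K s p -> bwd K x s <= dv p s.
Proof.
move=> sx [Kp ep]; rewrite /bwd ler_pdivrMr// -ep -/(du p s).
by have := supp_ge (s - x) bK Kp; rewrite du_rotN; lra.
Qed.

Lemma edge_le_fwd x s p : 0 < sin x -> edge K s p -> dv p s <= fwd K x s.
Proof.
move=> sx [Kp ep]; rewrite /fwd ler_pdivlMr// -ep -/(du p s).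
by have := supp_ge (s + x) bK Kp; rewrite du_rot; lra.
Qed.

Lemma bwd_le_fwd x y s : 0 < sin x -> 0 < sin y -> bwd K x s <= fwd K y s.
Proof.
move=> sx sy; have [p ep] := edge_ex s bK.
exact: le_trans (bwd_le_edge sx ep) (edge_le_fwd sy ep).
Qed.

Lemma side_ge0 x s : 0 < sin x -> 0 <= side K x s.
Proof. by move=> sx; rewrite side_quotients subr_ge0 bwd_le_fwd. Qed.

Lemma fwd_mono x y s : 0 < sin x -> 0 < sin y -> 0 <= sin (y - x) ->
  fwd K x s <= fwd K y s.
Proof.
move=> sx sy syx; rewrite /fwd ler_pdivrMr// mulrAC ler_pdivlMr//.
have := supp3 bK (s + x) (ltW sx) syx.
have -> : s + x - x = s by ring.
have -> : s + x + (y - x) = s + y by ring.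
have -> : x + (y - x) = y by ring.
by rewrite sinB; lra.
Qed.

(** The quotient based at [s + x] looks back at the edge at [s], whose points
    bound it from the other side. *)
Lemma bwd_ge_edge x s p : 0 < sin x -> 0 <= cos x -> edge K s p ->
  cos x * dv p s - sin x * supp K s <= bwd K x (s + x).
Proof.
move=> sx cx [Kp ep]; rewrite /bwd addrK ler_pdivlMr//.
have := supp_ge (s + x) bK Kp; rewrite du_rot [du p s]ep => h1.
have := ler_wpM2l cx h1.
have -> : cos x * (cos x * supp K s + sin x * dv p s) =
  supp K s * (cos x ^+ 2 + sin x ^+ 2) - supp K s * sin x ^+ 2 + cos x * sin x * dv p s by ring.
rewrite cos2Dsin2; lra.
Qed.

Lemma fwd_le_edge x s p : 0 < sin x -> 0 <= cos x -> edge K s p ->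
  fwd K x (s - x) <= cos x * dv p s + sin x * supp K s.
Proof.
move=> sx cx [Kp ep]; rewrite /fwd subrK ler_pdivrMr//.
have := supp_ge (s - x) bK Kp; rewrite du_rotN [du p s]ep => h1.
have := ler_wpM2l cx h1.
have -> : cos x * (cos x * supp K s - sin x * dv p s) =
  supp K s * (cos x ^+ 2 + sin x ^+ 2) - supp K s * sin x ^+ 2 - cos x * sin x * dv p s by ring.
rewrite cos2Dsin2; lra.
Qed.

End Body.

Lemma fwd_close K1 K2 e x s : 0 < sin x ->
  (forall t, `|supp K1 t - supp K2 t| <= e) ->
  `|fwd K1 x s - fwd K2 x s| <= 2 * e / sin x.
Proof.
move=> sx he; rewrite /fwd -mulrBl normrM (gtr0_norm (x := (sin x)^-1)) ?invr_gt0//.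
rewrite ler_pM2r ?invr_gt0//.
have -> : supp K1 (s + x) - supp K1 s * cos x - (supp K2 (s + x) - supp K2 s * cos x) =
  (supp K1 (s + x) - supp K2 (s + x)) - (supp K1 s - supp K2 s) * cos x by ring.
have h1 := he (s + x); have h2 := he s; have h3 := cos_max x.
rewrite (le_trans (ler_normB _ _))// normrM.
have := normr_ge0 (supp K1 s - supp K2 s); have := normr_ge0 (cos x); nra.
Qed.

Lemma bwd_close K1 K2 e x s : 0 < sin x ->
  (forall t, `|supp K1 t - supp K2 t| <= e) ->
  `|bwd K1 x s - bwd K2 x s| <= 2 * e / sin x.
Proof.
move=> sx he; rewrite /bwd -mulrBl normrM (gtr0_norm (x := (sin x)^-1)) ?invr_gt0//.
rewrite ler_pM2r ?invr_gt0//.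
have -> : supp K1 s * cos x - supp K1 (s - x) - (supp K2 s * cos x - supp K2 (s - x)) =
  (supp K1 s - supp K2 s) * cos x - (supp K1 (s - x) - supp K2 (s - x)) by ring.
have h1 := he (s - x); have h2 := he s; have h3 := cos_max x.
rewrite (le_trans (ler_normB _ _))// normrM.
have := normr_ge0 (supp K1 s - supp K2 s); have := normr_ge0 (cos x); nra.
Qed.

Lemma tan_halfE x : 0 < sin x -> 0 < cos x -> tan_half x = sin x / (1 + cos x).
Proof.
move=> sx cx; rewrite /tan_half; apply/eqP.
rewrite eqr_div; last 2 first.
- by rewrite gt_eqF.
- by rewrite gt_eqF// addr_gt0.
by apply/eqP; rewrite -[RHS]expr2 sin2cos2; ring.
Qed.

Lemma tan_half_le x : 0 < sin x -> 0 < cos x -> 2 * tan_half x <= sin x / cos x.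
Proof.
move=> sx cx; rewrite tan_halfE// mulrA ler_pdivrMr ?addr_gt0// mulrAC ler_pdivlMr//.
have := cos_le1 x; nra.
Qed.

Lemma tan_half_ge0 x : 0 < sin x -> 0 <= tan_half x.
Proof. by move=> sx; apply: divr_ge0; [rewrite subr_ge0 cos_le1|exact: ltW]. Qed.

(** The overhang is bounded by quotients at [t + pi / 2] on the scale [d], and
    these by the opposite quotients on any scale [x]. If the side is at most
    [2 tan (d / 2)], the inequality [side_le_overhang] has the side on both
    sides and is halved. *)
Lemma side_bound Th K t d x m : maximum_polygon_cap Th K -> Th t -> Th (t + d) ->
  0 < d -> Th (t - d) \/ t - d = 0 ->
  (forall s, Th s -> [\/ s <= t - d, s = t | t + d <= s]) ->
  0 < sin d -> 0 < cos d -> 0 < sin x -> 0 <= m ->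
  fwd K x (t + pi / 2) + supp K t - 1 <= m ->
  1 - supp K t - bwd K x (t + pi / 2) <= m ->
  side K d t <= sin d / cos d * (Num.max m ((m + 1) / 2) + tan_half d).
Proof.
move=> mK Tht Thd d0 nb gap sd cd sx m0 h1 h2.
have bK : convex_body K by case: mK => _ [[]].
have H := side_le_overhang mK Tht Thd d0 nb gap.
have T0 : 0 < sin d / cos d by rewrite divr_gt0.
have tau0 := tan_half_ge0 sd.
have ov : overhang K t d <= sin d / cos d * (m + tan_half d).
  have E : sin d / cos d * (m + tan_half d) * cos d = sin d * m + (1 - cos d).
    by rewrite /tan_half; field; rewrite !gt_eqF.
  apply: (overhang_le mK Tht Thd d0 nb).
  - by rewrite mulr_ge0 ?(ltW T0)// addr_ge0.
  - rewrite E; have := bwd_le_fwd bK (t + pi / 2) sd sx.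
    by rewrite {1}/bwd ler_pdivrMr//; nra.
  - rewrite E; have := bwd_le_fwd bK (t + pi / 2) sx sd.
    by rewrite {1}/fwd ler_pdivlMr//; nra.
have tl := tan_half_le sd cd.
have a1 : m <= Num.max m ((m + 1) / 2) by rewrite le_max lexx.
have a2 : (m + 1) / 2 <= Num.max m ((m + 1) / 2) by rewrite le_max lexx orbT.
move: H; rewrite -[2 * (1 - cos d) / sin d]mulrA -/(tan_half d).
set T := sin d / cos d in T0 ov tl *; set X := Num.max m _ in a1 a2 *.
set S := side K d t; have [S1|S1] := leP (2 * tan_half d) S.
  by rewrite max_l ?subr_le0// addr0; nra.
rewrite max_r ?subr_ge0 ?(ltW S1)//; nra.
Qed.

Lemma uniform_angleP n j : (0 < j < n)%N -> @uniform_angles R n (j%:R * (pi / 2 / n%:R)).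
Proof. by move=> /andP[j0 jn]; exists j; rewrite /= ?j0//; ring. Qed.

Lemma uniform_angle_inv n s : @uniform_angles R n s ->
  exists2 j, (0 < j < n)%N & s = j%:R * (pi / 2 / n%:R).
Proof. by move=> [j /= hj <-]; exists j => //; ring. Qed.

Lemma uniform_step n : (1 < n)%N -> 0 < pi / 2 / n%:R :> R /\ pi / 2 / n%:R <= pi / 2 / 2 :> R.
Proof.
move=> n1; have n0 : (0 : R) < n%:R by rewrite ltr0n (ltn_trans _ n1).
split; first by rewrite divr_gt0// pi2_gt0.
by rewrite ler_pM2l ?pi2_gt0// lef_pV2 ?posrE// ler_nat.
Qed.

Lemma uniform_side_bound n K j x m : maximum_polygon_cap (uniform_angles n) K ->
  (0 < j)%N -> (j.+1 < n)%N -> 0 < sin x -> 0 <= m ->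
  let d := pi / 2 / n%:R in let t := j%:R * d in
  fwd K x (t + pi / 2) + supp K t - 1 <= m ->
  1 - supp K t - bwd K x (t + pi / 2) <= m ->
  side K d t <= sin d / cos d * (Num.max m ((m + 1) / 2) + tan_half d).
Proof.
move=> mK j0 jn sx m0 d t h1 h2.
have n1 : (1 < n)%N by rewrite (leq_trans _ jn).
have [d0 d4] := @uniform_step n n1; rewrite -/d in d0 d4.
have p0 := @pi_gt0 R.
have tD i : (i%:R * d) + d = i.+1%:R * d by rewrite -natr1 mulrDl mul1r.
have tB : t - d = j.-1%:R * d.
  by rewrite /t -[in LHS](prednK j0) -tD addrK.
apply: (@side_bound (uniform_angles n) K t d x m) => //.
- by apply: uniform_angleP; rewrite j0 ltnW.
- by rewrite tD; exact: uniform_angleP.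
- rewrite tB; case: j j0 jn {h1 h2 tB t} => [//|[|j]] _ jn.
    by right; rewrite mul0r.
  by left; apply: uniform_angleP; rewrite /= ltnW// ltnW.
- move=> s /uniform_angle_inv[i _ ->].
  have [ij|ij|->] := ltngtP i j.
  + by apply: Or31; rewrite tB ler_pM2r// ler_nat -ltnS prednK.
  + by apply: Or33; rewrite tD ler_pM2r// ler_nat.
  + by apply: Or32.
- by apply: sin_gt0_acute => //; lra.
- by apply: cos_gt0_acute; lra.
Qed.

Lemma cap_nonneg K p : cap K -> K p -> 0 <= p.2.
Proof.
move=> [bK _ h0 _] Kp; have := supp_ge (3 * pi / 2) bK Kp; rewrite h0 duE.
have -> : 3 * pi / 2 = pi / 2 + pi :> R by field.
by rewrite cosDpi sinDpi cos_pihalf sin_pihalf oppr0 mulr0 add0r mulrN1 oppr_le0.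
Qed.

(** No half-plane of a polygon cap has its normal strictly between [u_0] and
    the first angle: a point of the cap slides down along the line of that
    first direction to the axis [y = 0] without leaving the cap. *)
Lemma uniform_first_side n K : (1 < n)%N -> polygon_cap (uniform_angles n) K ->
  supp K (pi / 2 / n%:R) <= supp K 0 * cos (pi / 2 / n%:R).
Proof.
move=> n1 pK; set d := pi / 2 / n%:R; have [d0 d4] := @uniform_step n n1; rewrite -/d in d0 d4.
have p0 := @pi_gt0 R.
have cK : cap K by case: pK.
have bK : convex_body K by case: cK.
have cd : 0 < cos d by apply: cos_gt0_acute; lra.
have K0 : K !=set0 by case: bK.
apply: supp_le => // p Kp.
rewrite -ler_pdivrMr//.
suff Kq : K (du p d / cos d, 0).
  by have := supp_ge 0 bK Kq; rewrite duE /= cos0 sin0 mulr0 addr0 mulr1.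
have p2 := cap_nonneg cK Kp.
have main s : d <= s -> s <= pi -> du (du p d / cos d, 0) s <= supp K s.
  move=> s1 s2; apply: (le_trans _ (supp_ge s bK Kp)).
  rewrite [leLHS]duE /= mul0r addr0 mulrAC ler_pdivrMr// !duE -subr_ge0.
  have -> : (p.1 * cos s + p.2 * sin s) * cos d - (p.1 * cos d + p.2 * sin d) * cos s
    = p.2 * sin (s - d) by rewrite sinB; ring.
  by rewrite mulr_ge0// sin_ge0_pi//; apply/andP; split; lra.
apply/(polygon_capP _ pK) => s [[|[s' + <-]]|[->|->]].
- move=> /uniform_angle_inv[j /andP[j0 jn] ->]; apply: main.
    by rewrite -[leLHS]mul1r ler_pM2r// ler1n.
  have : j%:R * (pi / 2 / n%:R) <= pi / 2 :> R.
    rewrite mulrCA ler_piMr ?(ltW pi2_gt0)// ler_pdivrMr ?ltr0n ?(ltn_trans _ n1)// mul1r ler_nat.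
    exact: ltnW.
  by lra.
- move=> /uniform_angle_inv[j /andP[j0 jn] ->]; apply: main.
    have : 0 <= j%:R * (pi / 2 / n%:R) :> R by rewrite mulr_ge0 ?ler0n// ltW.
    by lra.
  have : j%:R * (pi / 2 / n%:R) <= pi / 2 :> R.
    rewrite mulrCA ler_piMr ?(ltW pi2_gt0)// ler_pdivrMr ?ltr0n ?(ltn_trans _ n1)// mul1r ler_nat.
    exact: ltnW.
  by lra.
- by apply: main; lra.
- case: cK => _ _ -> _; rewrite duE /= mul0r addr0.
  have -> : 3 * pi / 2 = pi / 2 + pi :> R by field.
  by rewrite cosDpi cos_pihalf oppr0 mulr0.
Qed.

End Quotients.

(** * Antiderivatives *)
Section Antiderivative.
Context {R : realType}.
Notation mu := (@lebesgue_measure R).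
Implicit Types (f F G : R -> R) (a b c x : R).

Lemma antiderivative_ex f (M : R) : continuous f ->
  exists F, forall x, - M < x < M -> is_derive x 1 F (f x).
Proof.
move=> cf; pose F x := (\int[mu]_(t in `[- M, x]) f t)%R.
exists F => x /andP[x1 x2].
have fi : mu.-integrable `[- M, M] (EFin \o f).
  apply: continuous_compact_integrable; first exact: segment_compact.
  exact: continuous_subspaceT.
have [d1 d2] := continuous_FTC1_closed x2 fi x1 (cf x).
exact: (DeriveDef d1 (etrans (esym (derive1E F x)) d2)).
Qed.

Lemma antiderivative_mvt f F M : (forall x, - M < x < M -> is_derive x 1 F (f x)) ->
  forall x y, - M < x -> x < y -> y < M ->
  exists c, [/\ x < c, c < y & F y - F x = f c * (y - x)].
Proof.
move=> dF x y Mx xy yM.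
have [||c] := @MVT _ F f x y xy.
- by move=> z; rewrite in_itv/= => /andP[z1 z2]; apply: dF; lra.
- apply: derivable_within_continuous => z; rewrite in_itv/= => /andP[z1 z2].
  by apply: ex_derive; apply: dF; lra.
by rewrite in_itv/= => /andP[c1 c2] E; exists c.
Qed.

Section Integral.
Variables (f : R -> R) (L : R).
Hypotheses (mf : measurable_fun setT f) (fb : forall x, `|f x| <= L).

Definition primitive x : R := (\int[mu]_(t in `[0%R, x]) f t)%R.

Lemma integrable_itv (i : interval R) : (mu [set` i] < +oo)%E ->
  mu.-integrable [set` i] (EFin \o f).
Proof.
move=> ioo; apply: measurable_bounded_integrable => //.
  exact: measurable_funS mf.
exists L; split; first exact: num_real.
by move=> M LM x _; rewrite /= (le_trans (fb x))// ltW.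
Qed.

Lemma itvcc_lty a b : (mu (`[a, b] : set R) < +oo)%E.
Proof. by rewrite lebesgue_measure_itv/=; case: ifP => _; rewrite ?ltry. Qed.
Lemma itvoc_lty a b : (mu (`]a, b] : set R) < +oo)%E.
Proof. by rewrite lebesgue_measure_itv/=; case: ifP => _; rewrite ?ltry. Qed.

Lemma primitiveB a b : 0 <= a -> a <= b ->
  primitive b - primitive a = (\int[mu]_(t in `]a, b]) f t)%R.
Proof.
move=> a0 ab; rewrite /primitive Rintegral_itvB ?bnd_simp//.
by apply: integrable_itv; exact: itvcc_lty.
Qed.

Lemma primitiveB_cc a b : 0 <= a -> a <= b ->
  primitive b - primitive a = (\int[mu]_(t in `[a, b]) f t)%R.
Proof.
move=> a0 ab; rewrite primitiveB// Rintegral_itv_obnd_cbnd//.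
by apply: integrable_itv; exact: itvoc_lty.
Qed.

Lemma primitiveE a b : 0 <= a -> a <= b ->
  ((primitive b - primitive a)%:E = \int[mu]_(t in `]a, b]) (f t)%:E)%E.
Proof.
move=> a0 ab; rewrite primitiveB// /Rintegral fineK//.
have h := integrable_itv (itvoc_lty a b).
exact: integrable_fin_num.
Qed.

Lemma Rintegral_cst_itv a b c : a <= b -> (\int[mu]_(t in `[a, b]) c)%R = c * (b - a).
Proof.
move=> ab; rewrite Rintegral_cst//= lebesgue_measure_itv/= lte_fin.
move: ab; rewrite le_eqVlt => /orP[/eqP->|ab]; first by rewrite ltxx subrr.
by rewrite ab.
Qed.

Lemma primitive_lip a b : 0 <= a -> a <= b -> primitive b - primitive a <= L * (b - a).
Proof.
move=> a0 ab; rewrite primitiveB_cc// -Rintegral_cst_itv//.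
apply: le_Rintegral => //.
- by apply: integrable_itv; exact: itvcc_lty.
- apply: continuous_compact_integrable; first exact: segment_compact.
  by apply: continuous_subspaceT => x; exact: cvg_cst.
- by move=> x _; rewrite (le_trans (ler_norm _)).
Qed.

(** [f] is only measurable, so that the pointwise bound is integrated rather
    than deduced from a derivative of [primitive]. *)
Lemma primitive_ge (g G : R -> R) (M a b c : R) : continuous g ->
  (forall x, - M < x < M -> is_derive x 1 G (g x)) ->
  - M < a -> b < M -> 0 <= a -> a <= b ->
  (forall x, a <= x <= b -> c <= f x + g x) ->
  c * (b - a) <= primitive b - primitive a + (G b - G a).
Proof.
move=> cg dG Ma bM a0; rewrite le_eqVlt => /orP[/eqP<-|ab] hc; first by rewrite !subrr mulr0 addr0.
have ci h : continuous h -> mu.-integrable `[a, b] (EFin \o h).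
  move=> ch; apply: continuous_compact_integrable; first exact: segment_compact.
  exact: continuous_subspaceT.
have -> : G b - G a = (\int[mu]_(t in `[a, b]) g t)%R.
  rewrite /Rintegral (@continuous_FTC2 _ g G a b ab (continuous_subspaceT cg))//.
    split; [|apply: cvg_at_right_filter|apply: cvg_at_left_filter].
    - by move=> x; rewrite in_itv/= => /andP[? ?]; apply: ex_derive; apply: dG; lra.
    - apply: differentiable_continuous; apply/derivable1_diffP.
      by apply: ex_derive; apply: dG; lra.
    - apply: differentiable_continuous; apply/derivable1_diffP.
      by apply: ex_derive; apply: dG; lra.
  by move=> x; rewrite in_itv/= => /andP[? ?]; rewrite derive1E; apply: derive_val; apply: dG; lra.
have if1 : mu.-integrable `[a, b] (EFin \o f) by apply: integrable_itv; exact: itvcc_lty.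
rewrite primitiveB_cc ?(ltW ab)// -RintegralD//; last exact: ci.
rewrite -Rintegral_cst_itv ?(ltW ab)//; apply: le_Rintegral => //.
- by apply: ci => x; exact: cvg_cst.
- by apply: (integrableD _ if1 (ci g cg)).
Qed.

End Integral.
End Antiderivative.

(** * The arm length as a function of the angle *)
Section Arm.
Context {R : realType}.
Implicit Types (p q : R * R) (K : set (R * R)) (s t x : R).

Lemma local_nondecreasing (f : R -> R) (r : R) : 0 < r ->
  (forall x y, x <= y -> y <= x + r -> f x <= f y) -> nondecreasing_fun f.
Proof.
move=> r0 hf.
have H n : forall x y, x <= y -> y <= x + n%:R * r -> f x <= f y.
  elim: n => [|n IH] x y xy.
    by rewrite mul0r addr0 => yx; have -> // : x = y by apply/eqP; rewrite eq_le xy.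
  rewrite -natr1 mulrDl mul1r => yx; have [yr|ry] := leP y (x + r); first exact: hf.
  apply: (@le_trans _ _ (f (x + r))); first by apply: hf; lra.
  by apply: IH; lra.
move=> x y xy; apply: (H (Num.bound ((y - x) / r))) => //.
rewrite -lerBlDl -ler_pdivrMr// ltW// unstable.ltr_bound//.
Qed.

(** Where the support function is differentiable, its derivative. *)
Definition omega K t : R := dv (vplus K t) t.

Lemma gplusE K t : gplus K t = supp K t + omega K (t + pi / 2).
Proof.
rewrite /gplus -/(du _ t) /ycorner duB -[supp K t *: _ + _]/(frame t _ _) du_frame.
by rewrite /omega dv_pihalf.
Qed.

Lemma body_constant K : convex_body K -> exists2 B, 1 <= B &
  [/\ forall t, `|supp K t| <= B, forall s t, `|supp K t - supp K s| <= B * `|t - s|,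
      forall p t, K p -> `|dv p t| <= B &
      forall p s t, K p -> `|dv p t - dv p s| <= B * `|t - s|].
Proof.
move=> bK; have [b b0 hb] := norm_bound bK.
exists (1 + 2 * b); first by lra.
have le x : 0 <= x -> 2 * b * x <= (1 + 2 * b) * x by move=> x0; rewrite ler_wpM2r//; lra.
split.
- by move=> t; have := supp_norm bK t hb; lra.
- by move=> s t; rewrite (le_trans (supp_lip bK _ _ hb))// le.
- by move=> p t Kp; have [h1 h2] := hb _ Kp; have := dv_le t h1 h2; lra.
- move=> p s t Kp; have [h1 h2] := hb _ Kp; rewrite -!du_pihalf.
  rewrite (le_trans (du_lip _ _ h1 h2))//.
  have -> : t + pi / 2 - (s + pi / 2) = t - s by ring.
  exact: le.
Qed.

(** The boundary is traversed counterclockwise: each of the two points is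
    extreme in its own direction. *)
Lemma edge_mono K s t p q : convex_body K -> edge K s p -> edge K t q ->
  s < t -> t <= s + pi / 2 -> dv p s <= dv q s /\ dv p t <= dv q t.
Proof.
move=> bK [Kp ep] [Kq eq] st ts; have [x tE] : exists x, t = s + x by exists (t - s); ring.
subst t; have [x0 x2] : 0 < x /\ x <= pi / 2 by split; lra.
have := supp_ge (s + x) bK Kp; have := supp_ge s bK Kq.
rewrite -ep -eq -/(du p s) -/(du q (s + x)) => h1 h2.
have sx := sin_gt0_acute x0 x2.
have cx : 0 <= cos x.
  by rewrite cos_ge0_pihalf// x2 andbT (le_trans _ (ltW x0))// oppr_le0 ltW// pi2_gt0.
split; rewrite -(ler_pM2l sx).
  by move: h2; rewrite !du_rot; have := ler_wpM2l cx h1; lra.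
have := ler_wpM2l cx h2; move: h1.
have E : s = (s + x) - x by ring.
by rewrite {1 2}E !du_rotN; lra.
Qed.

(** The boundary point advances, and the rotation of the frame costs at most
    [B] per unit of angle: [omega] is the difference of two nondecreasing
    functions. *)
Lemma omega_measurable K : convex_body K -> measurable_fun setT (omega K).
Proof.
move=> bK; have [B B1 [_ _ _ dvl]] := body_constant bK.
have -> : omega K = (fun t => (omega K t + B * t) - B * t).
  by apply/funext => t; rewrite addrK.
apply: measurable_funB; last exact: mulrl_measurable.
apply: nondecreasing_measurable => //.
apply: (@local_nondecreasing _ (pi / 2)) => [|s t]; first exact: pi2_gt0.
rewrite le_eqVlt => /orP[/eqP->//|st] ts.
have [h1 _] := edge_mono bK (vplus_edge s bK) (vplus_edge t bK) st ts.
have [Kt _] := vplus_edge t bK.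
have := dvl _ s t Kt; rewrite (ger0_norm (x := t - s)) ?subr_ge0 ?(ltW st)//.
rewrite ler_norml => /andP[h2 _]; rewrite /omega; lra.
Qed.

Lemma gplus_measurable K : convex_body K -> measurable_fun setT (gplus K).
Proof.
move=> bK.
have -> : gplus K = (fun t => supp K t + omega K (1 * t + pi / 2)).
  by apply/funext => t; rewrite gplusE mul1r.
apply: measurable_funD.
  by apply: continuous_measurable_fun; exact: supp_continuous.
by apply: measurableT_comp; [exact: omega_measurable|exact: affine_measurable].
Qed.

Lemma k0_ge (x m r : R) : 0 <= r -> m = `|x - 1| + r ->
  Num.max m ((m + 1) / 2) <= k0 x + r.
Proof.
move=> r0 ->.
have h1 : `|x - 1| <= k0 x by rewrite /k0 le_max lexx.
have h2 : (`|x - 1| + 1) / 2 <= k0 x by rewrite /k0 le_max lexx orbT.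
by rewrite ge_max; apply/andP; split; lra.
Qed.

Lemma k0_ge0 (x : R) : 0 <= k0 x.
Proof. by rewrite /k0 le_max normr_ge0. Qed.

Lemma k0_le (x : R) : k0 x <= `|x| + 2.
Proof.
have : `|x - 1| <= `|x| + 1 by rewrite (le_trans (ler_normB _ _))// normr1.
by rewrite /k0 ge_max => h; apply/andP; split; have := normr_ge0 x; lra.
Qed.

Lemma k0_gplus_measurable K : convex_body K -> measurable_fun setT (fun t => k0 (gplus K t)).
Proof.
move=> bK; have m1 : measurable_fun setT (fun t => `|gplus K t - 1|).
  apply: measurableT_comp; first exact: normr_measurable.
  by apply: measurable_funB => //; exact: gplus_measurable.
rewrite /k0; apply: measurable_maxr => //.
by apply: measurable_funM => //; exact: measurable_funD.
Qed.

Lemma k0_gplus_bounded K : convex_body K ->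
  exists2 L, 1 <= L & forall t, `|k0 (gplus K t)| <= L.
Proof.
move=> bK; have [B B1 [hB _ dB _]] := body_constant bK.
exists (2 * B + 2) => [|t]; first by lra.
rewrite ger0_norm ?k0_ge0// (le_trans (k0_le _))// lerD2r gplusE.
rewrite (le_trans (ler_normD _ _))//.
have [Kt _] := vplus_edge (t + pi / 2) bK.
by have := hB t; have := dB _ (t + pi / 2) Kt; rewrite /omega; lra.
Qed.

Lemma balanced_approx K e : balanced_maximum_cap K -> 0 < e ->
  exists n A, [/\ (1 < n)%N, maximum_polygon_cap (uniform_angles n) A,
    hausdorff_dist A K <= e & pi / 2 / n%:R <= e].
Proof.
move=> [_ [n [A [_ n0 ninc mA hA]]]] e0.
have ni i : (i < n i)%N.
  elim: i => [|i IH]; first exact: ltnW.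
  exact: leq_ltn_trans IH (ninc i).
have n1 i : (1 < n i)%N.
  elim: i => [//|i IH]; exact: ltn_trans IH (ninc i).
move/cvgrPdist_le : hA => /(_ e e0) [N _ hN].
pose i := maxn N (Num.bound (pi / 2 / e)).
exists (n i), (A i); split => //.
  have := hN i (leq_maxl _ _); rewrite sub0r normrN => h.
  exact: le_trans (ler_norm _) h.
have np : (0 : R) < (n i)%:R by rewrite ltr0n (ltn_trans _ (n1 i)).
rewrite ler_pdivrMr// [e * _]mulrC -ler_pdivrMr// ltW//.
rewrite (lt_le_trans (unstable.ltr_bound _))// ler_nat.
by rewrite (leq_trans (leq_maxr N _))// ltnW.
Qed.

End Arm.

(** * Passage to the limit *)

(** The error terms of [increment_approx], with the values of all functions at
    [a], [b] and at the grid angles [M] near [b] and [N] near [a] abstracted to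
    numbers. *)
Lemma collect_errors {R : realType} (w B L c FM FN Fa Fb SM SN HM HN Ha Hb P Q Dm Dk : R) :
  0 < w -> w <= 1 / 8 -> 1 <= B -> 1 <= L -> 1 - w <= c -> c <= 1 ->
  FM - Fb <= L * (2 * w) -> Fa - FN <= L * (2 * w) -> Fb - Fa <= L * 2 ->
  SM - SN <= 12 * B * w -> 0 <= FM + SM - (FN + SN) ->
  `|HM - HN| <= B * 2 -> `|HM - Hb| <= B * (2 * w) -> `|Ha - HN| <= B * (2 * w) ->
  P - 6 * B * w <= Dm -> Dk <= Q + 6 * B * w ->
  Dm - Dk <= (FM + SM - (FN + SN)) / c - c * (HM - HN) + 2 * (16 * B * w) ->
  P - Q + (Hb - Ha) <= Fb - Fa + 100 * (B + L) * w.
Proof.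
move=> w0 w1 B1 L1 c1 c2 f1 f2 f3 sm ph hMN hM hN mm kk st.
have c0 : 0 < c by lra.
have Lw : L * w <= L * (1 / 8) by rewrite ler_wpM2l//; lra.
have Bw : B * w <= B * (1 / 8) by rewrite ler_wpM2l//; lra.
have Lw0 : 0 <= L * w by rewrite mulr_ge0//; lra.
have Bw0 : 0 <= B * w by rewrite mulr_ge0//; lra.
set E := FM + SM - (FN + SN) in ph st.
have ph1 : E <= Fb - Fa + 4 * L * w + 12 * B * w by rewrite /E; lra.
have ph2 : E <= 3 * (B + L) by lra.
have ph3 : E / c <= E + 2 * w * (3 * (B + L)).
  apply: (@le_trans _ _ (E * (1 + 2 * w))).
    by rewrite ler_wpM2l// -[leLHS]mul1r ler_pdivrMr//; clear -c1 w0 w1; nra.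
  rewrite mulrDr mulr1 lerD2l [E * _]mulrC ler_wpM2l//; lra.
have hc : (1 - c) * (HM - HN) <= w * (B * 2).
  apply: (le_trans (ler_norm _)); rewrite normrM ler_pM//.
  by rewrite ger0_norm ?subr_ge0//; lra.
move: hM hN; rewrite !ler_norml => /andP[hM _] /andP[hN _].
lra.
Qed.

Section Limit.
Context {R : realType}.
Implicit Types (p q : R * R) (s t x y : R).

(* The bound [10] only has to exceed all angles that occur. *)
Variables (K : set (R * R)) (H : R -> R) (B L : R).
Hypotheses (bK : convex_body K)
  (dH : forall x, - 10 < x < 10 -> is_derive x 1 H (supp K x)).
Hypotheses (B1 : 1 <= B) (hB : forall t, `|supp K t| <= B)
  (hlip : forall s t, `|supp K t - supp K s| <= B * `|t - s|)
  (dvB : forall p t, K p -> `|dv p t| <= B).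
Hypotheses (L1 : 1 <= L) (fL : forall t, `|k0 (gplus K t)| <= L).

Let h := supp K.
Let f t := k0 (gplus K t).
Let F := primitive f.
Let mf : measurable_fun setT f. Proof. exact: k0_gplus_measurable. Qed.
Let p1 : 1 <= pi / 2 :> R. Proof. exact: pihalf_ge1. Qed.
Let p2 : pi / 2 < 2 :> R. Proof. exact: pihalf_lt2. Qed.

Lemma H_increment x y : - 10 < x -> x <= y -> y < 10 ->
  exists2 c, x <= c <= y & H y - H x = h c * (y - x).
Proof.
move=> x10; rewrite le_eqVlt => /orP[/eqP->|xy] y10.
  by exists y; rewrite ?lexx// !subrr mulr0.
have [c [c1 c2 ->]] := antiderivative_mvt dH x10 xy y10.
by exists c => //; rewrite !ltW.
Qed.

Lemma H_lip x y : - 10 < x -> x <= y -> y < 10 -> `|H y - H x| <= B * (y - x).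
Proof.
move=> x10 xy y10; have [c _ ->] := H_increment x10 xy y10.
by rewrite normrM (ger0_norm (x := y - x)) ?subr_ge0// ler_wpM2r ?subr_ge0// hB.
Qed.

Lemma F_increment x y : 0 <= x -> x <= y -> F y - F x <= L * (y - x).
Proof. exact: primitive_lip. Qed.

Section Scale.
(* The scale of the difference quotients of the support function. *)
Variable w : R.
Hypotheses (w0 : 0 < w) (w1 : w <= 1 / 8).

Let sw : 0 < sin w. Proof. by apply: sin_gt0_acute => //; have := w1; have := p1; lra. Qed.
Let cw : 1 / 2 <= cos w.
Proof. by have := cos_ge1B (ltW w0); have := w1; lra. Qed.
Let sw2 : w <= 2 * sin w.
Proof.
have : w * cos w <= sin w by apply: sin_ge; rewrite (ltW w0)/=; have := w1; have := p1; lra.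
have := w0; have := cw; nra.
Qed.

(** An antiderivative of the spread [side K w (x + pi / 2)] of the two
    quotients that bracket the arm length. *)
Definition smear x : R :=
  (H (x + (pi / 2 + w)) + H (x + (pi / 2 - w)) - 2 * cos w * H (x + pi / 2)) / sin w.

Lemma smear_derive x : - 5 < x < 5 -> is_derive x 1 smear (side K w (x + pi / 2)).
Proof.
move=> /andP[x1 x2].
have sh c : 0 <= c <= 3 -> is_derive x 1 (fun x => H (x + c)) (h (x + c)).
  move=> /andP[c0 c3]; have dHc : is_derive (x + c) 1 H (h (x + c)) by apply: dH; lra.
  rewrite -[h _]mulr1; exact: (@is_derive1_comp R H (shift c) x _ 1 dHc (is_derive_shift _ _ _)).
have h1 : is_derive x 1 (fun x => H (x + (pi / 2 + w))) (h (x + (pi / 2 + w))).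
  by apply: sh; have := w0; have := w1; have := p1; have := p2; lra.
have h2 : is_derive x 1 (fun x => H (x + (pi / 2 - w))) (h (x + (pi / 2 - w))).
  by apply: sh; have := w0; have := w1; have := p1; have := p2; lra.
have h3 : is_derive x 1 (fun x => H (x + pi / 2)) (h (x + pi / 2)).
  by apply: sh; have := p1; have := p2; lra.
have -> : smear = (sin w)^-1 *: ((fun x => H (x + (pi / 2 + w))) +
   (fun x => H (x + (pi / 2 - w))) - (2 * cos w) *: (fun x => H (x + pi / 2))).
  by apply/funext => y; rewrite /smear mulrC.
apply: is_derive_eq.
rewrite /side /h /GRing.scale /=.
have -> : x + (pi / 2 + w) = x + pi / 2 + w by ring.
have -> : x + (pi / 2 - w) = x + pi / 2 - w by ring.
by ring.
Qed.

Lemma side_continuous : continuous (fun x => side K w (x + pi / 2)).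
Proof.
have hc c : continuous (fun x => h (x + c)).
  move=> x; apply: continuous_comp; last exact: supp_continuous.
  by apply: cvgD; [exact: cvg_id|exact: cvg_cst].
have h1 : continuous (fun x => supp K (x + pi / 2 + w)).
  have -> : (fun x => supp K (x + pi / 2 + w)) = (fun x => h (x + (pi / 2 + w))).
    by apply/funext => y; rewrite addrA.
  exact: hc.
have h2 : continuous (fun x => supp K (x + pi / 2 - w)).
  have -> : (fun x => supp K (x + pi / 2 - w)) = (fun x => h (x + (pi / 2 - w))).
    by apply/funext => y; rewrite addrA.
  exact: hc.
move=> x; apply: cvgM; last exact: cvg_cst.
apply: cvgB; first by apply: cvgD; [exact: h1|exact: h2].
apply: cvgM; last exact: cvg_cst.
by apply: cvgM; [exact: cvg_cst|exact: hc].
Qed.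

(** At each end the increment is a second difference of [H] on the scale [w],
    of order [w^2] as the support function is Lipschitz, divided by
    [sin w]. *)
Lemma smear_increment x y : 0 <= x -> x <= y -> y <= 2 -> smear y - smear x <= 12 * B * w.
Proof.
move=> x0 xy y2; have := (w0, w1, p1, p2) => -[[[w0' w1'] p1'] p2'].
have end_ s : 0 <= s <= 4 -> `|H (s + w) + H (s - w) - 2 * H s| <= 2 * B * w ^+ 2.
  move=> /andP[s0 s4].
  have [|||c1 /andP[c11 c12] e1] := @H_increment s (s + w); try lra.
  have [|||c2 /andP[c21 c22] e2] := @H_increment (s - w) s; try lra.
  have -> : H (s + w) + H (s - w) - 2 * H s = (H (s + w) - H s) - (H s - H (s - w)) by ring.
  rewrite e1 e2; have -> : s + w - s = w by ring.
  have -> : s - (s - w) = w by ring.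
  rewrite -mulrBl normrM (gtr0_norm w0) expr2 mulrA ler_pM2r//.
  rewrite (le_trans (hlip _ _))// ger0_norm; last lra.
  by have B1' := B1; rewrite -mulrA [2 * _]mulrC -mulrA ler_wpM2l; lra.
have E u : smear u * sin w = (H (u + pi / 2 + w) + H (u + pi / 2 - w) - 2 * H (u + pi / 2))
    + 2 * (1 - cos w) * H (u + pi / 2).
  rewrite /smear divfK ?gt_eqF//.
  have -> : u + (pi / 2 + w) = u + pi / 2 + w by ring.
  have -> : u + (pi / 2 - w) = u + pi / 2 - w by ring.
  by ring.
rewrite -(ler_pM2r sw) mulrBl !E.
have a1 : `|H (y + pi / 2 + w) + H (y + pi / 2 - w) - 2 * H (y + pi / 2)| <= 2 * B * w ^+ 2.
  by apply: end_; lra.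
have a2 : `|H (x + pi / 2 + w) + H (x + pi / 2 - w) - 2 * H (x + pi / 2)| <= 2 * B * w ^+ 2.
  by apply: end_; lra.
have a3 : `|H (y + pi / 2) - H (x + pi / 2)| <= B * 2.
  have : `|H (y + pi / 2) - H (x + pi / 2)| <= B * (y + pi / 2 - (x + pi / 2)) by apply: H_lip; lra.
  by move=> /le_trans; apply; rewrite ler_wpM2l; have := B1; lra.
have a4 : 1 - cos w <= w ^+ 2 / 2 by have := cos_ge1B2 w; lra.
have a5 := cos_le1 w.
move: a1 a2 a3; rewrite !ler_norml => /andP[_ a1] /andP[a2 _] /andP[_ a3].
have a6 : (1 - cos w) * (H (y + pi / 2) - H (x + pi / 2)) <= w ^+ 2 / 2 * (B * 2).
  apply: (@le_trans _ _ ((1 - cos w) * (B * 2))); first by rewrite ler_wpM2l// subr_ge0.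
  by rewrite ler_wpM2r// mulr_ge0//; have := B1; lra.
have a7 : B * w ^+ 2 <= B * w * (2 * sin w).
  by rewrite expr2 mulrA ler_wpM2l ?sw2// mulr_ge0//; have := B1; lra.
by lra.
Qed.

Section Approximation.
Variables (n : nat) (A : set (R * R)) (e : R).
Hypotheses (n1 : (1 < n)%N) (mA : maximum_polygon_cap (uniform_angles n) A)
  (hA : forall t, `|supp A t - supp K t| <= e).
Let d : R := pi / 2 / n%:R.
Hypotheses (ew : e <= w * sin w) (dw : d <= w * sin w).

Let pA : polygon_cap (uniform_angles n) A. Proof. by case: mA. Qed.
Let bA : convex_body A. Proof. by case: pA => -[]. Qed.
Let e0 : 0 <= e. Proof. exact: le_trans (normr_ge0 _) (hA 0). Qed.
Let d0 : 0 < d. Proof. by have [] := @uniform_step R n n1. Qed.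
Let wsw : w * sin w <= w.
Proof. by rewrite ler_piMr ?sin_le1// ltW. Qed.
Let d8 : d <= 1 / 8. Proof. by have := dw; have := wsw; have := w1; lra. Qed.
Let sd : 0 < sin d. Proof. by apply: sin_gt0_acute => //; have := d8; have := p1; lra. Qed.
Let cd : 1 - d <= cos d. Proof. by apply: cos_ge1B; exact: ltW. Qed.
Let cd0 : 0 < cos d. Proof. by have := cd; have := d8; lra. Qed.
Let sdd : sin d <= d. Proof. by apply: sin_le; exact: ltW. Qed.

Lemma supp_close t : supp A t <= h t + e /\ h t - e <= supp A t.
Proof. by have := hA t; rewrite ler_norml /h => /andP[? ?]; split; lra. Qed.

Lemma fwd_shift s t : `|t - s| <= d -> fwd K w t <= fwd K w s + 2 * B * w.
Proof.
move=> ts; rewrite -lerBlDl /fwd -mulrBl ler_pdivrMr//.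
have := hlip (s + w) (t + w); have := hlip s t.
have -> : t + w - (s + w) = t - s by ring.
rewrite !ler_norml => /andP[k1 k2] /andP[k3 k4].
have k5 : B * `|t - s| <= B * (w * sin w).
  by rewrite ler_wpM2l ?(le_trans ts)//; have := B1; lra.
have := cw; have := cos_le1 w; nra.
Qed.

Lemma bwd_shift s t : `|t - s| <= d -> bwd K w s - 2 * B * w <= bwd K w t.
Proof.
move=> ts; rewrite lerBlDl -lerBlDr /bwd -mulrBl ler_pdivrMr//.
have := hlip (t - w) (s - w); have := hlip t s.
have -> : s - w - (t - w) = s - t by ring.
rewrite (distrC s t) !ler_norml => /andP[k1 k2] /andP[k3 k4].
have k5 : B * `|t - s| <= B * (w * sin w).
  by rewrite ler_wpM2l ?(le_trans ts)//; have := B1; lra.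
have := cw; have := cos_le1 w; nra.
Qed.

Lemma quotient_err : 2 * e / sin w <= 2 * w.
Proof. by rewrite ler_pdivrMr// -mulrA ler_pM2l. Qed.

(** The quotients on the scale [w] move from [A] to [K] and from the grid
    angle to [x] at the cost of [O(w)], as [e] and [d] are at most [w sin w];
    for [K] they bracket [omega K (x + pi / 2) = gplus K x - h x] with spread
    [side K w (x + pi / 2)]. *)
Lemma side_pointwise j x : (j.+2 < n)%N -> j%:R * d <= x <= j.+1%:R * d ->
  side A d (j.+1%:R * d) <=
    sin d / cos d * (f x + side K w (x + pi / 2) + 6 * B * w + tan_half d).
Proof.
move=> jn /andP[x1 x2]; set t := j.+1%:R * d in x2 *.
have xt : `|t - x| <= d.
  by rewrite ger0_norm ?subr_ge0//; move: x1; rewrite /t -natr1 mulrDl mul1r; lra.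
have xt2 : `|t + pi / 2 - (x + pi / 2)| <= d.
  by have -> : t + pi / 2 - (x + pi / 2) = t - x by ring.
have sK := side_ge0 bK (x + pi / 2) sw.
pose r := side K w (x + pi / 2) + 6 * B * w.
have r0 : 0 <= r by rewrite addr_ge0// mulr_ge0 ?(ltW w0)//; have := B1; lra.
have eW : e <= w by have := ew; have := wsw; lra.
have dW : B * `|t - x| <= B * w.
  by rewrite ler_wpM2l//; [have := B1; lra|rewrite (le_trans xt)//; have := dw; have := wsw; lra].
have Bw : w <= B * w by rewrite ler_peMl// ltW.
have hx := hlip x t; move: hx; rewrite ler_norml => /andP[hx1 hx2].
have [sA1 sA2] := supp_close t.
have ev := vplus_edge (x + pi / 2) bK.
have o1 : omega K (x + pi / 2) = gplus K x - h x by rewrite gplusE addrAC subrr add0r.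
have := bwd_le_edge bK sw ev; have := edge_le_fwd bK sw ev.
rewrite -/(omega K _) o1 => o2 o3; have sE := side_quotients K w (x + pi / 2).
have := fwd_shift xt2; have := bwd_shift xt2 => b1 b2.
have := fwd_close (t + pi / 2) sw hA; have := bwd_close (t + pi / 2) sw hA.
rewrite !ler_norml => /andP[b3 b4] /andP[b5 b6]; have qe := quotient_err.
have nx := ler_norm (gplus K x - 1); have nx' := ler_norm (1 - gplus K x).
rewrite distrC in nx'.
have m0 : 0 <= `|gplus K x - 1| + r by rewrite addr_ge0.
have := uniform_side_bound mA (ltn0Sn j) jn sw m0; rewrite -/d -/t => main.
apply: (le_trans (main _ _)).
- by move: sA1 hx2 b6 b2 sE o3; rewrite /r /h; lra.
- by move: sA2 hx1 b3 b1 sE o2; rewrite /r /h; lra.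
rewrite ler_pM2l ?divr_gt0// lerD2r -(addrA (f x)) -/r.
exact: (@k0_ge _ (gplus K x) _ r).
Qed.

Let Phi x : R := F x + smear x.

Lemma Phi_mono x y : 0 <= x -> x <= y -> y <= 2 -> 0 <= Phi y - Phi x.
Proof.
move=> x0 xy y2.
have := @primitive_ge R f L mf fL (fun x => side K w (x + pi / 2)) smear 5 x y 0
  side_continuous smear_derive; rewrite mul0r /Phi => P.
rewrite opprD addrACA; apply: P => //; try lra.
by move=> z _; rewrite addr_ge0 ?k0_ge0//; exact: side_ge0.
Qed.

(** By [fwd_bwd_step], the increment of [fwd A d] over one grid step is the side
    of [A] minus a trapezoidal approximation of the integral of its support
    function; the side is bounded by integrating [side_pointwise] over the
    step. *)
Lemma fwd_step j : (j.+2 < n)%N ->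
  fwd A d (j.+1%:R * d) - fwd A d (j%:R * d) <=
  (Phi (j.+1%:R * d) - Phi (j%:R * d)) / cos d
  - cos d * (H (j.+1%:R * d) - H (j%:R * d)) + d * (16 * B * w).
Proof.
move=> jn; set t := j.+1%:R * d; set u := j%:R * d.
have tE : t = u + d by rewrite /t -natr1 mulrDl mul1r.
have u0 : 0 <= u by rewrite mulr_ge0 ?ler0n// ltW.
have t2 : t <= pi / 2.
  rewrite /t /d mulrCA ler_piMr ?(ltW pi2_gt0)// ler_pdivrMr ?ltr0n ?(ltn_trans _ n1)//.
  by rewrite mul1r ler_nat ltnW// ltnW.
have ut : u <= t by rewrite tE lerDl ltW.
have tu : t - u = d by rewrite tE addrAC subrr add0r.
have td : tan_half d <= d.
  rewrite tan_halfE// ler_pdivrMr ?addr_gt0//.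
  by have := sdd; have := d0; have := cd0; nra.
have tau0 := tan_half_ge0 sd.
set T := sin d / cos d; have T0 : 0 < T by rewrite divr_gt0.
have Td : T <= d / cos d by rewrite ler_pM2r ?invr_gt0.
have part1 : side A d t <= (Phi t - Phi u) / cos d + d / cos d * (6 * B * w + d).
  have P := @primitive_ge R f L mf fL (fun x => side K w (x + pi / 2)) smear 5 u t
    (side A d t / T - (6 * B * w + tan_half d)) side_continuous smear_derive.
  have := P _ _ u0 ut _; rewrite tu => {}P.
  have Q : (side A d t / T - (6 * B * w + tan_half d)) * d <= Phi t - Phi u.
    rewrite [leRHS](_ : _ = F t - F u + (smear t - smear u)); last by rewrite /Phi; ring.
    apply: P; [lra|have := p2; lra|move=> x ux].
    have := side_pointwise jn ux; rewrite -/t -/T => sp.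
    rewrite lerBlDr ler_pdivrMr// mulrC (le_trans sp)// ler_pM2l//; lra.
  have PM := Phi_mono u0 ut (le_trans t2 (ltW p2)).
  have -> : side A d t = (side A d t / T - (6 * B * w + tan_half d)) * d * (T / d)
     + T * (6 * B * w + tan_half d).
    by field; rewrite !gt_eqF.
  apply: lerD.
    apply: (@le_trans _ _ ((Phi t - Phi u) * (T / d))).
      by rewrite ler_pM2r// divr_gt0.
    by rewrite ler_wpM2l// ler_pdivrMr// [_ * d]mulrC.
  have Bw0 : 0 <= 6 * B * w by rewrite !mulr_ge0 ?(ltW w0)//; have := B1; lra.
  apply: (@le_trans _ _ (d / cos d * (6 * B * w + tan_half d))).
    by rewrite ler_wpM2r// addr_ge0.
  by rewrite ler_wpM2l ?lerD2l// divr_ge0// ltW.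
have nn s : 0 <= s <= pi / 2 -> 0 <= supp A s.
  move=> /andP[s0 s2]; case: mA => _ _ A01 _.
  apply: (le_trans _ (supp_ge s bA A01)); rewrite duE /= mul0r add0r mul1r.
  by rewrite sin_ge0_pi// s0/=; have := p1; lra.
have part2 : cos d * (H t - H u) - 2 * B * (d * w) <= tan_half d * (supp A u + supp A t).
  have [|//||c /andP[c1 c2] ->] := @H_increment u t; [lra|have := p2; lra|].
  rewrite tu.
  have nu : 0 <= supp A u by apply: nn; rewrite u0 (le_trans ut).
  have nt : 0 <= supp A t by apply: nn; rewrite t2 (le_trans u0).
  have th : d * cos d / 2 <= tan_half d.
    rewrite tan_halfE// ler_pdivlMr ?addr_gt0//.
    have : d * cos d <= sin d by apply: sin_ge; rewrite (ltW d0)/=; have := d8; have := p1; lra.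
    by have := cos_le1 d; have := cd0; have := d0; have := sd; nra.
  apply: (@le_trans _ _ (d * cos d / 2 * (supp A u + supp A t))); last first.
    by rewrite ler_wpM2r// addr_ge0.
  have [_ sA1] := supp_close u; have [_ sA2] := supp_close t.
  have eW : e <= w by have := ew; have := wsw; lra.
  have l1 := hlip u c; have l2 := hlip t c.
  have n1' : `|c - u| <= w by rewrite ger0_norm; have := dw; have := wsw; lra.
  have n2' : `|c - t| <= w by rewrite distrC ger0_norm; have := dw; have := wsw; lra.
  have B0 : 0 <= B by have := B1; lra.
  have := ler_wpM2l B0 n1'; have := ler_wpM2l B0 n2' => m2 m1.
  move: l1 l2; rewrite !ler_norml => /andP[_ l1] /andP[_ l2].
  have wB : w <= B * w by rewrite ler_peMl// ltW.
  have key : h c - 2 * B * w <= (supp A u + supp A t) / 2 by move: sA1 sA2 l1 l2; rewrite /h; lra.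
  have cd1 := cos_le1 d.
  have := ler_wpM2l (mulr_ge0 (ltW d0) (ltW cd0)) key.
  have : 2 * B * w * (d * cos d) <= 2 * B * w * d.
    rewrite ler_wpM2l// ?ler_piMr ?(ltW d0)//.
    by rewrite !mulr_ge0 ?(ltW w0).
  lra.
rewrite (fwd_bwd_step A d u) -tE; have := side_quotients A d t.
have fin : d / cos d * (6 * B * w + d) <= d * (14 * B * w).
  rewrite -mulrA ler_pM2l// mulrC ler_pdivrMr//.
  have wB : w <= B * w by rewrite ler_peMl// ltW.
  have dB : d <= B * w by have := dw; have := wsw; lra.
  have : 7 / 8 <= cos d by have := cd; have := d8; lra.
  have : 0 < B * w by rewrite mulr_gt0//; have := B1; lra.
  by nra.
by lra.
Qed.

Lemma fwd_steps k m : (k <= m)%N -> (m.+1 < n)%N ->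
  fwd A d (m%:R * d) - fwd A d (k%:R * d) <=
  (Phi (m%:R * d) - Phi (k%:R * d)) / cos d
  - cos d * (H (m%:R * d) - H (k%:R * d)) + (m - k)%:R * d * (16 * B * w).
Proof.
elim: m => [|m IH]; first by rewrite leqn0 => /eqP-> _; rewrite !subrr subn0 !mul0r mulr0 subrr addr0.
rewrite leq_eqVlt => /orP[/eqP->|km] mn; first by rewrite !subrr subnn !mul0r mulr0 subrr addr0.
have := IH km (ltnW mn); have := fwd_step mn.
rewrite subSn// -natr1; lra.
Qed.

Let dw' : d <= w. Proof. exact: le_trans dw wsw. Qed.
Let B0 : 0 <= B. Proof. exact: le_trans ler01 B1. Qed.

Lemma near_scale z g x : w <= z -> z <= 2 * w -> `|g| <= B -> `|x| <= B ->
  [/\ sin w <= sin z, 0 <= cos z, 2 * e / sin z <= 2 * w &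
    `|cos z * g + sin z * x - g| <= 4 * B * w].
Proof.
move=> z1 z2 hg hx; have := (w0, w1, p1) => -[[w0' w1'] p1'].
have sz : sin w <= sin z.
  by rewrite leNgt ltr_sin ?in_itv/= -?leNgt//; apply/andP; split; lra.
have z0 : 0 <= z by lra.
have cz := cos_ge1B z0.
split => //; first by lra.
  apply: le_trans quotient_err.
  by rewrite ler_wpM2l ?mulr_ge0// lef_pV2 ?posrE//; apply: lt_le_trans sz.
have -> : cos z * g + sin z * x - g = sin z * x - (1 - cos z) * g by ring.
rewrite (le_trans (ler_normB _ _))// !normrM.
have s1 : `|sin z| <= 2 * w.
  by have := sin_lip z 0; rewrite sin0 !subr0 (ger0_norm (x := z))//; lra.
have s2 : `|1 - cos z| <= 2 * w.
  by rewrite ger0_norm ?subr_ge0 ?cos_le1//; lra.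
have := ler_pM (normr_ge0 _) (normr_ge0 _) s1 hx.
have := ler_pM (normr_ge0 _) (normr_ge0 _) s2 hg; lra.
Qed.

(** A grid angle between [b + w] and [b + 2 w] is far enough from [b] for the
    quotient of [A] over that distance to be within [O(w)] of the one of [K],
    which bounds the position of the edge at [b]. *)
Lemma far_end b p : 0 <= b -> b + 4 * w <= pi / 2 -> edge K b p ->
  exists m, [/\ (m.+1 < n)%N, b + w <= m%:R * d, m%:R * d <= b + 2 * w &
    dv p b - 6 * B * w <= fwd A d (m%:R * d)].
Proof.
move=> b0 bw ep; have := (w0, dw', d0) => -[[w0' dww] d0'].
pose m := (Num.truncn ((b + w) / d)).+1.
have [m1 m2] : b + w <= m%:R * d /\ m%:R * d <= b + 2 * w.
  have : 0 <= (b + w) / d by apply: divr_ge0; lra.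
  move/truncn_itv => /andP[]; rewrite ler_pdivlMr// ltr_pdivrMr// -/m => t1 t2.
  split; first exact: ltW.
  by rewrite /m -natr1 mulrDl mul1r; lra.
exists m; split => //.
  have np : (0 : R) < n%:R by rewrite ltr0n (ltn_trans _ n1).
  have nd : n%:R * d = pi / 2 by rewrite /d mulrC divfK// gt_eqF.
  rewrite -(ltr_nat R) -(ltr_pM2r d0) nd -natr1 mulrDl mul1r.
  apply: (@le_lt_trans _ _ (b + 3 * w)); last by lra.
  by apply: (@le_trans _ _ (b + 2 * w + d)); [rewrite lerD2r|lra].
have [z zE] : exists z, z = m%:R * d - b by exists (m%:R * d - b).
have -> : m%:R * d = b + z by rewrite zE; ring.
have [z1 z2] : w <= z /\ z <= 2 * w by rewrite zE; split; lra.
have hb' : `|- h b| <= B by rewrite normrN.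
have [sz cz err] := near_scale z1 z2 (dvB b ep.1) hb'.
rewrite ler_norml => /andP[c2 _].
have sz0 : 0 < sin z := lt_le_trans sw sz.
apply: (le_trans _ (bwd_le_fwd bA (b + z) sz0 sd)).
have := bwd_close (b + z) sz0 hA; rewrite ler_norml => /andP[c1 _].
have c3 := bwd_ge_edge bK sz0 cz ep.
have wB : w <= B * w by rewrite ler_peMl// ltW.
by move: c1 c2 c3 err wB; rewrite /h; lra.
Qed.

(** Symmetric to [far_end], except that there is no grid angle before [0]; at
    [a = 0] the quotient is nonpositive by [uniform_first_side]. *)
Lemma near_end a q : 0 <= a -> (a = 0 /\ 0 <= dv q a) \/ w <= a -> edge K a q ->
  exists k, [/\ k%:R * d <= a, a - k%:R * d <= 2 * w &
    fwd A d (k%:R * d) <= dv q a + 6 * B * w].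
Proof.
move=> a0 aw eq; have := (w0, w1, dw', d0, p1) => -[[[[w0' w1'] dww] d0'] p1'].
case: aw => [[aE q0]|aw].
  exists 0%N; rewrite mul0r aE; rewrite aE in q0; split; [by []|by lra|].
  apply: (@le_trans _ _ 0); last first.
    by rewrite addr_ge0// !mulr_ge0// ltW.
  rewrite /fwd add0r ler_pdivrMr// mul0r subr_le0.
  exact: (@uniform_first_side _ n A n1 pA).
pose k := Num.truncn ((a - w) / d).
have [k1 k2] : k%:R * d <= a - w /\ a - k%:R * d <= 2 * w.
  have : 0 <= (a - w) / d by apply: divr_ge0; lra.
  move/truncn_itv => /andP[]; rewrite ler_pdivlMr// ltr_pdivrMr// -/k.
  by rewrite -natr1 mulrDl mul1r => t1 t2; split; lra.
exists k; split => //; first by lra.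
have [z zE] : exists z, z = a - k%:R * d by exists (a - k%:R * d).
have -> : k%:R * d = a - z by rewrite zE; ring.
have [z1 z2] : w <= z /\ z <= 2 * w by rewrite zE; split; lra.
have [sz cz err] := near_scale z1 z2 (dvB a eq.1) (hB a).
rewrite ler_norml => /andP[_ c2].
have sz0 : 0 < sin z := lt_le_trans sw sz.
have szd : 0 <= sin (z - d) by rewrite sin_ge0_pi//; apply/andP; split; lra.
apply: (le_trans (fwd_mono bA (a - z) sd sz0 szd)).
have := fwd_close (a - z) sz0 hA; rewrite ler_norml => /andP[_ c1].
have c3 := fwd_le_edge bK sz0 cz eq.
have wB : w <= B * w by rewrite ler_peMl// ltW.
by move: c1 c2 c3 err wB; rewrite /h; lra.
Qed.

Lemma increment_approx a b p q : 0 <= a -> a <= b -> b + 4 * w <= pi / 2 ->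
  (a = 0 /\ 0 <= dv q a) \/ w <= a -> edge K b p -> edge K a q ->
  dv p b - dv q a + (H b - H a) <= F b - F a + 100 * (B + L) * w.
Proof.
move=> a0 ab bw aw ep eq.
have [m [mn m1 m2 mm]] := far_end (le_trans a0 ab) bw ep.
have [k [k1 k2 kk]] := near_end a0 aw eq.
have k0 : 0 <= k%:R * d by rewrite mulr_ge0 ?ler0n// ltW.
have w0' := w0; have L0 : 0 <= L by rewrite (le_trans ler01).
have km : (k <= m)%N by rewrite -(ler_nat R) -(ler_pM2r d0); move: m1 k1 ab w0'; lra.
have st := fwd_steps km mn.
have mk : (m - k)%:R * d * (16 * B * w) <= 2 * (16 * B * w).
  rewrite ler_wpM2r ?mulr_ge0 ?(ltW w0)// natrB// mulrBl.
  by move: m2 k0 bw w0' (p2); lra.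
move: (m%:R * d) (k%:R * d) => M N in st m1 m2 mm k1 k2 kk k0.
have MN : [/\ N <= M, M <= 2, b <= M, - 10 < N & M < 10].
  by move: m1 m2 k1 k2 k0 ab bw w0' (p2); split; lra.
case: MN => NM M2 bM N10 M10.
have b2 : b <= 2 by exact: le_trans bM M2.
have d2 : [/\ M - b <= 2 * w, M - N <= 2, b - a <= 2, - 10 < b & a < 10].
  by move: m1 m2 k1 k2 k0 a0 ab M2 b2 w0'; split; lra.
case: d2 => d21 d22 d23 b10 a10.
have f1 : F M - F b <= L * (2 * w).
  by apply: (le_trans (F_increment (le_trans a0 ab) bM)); exact: ler_wpM2l.
have f2 : F a - F N <= L * (2 * w).
  by apply: (le_trans (F_increment k0 k1)); exact: ler_wpM2l.
have f3 : F b - F a <= L * 2.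
  by apply: (le_trans (F_increment a0 ab)); exact: ler_wpM2l.
have sm := smear_increment k0 NM M2.
have ph := Phi_mono k0 NM M2.
have hMN : `|H M - H N| <= B * 2.
  by apply: (le_trans (H_lip N10 NM M10)); exact: ler_wpM2l.
have hM : `|H M - H b| <= B * (2 * w).
  by apply: (le_trans (H_lip b10 bM M10)); exact: ler_wpM2l.
have hN : `|H a - H N| <= B * (2 * w).
  by apply: (le_trans (H_lip N10 k1 a10)); exact: ler_wpM2l.
have cd1 : 1 - w <= cos d by apply: le_trans cd; rewrite lerD2l lerN2.
exact: (collect_errors (w0) (w1) (B1) (L1) cd1 (cos_le1 d) f1 f2 f3 sm ph hMN hM hN mm kk
  (le_trans st (lerD (lexx _) mk))).
Qed.

End Approximation.
End Scale.
End Limit.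

(** * Regularity of the boundary of a balanced maximum cap *)
Section Increment.
Context {R : realType}.
Implicit Types (p q : R * R) (K : set (R * R)) (s t x y a b : R).

(** The scale [w] is chosen first, then a maximum polygon cap that is close to
    [K] on this scale; the total error is a multiple of [w]. *)
Lemma edge_increment K H a b p q : balanced_maximum_cap K ->
  (forall x, - 10 < x < 10 -> is_derive x 1 H (supp K x)) ->
  0 <= a -> a <= b -> b < pi / 2 -> edge K b p -> edge K a q ->
  dv p b - dv q a + (H b - H a) <=
    primitive (fun t => k0 (gplus K t)) b - primitive (fun t => k0 (gplus K t)) a.
Proof.
move=> balK dH a0 ab b2 ep eq; have [cK _] := balK; have [bK _ _ _] := cK.
have [B B1 [hB hlip dvB _]] := body_constant bK.
have [L L1 fL] := k0_gplus_bounded bK.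
apply/ler_addgt0Pr => e e0.
have C0 : 0 < 100 * (B + L) by lra.
pose w1 := Num.min (1 / 8) (Num.min ((pi / 2 - b) / 4) (e / (100 * (B + L)))).
pose w := if a == 0 then w1 else Num.min w1 a.
have w10 : 0 < w1 by rewrite !lt_min; apply/and3P; split; [lra|lra|exact: divr_gt0].
have w0 : 0 < w.
  by rewrite /w; case: eqVneq => // an0; rewrite lt_min w10 lt_neqAle eq_sym an0.
have ww : w <= w1 by rewrite /w; case: ifP => // _; rewrite ge_min lexx.
have : w <= w1 := ww; rewrite !le_min => /and3P[l1 l2 l3].
have sw : 0 < sin w by apply: sin_gt0_acute => //; have := pihalf_ge1 R; lra.
have [n [A [n1 mA hA hd]]] := balanced_approx balK (mulr_gt0 w0 sw).
have bA : convex_body A by case: mA => _ [[]].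
have hA' t : `|supp A t - supp K t| <= w * sin w.
  exact: le_trans (supp_hausdorff t bA bK) hA.
have aw : (a = 0 /\ 0 <= dv q a) \/ w <= a.
  rewrite /w; case: eqVneq => [->|_]; [left; split => //|by right; rewrite ge_min lexx orbT].
  by case: eq => Kq _; rewrite dvE sin0 cos0 mulr0 add0r mulr1; exact: (cap_nonneg cK).
have := @increment_approx R K H B L bK dH B1 hB hlip dvB L1 fL w w0 l1 n A _ n1 mA hA'
  (lexx _) hd a b p q a0 ab _ aw ep eq.
have -> : b + 4 * w <= pi / 2 by lra.
move=> /(_ isT) /le_trans; apply; rewrite lerD2l.
by move: l3; rewrite ler_pdivlMr// mulrC.
Qed.

(** [edge_increment] on a degenerate interval. *)
Lemma edge_unique K t p q : balanced_maximum_cap K -> 0 <= t -> t < pi / 2 ->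
  edge K t p -> edge K t q -> p = q.
Proof.
move=> balK t0 t2 ep eq; have [[bK _ _ _] _] := balK.
have [H dH] := @antiderivative_ex R (supp K) 10 (supp_continuous bK).
have := edge_increment balK dH t0 (lexx t) t2 ep eq.
have := edge_increment balK dH t0 (lexx t) t2 eq ep.
rewrite !subrr !addr0 !subr_le0 => h1 h2.
apply: (@point_eq _ p q t); first by case: ep => _ e1; case: eq => _ e2; rewrite /du e1 e2.
by apply/eqP; rewrite eq_le h1 h2.
Qed.

(** Over [N] equal pieces the quadratic bounds add up to [O(1 / N)]. *)
Lemma quadratic_increment (D : R -> R) (a b r C : R) : a <= b -> 0 < r ->
  (forall x y, a <= x -> x <= y -> y <= b -> y - x <= r -> D y - D x <= C * (y - x) ^+ 2) ->
  D b <= D a.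
Proof.
move=> ab r0 hD; apply/ler_addgt0Pr => e e0.
pose N := (Num.bound ((b - a) / r) + Num.bound (`|C| * (b - a) ^+ 2 / e)).+1.
have N0 : (0 : R) < N%:R by rewrite ltr0n.
have N1 : (b - a) / r <= N%:R.
  rewrite ltW// (lt_le_trans (unstable.ltr_bound _))// ler_nat /N leqW// leq_addr//.
have N2 : `|C| * (b - a) ^+ 2 / e <= N%:R.
  rewrite ltW// (lt_le_trans (unstable.ltr_bound _))// ler_nat /N leqW// leq_addl//.
pose d := (b - a) / N%:R.
have d0 : 0 <= d by rewrite divr_ge0 ?subr_ge0// ltW.
have dr : d <= r by rewrite ler_pdivrMr// [r * _]mulrC -ler_pdivrMr.
have Nd : N%:R * d = b - a by rewrite mulrC divfK// gt_eqF.
have H j : (j <= N)%N -> D (a + j%:R * d) - D a <= j%:R * (`|C| * d ^+ 2).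
  elim: j => [|j IH] jN; first by rewrite !mul0r addr0 subrr.
  have jd : a + j.+1%:R * d <= b.
    by rewrite -lerBrDl -Nd ler_wpM2r// ler_nat.
  have E : a + j.+1%:R * d - (a + j%:R * d) = d by rewrite -natr1; ring.
  have j0 : 0 <= j%:R * d by rewrite mulr_ge0.
  have := hD (a + j%:R * d) (a + j.+1%:R * d).
  rewrite E => /(_ _ _ jd dr) st.
  have {}st : D (a + j.+1%:R * d) - D (a + j%:R * d) <= `|C| * d ^+ 2.
    apply: (le_trans (st _ _)); [by rewrite lerDl|by rewrite lerD2l ler_wpM2r// ler_nat|].
    by rewrite ler_wpM2r ?sqr_ge0// ler_norm.
  have IHj := IH (ltnW jN).
  by rewrite -[in leRHS]natr1 [leRHS]mulrDl mul1r; lra.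
have E : a + (b - a) = b by ring.
have := H N (leqnn N); rewrite Nd E => /le_trans h.
rewrite -lerBlDl; apply: h.
rewrite mulrCA expr2 [N%:R * _]mulrA Nd.
have -> : `|C| * ((b - a) * d) = `|C| * (b - a) ^+ 2 / N%:R by rewrite /d; ring.
by rewrite ler_pdivrMr// [e * _]mulrC -ler_pdivrMr.
Qed.

End Increment.

(** * Local parallel sets over short arcs *)
Section Sandwich.
Context {R : realType}.
Implicit Types (p q : R * R) (s t x y a b : R).

(** [g] is only controlled on [[x, y]]; composing it with the clipping map
    makes it Lipschitz everywhere. *)
Lemma lip_ivt (g : R -> R) (C x y : R) : x <= y -> 0 < C ->
  (forall s t, x <= s -> s <= t -> t <= y -> `|g t - g s| <= C * (t - s)) ->
  0 < g x -> g y <= 0 -> exists t, [/\ x < t, t <= y & g t = 0].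
Proof.
move=> xy C0 hg gx gy.
pose clip t := if t <= x then x else if y <= t then y else t.
have clip_in t : x <= clip t /\ clip t <= y.
  by rewrite /clip; case: (leP t x) => h1; [|case: (leP y t) => h2]; split; lra.
have clip_id t : x <= t -> t <= y -> clip t = t.
  move=> xt ty; rewrite /clip; case: (leP t x) => h1; [|case: (leP y t) => h2] => //.
    by apply/eqP; rewrite eq_le xt h1.
  by apply/eqP; rewrite eq_le ty h2.
have clip_mono s t : s <= t -> clip s <= clip t /\ clip t - clip s <= t - s.
  move=> st; rewrite /clip.
  case: (leP t x) => h1; first by rewrite (le_trans st h1) lexx subrr subr_ge0.
  case: (leP s x) => h3.
    by case: (leP y t) => h2; split; lra.
  by case: (leP y t) => h2; case: (leP y s) => h4; split; lra.
have cg : continuous (g \o clip).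
  apply: (@lip_continuous _ C) => // t s.
  wlog st : s t / s <= t.
    move=> W; have [|/ltW] := leP s t; first exact: W.
    by rewrite distrC (distrC t); exact: W.
  have [m1 m2] := clip_mono s t st.
  have [s1 s2] := clip_in s; have [t1 t2] := clip_in t.
  rewrite /= (le_trans (hg _ _ s1 m1 t2))// (ger0_norm (x := t - s)) ?subr_ge0//.
  by rewrite ler_pM2l.
have [||t] := @IVT R (g \o clip) x y 0 xy.
- exact: continuous_subspaceT.
- rewrite /= !clip_id//; apply/andP; split.
    by rewrite ge_min gy orbT.
  by rewrite le_max (ltW gx).
rewrite in_itv/= => /andP[xt ty]; rewrite clip_id// => gt; exists t; split => //.
rewrite lt_neqAle xt andbT; apply/negP => /eqP E.
by move: gx; rewrite E gt ltxx.
Qed.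

(** The arc length of the boundary up to its edge in direction [t], up to a
    constant, when [H] is an antiderivative of the support function: where the
    boundary is smooth, its radius of curvature is [h + h''] and [omega] is
    [h']. *)
Definition arclength (K : set (R * R)) (H : R -> R) t : R := omega K t + H t.

Variables (K : set (R * R)) (H : R -> R) (B L : R).
Hypotheses (bK : convex_body K)
  (dH : forall x, - 10 < x < 10 -> is_derive x 1 H (supp K x)).
Hypotheses (B1 : 1 <= B)
  (hlip : forall s t, `|supp K t - supp K s| <= B * `|t - s|)
  (dvlip : forall p s t, K p -> `|dv p t - dv p s| <= B * `|t - s|)
  (hB : forall t, `|supp K t| <= B).
Let h := supp K.
Notation G := (arclength K H).
Hypotheses (uniq : forall t p, 0 <= t -> t < pi / 2 -> edge K t p -> p = vplus K t)
  (L1 : 1 <= L)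
  (Glip : forall a b, 0 <= a -> a <= b -> b < pi / 2 -> G b - G a <= L * (b - a)).

Lemma dv_derive q (c : R) : is_derive c 1 (dv q) (- du q c).
Proof.
have -> : dv q = (- q.1) *: @sin R + q.2 *: @cos R by apply/funext => t; rewrite dvE.
have -> : - du q c = (- q.1) *: cos c + q.2 *: (- sin c).
  by rewrite duE /GRing.scale/= opprD mulNr mulrN.
by apply: is_deriveD.
Qed.

(** The derivative of [dv q + H] is the distance [h - du q] of [q] to the
    support line, which is nonnegative, and Lipschitz with value [0] at a
    direction whose edge contains [q]. *)
Lemma dv_H_increment q x y : K q -> - 10 < x -> x <= y -> y < 10 ->
  0 <= dv q y + H y - (dv q x + H x) /\
  (edge K y q -> dv q y + H y - (dv q x + H x) <= 2 * B * (y - x) ^+ 2).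
Proof.
move=> Kq x10; rewrite le_eqVlt => /orP[/eqP->|xy] y10.
  by rewrite !subrr expr0n mulr0 lexx.
have D (c : R) : - 10 < c < 10 -> is_derive c 1 (dv q \+ H) (h c - du q c).
  by move=> /dH dHc; have := dv_derive q c; rewrite addrC => dq; apply: is_deriveD.
have [c [xc cy]] := antiderivative_mvt D x10 xy y10; rewrite /= => ->.
split.
  rewrite mulr_ge0 ?subr_ge0//; last exact: ltW.
  exact: (supp_ge c bK Kq).
move=> [_ eq]; rewrite expr2 mulrA ler_pM2r ?subr_gt0//.
have l1 := hlip y c.
have l2 := dvlip (c + pi / 2) (y + pi / 2) Kq.
rewrite !dv_pihalf [du q y]eq in l2.
have e1 : `|c - y| <= y - x by rewrite distrC ger0_norm; lra.
have e2 : `|y + pi / 2 - (c + pi / 2)| <= y - x.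
  have -> : y + pi / 2 - (c + pi / 2) = y - c by ring.
  by rewrite ger0_norm; lra.
have B0 : 0 <= B := le_trans ler01 B1.
have := ler_wpM2l B0 e1; have := ler_wpM2l B0 e2.
move: l1 l2; rewrite !ler_norml /h => /andP[_ l1] /andP[l2 _]; lra.
Qed.

Lemma G_mono x y : - 10 < x -> x <= y -> y < 10 -> y <= x + pi / 2 -> G x <= G y.
Proof.
move=> x10; rewrite le_eqVlt => /orP[/eqP->//|xy] y10 yx.
have ey := vplus_edge y bK.
have [h1 _] := dv_H_increment ey.1 x10 (ltW xy) y10.
have [h2 _] := edge_mono bK (vplus_edge x bK) ey xy yx.
by rewrite /arclength /omega; lra.
Qed.

Section Arc.
Variables x y r : R.
Hypotheses (x0 : 0 <= x) (xy : x <= y) (y2 : y < pi / 2) (yx : y - x <= 1 / 2) (r0 : 0 < r).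
Let p4 : pi / 2 < 2 :> R. Proof. exact: pihalf_lt2. Qed.
Let p1 : 1 <= pi / 2 :> R. Proof. exact: pihalf_ge1. Qed.
Let th := y - x.
Let th0 : 0 <= th. Proof. by rewrite subr_ge0. Qed.

(** The boundary arc between the normals [x] and [y], in the frame at [x]: it
    advances by at most the arc length and recedes from the support line at
    [x] quadratically. *)
Lemma arc_point t : x < t -> t <= y ->
  [/\ dv (vplus K x) x <= dv (vplus K t) x,
      dv (vplus K t) x - omega K x <= G y - G x &
      h x - 2 * L * th ^+ 2 <= du (vplus K t) x].
Proof.
move=> xt ty; have := (x0, y2, yx, p4, p1) => -[[[[x0' y2'] yx'] p4'] p1'].
have et := vplus_edge t bK; have ex := vplus_edge x bK.
have [h1 _] := edge_mono bK ex et xt ltac:(lra).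
have Gt : G t <= G y by apply: G_mono; lra.
have [h2 _] := @dv_H_increment (vplus K t) x t et.1 ltac:(lra) (ltW xt) ltac:(lra).
have h3 : dv (vplus K t) x - omega K x <= G t - G x by rewrite /arclength /omega; lra.
split => //; first by lra.
have tx0 : 0 <= t - x by lra.
have tx : t - x <= th by rewrite /th; lra.
have c2 : 1 / 2 <= cos (t - x) by have := cos_ge1B tx0; lra.
have s1 : sin (t - x) <= t - x by exact: sin_le.
have s0 : 0 <= sin (t - x) by rewrite sin_ge0_pi// tx0/=; lra.
have gl : G t - G x <= L * (t - x) by apply: Glip => //; lra.
have gl' : G t - G x <= L * th.
  by apply: (le_trans gl); rewrite ler_wpM2l// (le_trans ler01).
have := supp_ge t bK ex.1; rewrite -[supp K t](et.2) -/(du _ t).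
have tE : t = x + (t - x) by ring.
rewrite [X in du _ X <= _]tE [X in _ <= du _ X]tE !du_rot [du (vplus K x) x]ex.2 -/h => key.
set D := dv (vplus K t) x - omega K x in h3.
have D0 : 0 <= D by rewrite /D /omega; lra.
have DL : D <= L * th by lra.
have sD : sin (t - x) * D <= th * (L * th).
  by apply: ler_pM => //; lra.
set U := du (vplus K t) x in key *.
have k2 : cos (t - x) * (h x - U) <= L * th ^+ 2 by rewrite /D /omega in sD; lra.
have [hU|hU] := leP (h x) U.
  by rewrite (le_trans _ hU)// gerBl !mulr_ge0// ?(le_trans ler01 L1)// sqr_ge0.
have : 1 / 2 * (h x - U) <= cos (t - x) * (h x - U) by rewrite ler_wpM2r// subr_ge0 ltW.
by lra.
Qed.

Lemma parallel_sub_box : local_parallel_set K r `]x, y]%classic `<=`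
  box x `[h x - 2 * L * th ^+ 2, h x + r] `[omega K x, omega K x + (G y - G x) + r * th].
Proof.
move=> p [t [q [s [/=]]]]; rewrite in_itv/= => /andP[xt ty] eq /andP[s0 sr] ->.
have := (x0, y2, yx, p4, p1) => -[[[[x0' y2'] yx'] p4'] p1'].
have -> : q = vplus K t by apply: uniq => //; lra.
have [a1 a2 a3] := arc_point xt ty.
have s3 : 0 <= sin (t - x) by rewrite sin_ge0_pi//; apply/andP; split; lra.
have s4 : sin (t - x) <= th.
  by apply: (@le_trans _ _ (t - x)); [apply: sin_le; lra|rewrite /th; lra].
have c0 : 0 <= cos (t - x).
  by rewrite ltW// cos_gt0_acute//; lra.
have c1 := cos_le1 (t - x).
have Kt : K (vplus K t) by have [] := vplus_edge t bK.
have hx := supp_ge x bK Kt; rewrite -/h in hx.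
have Ex : x - t = - (t - x) by ring.
split; rewrite /= in_itv/= ?duD ?dvD ?duZ ?dvZ ?du_uvec ?dv_uvec Ex ?cosN ?sinN ?opprK.
  have : 0 <= s * cos (t - x) by rewrite mulr_ge0// ltW.
  have : s * cos (t - x) <= s by rewrite ler_piMr// ltW.
  by move=> ? ?; apply/andP; split; lra.
have : 0 <= s * sin (t - x) by rewrite mulr_ge0// ltW.
have : s * sin (t - x) <= r * th by rewrite ler_pM// ltW.
by move=> ? ?; apply/andP; split; [rewrite /omega|]; lra.
Qed.

(** For [p] in the box, [dv p t - omega K t] changes sign between [x] and [y];
    at a zero, [p] lies on the normal through the edge at [t]. *)
Lemma box_sub_parallel :
  box x `]h x, h x + (r * cos th - 2 * L * th ^+ 2)] `]omega K x, dv (vplus K y) x]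
  `<=` local_parallel_set K r `]x, y]%classic.
Proof.
move=> p [/=]; rewrite !in_itv/= => /andP[u1 u2] /andP[v1 v2].
have := (x0, xy, y2, yx, p4, p1, B1, L1) => -[[[[[[[x0' xy'] y2'] yx'] p4'] p1'] B1'] L1'].
have ey := vplus_edge y bK.
have cth : 0 <= cos th by rewrite ltW// cos_gt0_acute// /th; lra.
have sth : 0 <= sin th by rewrite sin_ge0_pi// th0/= /th; lra.
pose C := 2 * (`|p.1| + `|p.2|) + (L + B).
have C0 : 0 < C by rewrite /C; have := normr_ge0 p.1; have := normr_ge0 p.2; lra.
have [t [xt ty pt]] : exists t, [/\ x < t, t <= y & dv p t - omega K t = 0].
  apply: (@lip_ivt (fun t => dv p t - omega K t) C x y xy C0).
  - move=> s t xs st ty.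
    have g1 : G s <= G t by apply: G_mono; lra.
    have g2 : G t - G s <= L * (t - s) by apply: Glip; lra.
    have g3 : `|H t - H s| <= B * (t - s).
      move: st; rewrite le_eqVlt => /orP[/eqP->|st]; first by rewrite !subrr normr0 mulr0.
      have s10 : - 10 < s by lra.
      have t10 : t < 10 by lra.
      have [c [_ _ ->]] := antiderivative_mvt dH s10 st t10.
      by rewrite normrM (gtr0_norm (x := t - s)) ?subr_gt0// ler_pM2r ?subr_gt0.
    have b1 : `|p.1| <= `|p.1| + `|p.2| by rewrite lerDl.
    have b2 : `|p.2| <= `|p.1| + `|p.2| by rewrite lerDr.
    have g4 := du_lip (t + pi / 2) (s + pi / 2) b1 b2.
    rewrite !du_pihalf in g4.
    have E : t + pi / 2 - (s + pi / 2) = t - s by ring.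
    rewrite E (ger0_norm (x := t - s)) ?subr_ge0// in g4.
    move: g3 g4; rewrite !ler_norml /C /arclength in g1 g2 * => /andP[k1 k2] /andP[k3 k4].
    by rewrite !mulrDl in k3 k4 *; apply/andP; split; lra.
  - by rewrite subr_gt0.
  - rewrite subr_le0 /omega.
    have yE : y = x + th by rewrite /th; ring.
    rewrite [X in dv _ X]yE [X in _ <= dv _ X]yE !dv_rot.
    have hy := supp_ge x bK ey.1; rewrite -/h in hy.
    have := ler_wpM2l cth v2.
    have : sin th * du (vplus K y) x <= sin th * du p x by rewrite ler_wpM2l//; lra.
    lra.
have et := vplus_edge t bK.
have [_ _ a3] := arc_point xt ty.
pose s := du p t - h t.
have pE : p = vplus K t + s *: uvec t.
  apply: (@point_eq _ _ _ t).
    rewrite duD duZ du_uvec subrr cos0 mulr1 /s [du (vplus K t) t]et.2; rewrite -/h; ring.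
  by rewrite dvD dvZ dv_uvec subrr sin0 oppr0 mulr0 addr0; move: pt; rewrite /omega; lra.
have ct : 0 < cos (t - x) by rewrite cos_gt0_acute//; lra.
have sx : du p x - du (vplus K t) x = s * cos (t - x).
  by rewrite {1}pE duD duZ du_uvec addrAC subrr add0r -cosN opprB.
have hx := supp_ge x bK et.1; rewrite -/h in hx.
exists t, (vplus K t), s; split => //.
- by rewrite /= in_itv/= xt.
- apply/andP; split.
    by rewrite -(pmulr_lgt0 _ ct) -sx subr_gt0; lra.
  rewrite -(ler_pM2r ct) -sx.
  have cc : cos th <= cos (t - x).
    rewrite leNgt ltr_cos ?in_itv/=; [rewrite -leNgt /th; lra| |]; apply/andP; rewrite ?/th; split; lra.
  by have := ler_wpM2l (ltW r0) cc; lra.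
Qed.

End Arc.
End Sandwich.

(** * Measurability of local parallel sets *)
Section ParallelMeasurable.
Context {R : realType}.
Notation mu := (@lebesgue_measure R).
Notation mu2 := (mu \x mu)%E.
Implicit Types (p q : R * R) (s t x y a b r : R) (X Y : set R).

Variable (K : set (R * R)).
Hypothesis bK : convex_body K.
Let h := supp K.

Lemma parallel_bigcup (I : Type) (D : set I) r (X : I -> set R) :
  local_parallel_set K r (\bigcup_(i in D) X i) = \bigcup_(i in D) local_parallel_set K r (X i).
Proof.
apply/seteqP; split => p.
  by move=> [t [q [s [[i Di Xt] e s0 ->]]]]; exists i => //; exists t, q, s.
by move=> [i Di [t [q [s [Xt e s0 ->]]]]]; exists t, q, s; split => //; exists i.
Qed.

Lemma parallel_setU r X Y :
  local_parallel_set K r (X `|` Y) = local_parallel_set K r X `|` local_parallel_set K r Y.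
Proof.
apply/seteqP; split => p.
  by move=> [t [q [s [[Xt|Yt] e s0 ->]]]]; [left|right]; exists t, q, s.
by move=> [] [t [q [s [Xt e s0 ->]]]]; exists t, q, s; split => //; [left|right].
Qed.

Lemma parallel_bounded r X : bounded_plane (local_parallel_set K r X).
Proof.
have [b b0 hb] := norm_bound bK.
exists (b + `|r|) => p [t [q [s [_ [Kq _] /andP[s0 sr] ->]]]].
have [h1 h2] := hb _ Kq.
have sn : `|s| <= `|r| by rewrite gtr0_norm// (le_trans sr)// ler_norm.
have g u : `|u| <= 1 -> `|s * u| <= `|r|.
  by move=> hu; rewrite normrM (le_trans _ sn)// ler_piMr.
by split; rewrite /= (le_trans (ler_normD _ _))// lerD//; apply: g;
  [exact: cos_max|exact: sin_max].
Qed.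

(** Each of the two feet lies behind the support line of the other, so that
    [s <= s' cos (t - t')] and [s' <= s cos (t - t')]. *)
Lemma parallel_angle_unique r t t' p : `|t - t'| < pi / 2 ->
  local_parallel_set K r [set t] p -> local_parallel_set K r [set t'] p -> t = t'.
Proof.
move=> tt [_ [q [s [-> [Kq eq] /andP[s0 _] pE]]]] [_ [q' [s' [-> [Kq' eq'] /andP[s'0 _] pE']]]].
have h1 := supp_ge t bK Kq'; have h2 := supp_ge t' bK Kq.
have e1 : du p t = h t + s by rewrite pE duD duZ du_uvec subrr cos0 mulr1 [du q t]eq.
have e2 : du p t' = h t' + s' by rewrite pE' duD duZ du_uvec subrr cos0 mulr1 [du q' t']eq'.
have f1 : du p t = du q' t + s' * cos (t - t') by rewrite pE' duD duZ du_uvec.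
have f2 : du p t' = du q t' + s * cos (t' - t) by rewrite pE duD duZ du_uvec.
have cE : cos (t' - t) = cos (t - t') by rewrite -cosN opprB.
rewrite cE in f2; have c1 := cos_le1 (t - t').
have k1 : s <= s' * cos (t - t') by rewrite /h in e1 e2 *; lra.
have k2 : s' <= s * cos (t - t') by rewrite /h in e1 e2 *; lra.
have cc : cos `|t - t'| = cos 0.
  rewrite cos_norm cos0; apply/eqP; rewrite eq_le c1 /=.
  have ss : s' <= s by rewrite (le_trans k2)// ler_piMr// ltW.
  by rewrite -(ler_pM2l s'0) mulr1; lra.
have /eqP : `|t - t'| = 0.
  apply: cos_inj cc; rewrite in_itv/= ?lexx ?normr_ge0 ?pi_ge0//=.
  by rewrite (le_trans (ltW tt))//; have := @pi_gt0 R; lra.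
by rewrite normr_eq0 subr_eq0 => /eqP.
Qed.

(** Direction, foot and distance; distance [0] is included for compactness. *)
Definition normal_triples a b r : set (R * ((R * R) * R)) :=
  (`[a, b]%classic `*` (K `*` `[0, r]%classic)) `&`
  [set z | du z.2.1 z.1 - supp K z.1 = 0].

Definition normal_point (z : R * ((R * R) * R)) : R * R :=
  (z.2.1.1 + z.2.2 * cos z.1, z.2.1.2 + z.2.2 * sin z.1).

Lemma normal_triples_compact a b r : compact (normal_triples a b r).
Proof.
apply: compact_closedI.
  apply: compact_setX; first exact: segment_compact.
  by apply: compact_setX; [case: bK|exact: segment_compact].
pose g (z : R * ((R * R) * R)) := du z.2.1 z.1 - supp K z.1.
apply: (@preimage_closed _ _ g [set 0]) => [z _|]; last exact: closed_eq.
have c1 : fst @ z --> z.1 by exact: cvg_fst.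
have c2 : (fun z : R * ((R * R) * R) => z.2.1) @ z --> z.2.1.
  by apply: (@cvg_comp _ _ _ snd fst _ (nbhs z.2)); [exact: cvg_snd|exact: cvg_fst].
have c21 : (fun z : R * ((R * R) * R) => z.2.1.1) @ z --> z.2.1.1.
  by apply: (@cvg_comp _ _ _ (fun z : R * ((R * R) * R) => z.2.1) fst _ (nbhs z.2.1)) => //; exact: cvg_fst.
have c22 : (fun z : R * ((R * R) * R) => z.2.1.2) @ z --> z.2.1.2.
  by apply: (@cvg_comp _ _ _ (fun z : R * ((R * R) * R) => z.2.1) snd _ (nbhs z.2.1)) => //; exact: cvg_snd.
have cc : (fun z : R * ((R * R) * R) => cos z.1) @ z --> cos z.1.
  by apply: (@cvg_comp _ _ _ fst _ _ (nbhs z.1)) => //; exact: continuous_cos.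
have cs : (fun z : R * ((R * R) * R) => sin z.1) @ z --> sin z.1.
  by apply: (@cvg_comp _ _ _ fst _ _ (nbhs z.1)) => //; exact: continuous_sin.
have ch : (fun z : R * ((R * R) * R) => supp K z.1) @ z --> supp K z.1.
  by apply: (@cvg_comp _ _ _ fst _ _ (nbhs z.1)) => //; exact: supp_continuous.
exact: (cvgB (cvgD (cvgM c21 cc) (cvgM c22 cs)) ch).
Qed.

Lemma normal_point_continuous : continuous normal_point.
Proof.
move=> z.
have c1 : fst @ z --> z.1 by exact: cvg_fst.
have c2 : (fun z : R * ((R * R) * R) => z.2.1) @ z --> z.2.1.
  by apply: (@cvg_comp _ _ _ snd fst _ (nbhs z.2)); [exact: cvg_snd|exact: cvg_fst].
have c3 : (fun z : R * ((R * R) * R) => z.2.2) @ z --> z.2.2.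
  by apply: (@cvg_comp _ _ _ snd snd _ (nbhs z.2)); [exact: cvg_snd|exact: cvg_snd].
have c21 : (fun z : R * ((R * R) * R) => z.2.1.1) @ z --> z.2.1.1.
  by apply: (@cvg_comp _ _ _ (fun z : R * ((R * R) * R) => z.2.1) fst _ (nbhs z.2.1)) => //; exact: cvg_fst.
have c22 : (fun z : R * ((R * R) * R) => z.2.1.2) @ z --> z.2.1.2.
  by apply: (@cvg_comp _ _ _ (fun z : R * ((R * R) * R) => z.2.1) snd _ (nbhs z.2.1)) => //; exact: cvg_snd.
have cc : (fun z : R * ((R * R) * R) => cos z.1) @ z --> cos z.1.
  by apply: (@cvg_comp _ _ _ fst _ _ (nbhs z.1)) => //; exact: continuous_cos.
have cs : (fun z : R * ((R * R) * R) => sin z.1) @ z --> sin z.1.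
  by apply: (@cvg_comp _ _ _ fst _ _ (nbhs z.1)) => //; exact: continuous_sin.
exact: (cvg_pair (cvgD c21 (cvgM c3 cc)) (cvgD c22 (cvgM c3 cs))).
Qed.

(** The difference of two compact sets: distance at most [r], and
    distance [0]. *)
Lemma parallel_cc_measurable a b r : measurable (local_parallel_set K r `[a, b]%classic).
Proof.
have mI r' : measurable (normal_point @` normal_triples a b r').
  apply: compact_measurable_plane; apply: continuous_compact.
    by apply: continuous_subspaceT; exact: normal_point_continuous.
  exact: normal_triples_compact.
have [r0|r0] := leP r 0.
  have -> : local_parallel_set K r `[a, b]%classic = set0.
    by apply/seteqP; split => // p [t [q [s [_ _ /andP[s0 sr] _]]]]; lra.
  exact: measurable0.
have -> : local_parallel_set K r `[a, b]%classic =
  (normal_point @` normal_triples a b r) `\` (normal_point @` normal_triples a b 0).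
  apply/seteqP; split => p.
    move=> [t [q [s [/= ht [Kq eq] /andP[s0 sr] ->]]]]; split.
      exists (t, (q, s)) => //; split => /=; last by apply/eqP; rewrite subr_eq0; apply/eqP.
      by split => //; split => //=; rewrite in_itv/= ltW.
    move=> [[t' [q' s']] [[/= ht' [/= Kq' +]] /= E] ].
    rewrite in_itv/= -eq_le => /eqP s'0; rewrite -s'0 /normal_point /= !mul0r !addr0 => E2.
    have := supp_ge t bK Kq'; have -> : q' = q + s *: uvec t by rewrite -E2; case: (q').
    by rewrite duD duZ du_uvec subrr cos0 mulr1 [du q t]eq; lra.
  move=> [[[t [q s]] [[/= ht [/= Kq +]] /= E] <-] N].
  rewrite in_itv/= => /andP[s0 sr]; exists t, q, s; split => //.
    by split => //; apply/eqP; rewrite -subr_eq0; apply/eqP.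
  rewrite sr andbT lt_neqAle s0 andbT; apply/negP => /eqP s00; apply: N.
  exists (t, (q, s)) => //; split => //=; split => //; split => //=.
  by rewrite -s00 in_itv/= lexx.
exact: measurableD.
Qed.

Lemma parallel_oc_measurable a b r : measurable (local_parallel_set K r `]a, b]%classic).
Proof.
have -> : `]a, b]%classic = \bigcup_n `[a + n.+1%:R^-1, b]%classic.
  apply/seteqP; split => x.
    rewrite /= in_itv/= => /andP[ax xb]; have [n hn] := ltr_add_invr ax.
    by exists n => //; rewrite /= in_itv/= xb ltW.
  move=> [n _]; rewrite /= !in_itv/= => /andP[h1 ->]; rewrite andbT.
  by rewrite (lt_le_trans _ h1)// ltrDl invr_gt0.
rewrite parallel_bigcup; apply: bigcupT_measurable => n; exact: parallel_cc_measurable.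
Qed.

Lemma parallel_oo_measurable a b r : measurable (local_parallel_set K r `]a, b[%classic).
Proof.
have -> : `]a, b[%classic = \bigcup_n `]a, b - n.+1%:R^-1]%classic.
  apply/seteqP; split => x.
    rewrite /= in_itv/= => /andP[ax xb]; have [n hn] := ltr_add_invr xb.
    by exists n => //; rewrite /= in_itv/= ax/=; rewrite lerBrDr ltW.
  move=> [n _]; rewrite /= !in_itv/= => /andP[-> h1]; rewrite /=.
  by rewrite (le_lt_trans h1)// ltrBlDr ltrDl invr_gt0.
rewrite parallel_bigcup; apply: bigcupT_measurable => n; exact: parallel_oc_measurable.
Qed.

Section Image.
Variable r : R.

(** The value [-1] marks the points that are on no normal with angle in
    []0, pi / 2[], or too far away. *)
Definition normal_angle p : R :=
  xget (-1) [set t | 0 < t < pi / 2 /\ local_parallel_set K r [set t] p].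

Lemma normal_angleE p t : 0 < t < pi / 2 -> local_parallel_set K r [set t] p ->
  normal_angle p = t.
Proof.
move=> t0 pt; rewrite /normal_angle; case: xgetP => [t' _ [t'0 pt']|/(_ t)]; last by case.
apply: parallel_angle_unique pt' pt; move: t0 t'0 => /andP[? ?] /andP[? ?].
by rewrite ltr_norml; apply/andP; split; lra.
Qed.

Lemma normal_angle_preimage X : X `<=` `]0, pi / 2[%classic ->
  normal_angle @^-1` X = local_parallel_set K r X.
Proof.
move=> Xs; apply/seteqP; split => p.
  rewrite /= /normal_angle; case: xgetP => [t _ [_ [t' [q [s [/= tt e s0 ->]]]]] Xt|_].
    by exists t', q, s; split => //; rewrite tt.
  move=> /Xs /=; rewrite in_itv/= => /andP[n1 _]; exfalso; lra.
move=> [t [q [s [Xt e s0 ->]]]] /=; rewrite (@normal_angleE _ t)//.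
  by have := Xs _ Xt; rewrite /= in_itv.
by exists t, q, s.
Qed.

Lemma normal_angle_measurable : measurable_fun setT normal_angle.
Proof.
apply: (measurability (@RGenOInfty.G R)); first exact: RGenOInfty.measurableE.
move=> _ [_ [c ->] <-]; rewrite setTI.
have [c1|c1] := ltP c (-1).
  have -> : normal_angle @^-1` `]c, +oo[%classic = setT.
    apply/seteqP; split => // p _ /=; rewrite in_itv/= andbT /normal_angle.
    case: xgetP => [t -> [/andP[t0 _] _]|_] //; lra.
  exact: measurableT.
have -> : normal_angle @^-1` `]c, +oo[%classic =
    local_parallel_set K r `]Num.max c 0, pi / 2[%classic.
  rewrite -normal_angle_preimage; last first.
    by move=> t; rewrite /= !in_itv/= gt_max => /andP[/andP[_ ->] ->].
  apply/seteqP; split => p /=; rewrite !in_itv/= andbT; last by rewrite gt_max => /andP[/andP[-> _] _].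
  rewrite /normal_angle; case: xgetP => [t -> [/andP[t0 t2] _] ct|_]; last lra.
  by rewrite gt_max ct t0 t2.
exact: parallel_oo_measurable.
Qed.

(** The image of the area under [normal_angle]. *)
Lemma parallel_measure : exists m : {measure set (measurableTypeR R) -> \bar R},
  forall X, X `<=` `]0, pi / 2[%classic -> m X = area_measure (local_parallel_set K r X).
Proof.
have [m mE'] := @image_measure R _ _ (measurableTypeR R * measurableTypeR R)%type
  (measurableTypeR R) mu2 _ normal_angle_measurable.
by exists m => X Xs; rewrite mE' normal_angle_preimage.
Qed.

Lemma parallel_measurable X : measurable X -> X `<=` `]0, pi / 2[%classic ->
  measurable (local_parallel_set K r X).
Proof.
move=> mX Xs; rewrite -normal_angle_preimage//.
exact: (measurable_preimage normal_angle_measurable).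
Qed.

End Image.
End ParallelMeasurable.

(** * Comparing Borel measures on intervals *)
Section Compare.
Context {R : realType}.
Implicit Types (a b c d x y C : R).

(** If [m1 <= m2] on half-open intervals, the difference of the distribution
    functions is nondecreasing; its Lebesgue-Stieltjes measure is a measure
    [m] with [m1 + m = m2] on intervals, hence on all Borel sets. *)
Lemma measure_le_oc (m1 m2 : {measure set (measurableTypeR R) -> \bar R}) c d C :
  c <= d ->
  (forall a b, c <= a -> a <= b -> b <= d ->
    (m1 (`]a, b]%classic : set R) <= m2 (`]a, b]%classic : set R))%E) ->
  (forall a b, c <= a -> a <= b -> b <= d ->
    (m2 (`]a, b]%classic : set R) <= (C * (b - a))%:E)%E) ->
  forall A : set R, measurable A -> A `<=` `]c, d]%classic -> (m1 A <= m2 A)%E.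
Proof.
move=> cd m12 m2C.
pose clip x := if x <= c then c else if d <= x then d else x.
have clip_in x : c <= clip x /\ clip x <= d.
  by rewrite /clip; case: (leP x c) => h1; [|case: (leP d x) => h2]; split; lra.
have clip_mono x y : x <= y -> clip x <= clip y /\ clip y - clip x <= y - x.
  move=> xy; rewrite /clip.
  case: (leP y c) => h1; first by rewrite (le_trans xy h1) lexx subrr subr_ge0.
  case: (leP x c) => h3.
    by case: (leP d y) => h2; split; lra.
  by case: (leP d y) => h2; case: (leP d x) => h4; split; lra.
have fin2 a b : c <= a -> a <= b -> b <= d -> m2 (`]a, b]%classic : set R) \is a fin_num.
  by move=> ca ab bd; rewrite ge0_fin_numE// (le_lt_trans (m2C _ _ ca ab bd)) ?ltry.
have fin1 a b : c <= a -> a <= b -> b <= d -> m1 (`]a, b]%classic : set R) \is a fin_num.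
  move=> ca ab bd; rewrite ge0_fin_numE// (le_lt_trans (m12 _ _ ca ab bd))//.
  by rewrite -ge0_fin_numE// fin2.
pose F x := fine (m2 (`]c, clip x]%classic : set R)) - fine (m1 (`]c, clip x]%classic : set R)).
have splitm (m : {measure set (measurableTypeR R) -> \bar R}) x y : clip x <= clip y ->
    m (`]c, clip y]%classic : set R) =
    (m (`]c, clip x]%classic : set R) + m (`]clip x, clip y]%classic : set R))%E.
  move=> xy; rewrite -measureU//.
  - congr (m _); apply/seteqP; split => z /=; rewrite !in_itv/=.
      move=> /andP[cz zy]; have [zx|xz] := leP z (clip x); [left|right].
        by rewrite cz.
      by rewrite zy.
    have [? ?] := clip_in x; move=> [/andP[cz zx]|/andP[xz zy]]; apply/andP; split; lra.
  - apply/seteqP; split => z //=; rewrite !in_itv/= => -[/andP[_ zx] /andP[xz _]].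
    by move: xz; rewrite ltNge zx.
have FB x y : x <= y -> F y - F x = fine (m2 (`]clip x, clip y]%classic : set R)) -
    fine (m1 (`]clip x, clip y]%classic : set R)).
  move=> xy; have [cxy _] := clip_mono x y xy.
  have [x1 x2] := clip_in x; have [y1 y2] := clip_in y.
  rewrite /F (splitm m2 x y cxy) (splitm m1 x y cxy) !fineD ?fin1 ?fin2//; ring.
have Fnd : nondecreasing_fun F.
  move=> x y xy; rewrite -subr_ge0 FB//.
  have [cxy _] := clip_mono x y xy.
  have [x1 x2] := clip_in x; have [y1 y2] := clip_in y.
  by rewrite subr_ge0 fine_le ?fin1 ?fin2// m12.
have C1 : 0 < `|C| + 1 by rewrite ltr_wpDl.
have Flip x y : x <= y -> F y - F x <= (`|C| + 1) * (y - x).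
  move=> xy; have [cxy cyx] := clip_mono x y xy.
  have [x1 x2] := clip_in x; have [y1 y2] := clip_in y.
  rewrite FB// (le_trans (y := C * (clip y - clip x)))//.
    have : 0 <= fine (m1 (`]clip x, clip y]%classic : set R)) by exact: fine_ge0.
    have : fine (m2 (`]clip x, clip y]%classic : set R)) <= C * (clip y - clip x).
      by rewrite -lee_fin fineK ?fin2// m2C.
    by lra.
  have : C <= `|C| + 1 by rewrite (le_trans (ler_norm _))// lerDl.
  move=> CC; apply: (@le_trans _ _ ((`|C| + 1) * (clip y - clip x))).
    by rewrite ler_wpM2r// subr_ge0.
  by rewrite ler_pM2l.
have Fc : continuous F.
  apply: (lip_continuous C1) => x y.
  wlog xy : x y / x <= y.
    move=> W; have [|/ltW] := leP x y; first exact: W.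
    by rewrite distrC (distrC x); exact: W.
  rewrite distrC (distrC x) (ger0_norm (x := F y - F x)) ?subr_ge0 ?Fnd//.
  by rewrite (ger0_norm (x := y - x)) ?subr_ge0// Flip.
have Frc : right_continuous F by move=> x; apply: cvg_at_right_filter; exact: Fc.
have [cF cFE] : exists cF : cumulative R R, forall x, cF x = F x.
  by exists (HB.pack_for (cumulative R R) F (isCumulative.Build R _ R F Fnd Frc)).
pose ls := lebesgue_stieltjes_measure cF.
have lsE a b : a < b -> ls (`]a, b]%classic : set R) = (F b - F a)%:E.
  move=> ab; rewrite /ls /lebesgue_stieltjes_measure /measure_extension/=.
  rewrite measurable_mu_extE/=; last exact: is_ocitv.
  by rewrite wlength_itv_bnd ?ltW// !cFE.
have mD : measurable (`]c, d]%classic : set (measurableTypeR R)) by exact: measurable_itv.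
have clipE a b : a < b -> `]a, b]%classic `&` `]c, d]%classic = `]clip a, clip b]%classic.
  move=> ab; have clip_ge z x : c < z -> z <= d -> (z <= clip x) = (z <= x).
    rewrite /clip => cz zd; case: (leP x c) => h1.
      by rewrite !leNgt cz (le_lt_trans h1 cz).
    by case: (leP d x) => h2 //; rewrite zd (le_trans zd h2).
  apply/seteqP; split => z /=; rewrite !in_itv/=.
    by move=> [/andP[az zb] /andP[cz zd]]; rewrite !ltNge !clip_ge// -ltNge az.
  have [ca _] := clip_in a; have [_ bd] := clip_in b.
  move=> /andP[az zb]; have cz := le_lt_trans ca az; have zd := le_trans zb bd.
  by move: az zb; rewrite !ltNge !clip_ge// -!ltNge => -> ->; rewrite cz zd.
pose m1' : {measure set (measurableTypeR R) -> \bar R} := mrestr m1 mD.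
pose m2' : {measure set (measurableTypeR R) -> \bar R} := mrestr m2 mD.
pose m3 : {measure set (measurableTypeR R) -> \bar R} := measure_add m1' ls.
have m3E A : m3 A = (m1' A + ls A)%E by exact: measure_addE.
have key : forall A, measurable A -> m2' A = m3 A.
  apply: (@measure_eq_itv R m2' m3) => [a b ab|a b].
    have e1 : m1' (`]a, b]%classic : set R) = m1 (`]clip a, clip b]%classic : set R).
      by rewrite -(clipE a b ab).
    have e2 : m2' (`]a, b]%classic : set R) = m2 (`]clip a, clip b]%classic : set R).
      by rewrite -(clipE a b ab).
    rewrite m3E lsE// FB ?(ltW ab)// e1 e2.
    have [cab _] := clip_mono a b (ltW ab).
    have [x1 x2] := clip_in a; have [y1 y2] := clip_in b.
    have f1 := fin1 _ _ x1 cab y2; have f2 := fin2 _ _ x1 cab y2.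
    by rewrite -[in RHS](fineK f1) -EFinD addrC subrK fineK.
  rewrite /m2' /mrestr /=; apply: (@le_lt_trans _ _ (m2 (`]c, d]%classic : set R))).
    apply: le_measure; rewrite ?inE//; first exact: measurableI.
  by have := fin2 c d (lexx c) cd (lexx d); rewrite ge0_fin_numE.
move=> A mA Acd; have := key A mA.
have rE (m : {measure set (measurableTypeR R) -> \bar R}) : mrestr m mD A = m A.
  by rewrite /mrestr; congr (m _); exact: setIidl.
by rewrite m3E /m1' /m2' /= !rE => ->; rewrite leeDl.
Qed.

(** [measure_le_oc] on the intervals [ ]c, d - 1 / n] ], which exhaust
    [ ]c, d[ ]. *)
Lemma measure_le_oo (m1 m2 : {measure set (measurableTypeR R) -> \bar R}) c d C :
  (forall a b, c <= a -> a <= b -> b < d ->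
    (m1 (`]a, b]%classic : set R) <= m2 (`]a, b]%classic : set R))%E) ->
  (forall a b, c <= a -> a <= b -> b < d ->
    (m2 (`]a, b]%classic : set R) <= (C * (b - a))%:E)%E) ->
  forall A : set R, measurable A -> A `<=` `]c, d[%classic -> (m1 A <= m2 A)%E.
Proof.
move=> m12 m2C A mA Acd.
pose B n : set R := A `&` `]c, d - n.+1%:R^-1]%classic.
have mB n : measurable (B n) by apply: measurableI.
have AE : A = \bigcup_n B n.
  apply/seteqP; split => [x Ax|x [n _ []//]].
  have := Acd x Ax; rewrite /= in_itv/= => /andP[cx xd].
  have [n hn] := ltr_add_invr xd; exists n => //; split => //=.
  by rewrite in_itv/= cx/= lerBrDr ltW.
have ndB : nondecreasing_seq B.
  move=> m n mn; apply/subsetPset => x [Ax]; rewrite /= in_itv/= => /andP[cx xm].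
  split => //=; rewrite in_itv/= cx (le_trans xm)// lerD2l lerN2.
  by rewrite lef_pV2 ?posrE// ler_nat.
have mU : measurable (\bigcup_n B n) by exact: bigcupT_measurable.
have c1 := @nondecreasing_cvg_mu _ (measurableTypeR R) _ m1 B mB mU ndB.
have c2 := @nondecreasing_cvg_mu _ (measurableTypeR R) _ m2 B mB mU ndB.
rewrite AE -(cvg_lim _ c1)// -(cvg_lim _ c2)//.
apply: lee_lim; [by apply/cvg_ex; eexists; exact: c1|by apply/cvg_ex; eexists; exact: c2|].
apply: nearW => n; rewrite /=.
have [cd|dc] := leP c (d - n.+1%:R^-1); last first.
  suff -> : B n = set0 by rewrite !measure0.
  apply/seteqP; split => // x [_]; rewrite /= in_itv/= => /andP[h1 h2].
  by have := lt_le_trans h1 h2; rewrite ltNge (ltW dc).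
have dd : d - n.+1%:R^-1 < d by rewrite ltrBlDr ltrDl invr_gt0.
apply: (@measure_le_oc m1 m2 c (d - n.+1%:R^-1) C cd) => //.
- by move=> a b ca ab bd; apply: m12 => //; exact: le_lt_trans dd.
- by move=> a b ca ab bd; apply: m2C => //; exact: le_lt_trans dd.
- by move=> x [].
Qed.

End Compare.

(** * Steiner bounds for arcs *)
Section Steiner.
Context {R : realType}.
Notation mu := (@lebesgue_measure R).
Notation mu2 := (mu \x mu)%E.
Implicit Types (p q : R * R) (s t x y a b r : R) (X : set R).

Variables (K : set (R * R)) (H : R -> R) (B L : R).
Hypotheses (bK : convex_body K)
  (dH : forall x, - 10 < x < 10 -> is_derive x 1 H (supp K x)).
Hypotheses (B1 : 1 <= B)
  (hlip : forall s t, `|supp K t - supp K s| <= B * `|t - s|)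
  (dvlip : forall p s t, K p -> `|dv p t - dv p s| <= B * `|t - s|)
  (hB : forall t, `|supp K t| <= B).
Let h := supp K.
Notation G := (arclength K H).
Hypotheses (uniq : forall t p, 0 <= t -> t < pi / 2 -> edge K t p -> p = vplus K t)
  (L1 : 1 <= L)
  (Glip : forall a b, 0 <= a -> a <= b -> b < pi / 2 -> G b - G a <= L * (b - a)).

Lemma area_box_oc t (a b c d : R) : 0 < cos t -> a <= b ->
  area (box t `]a, b] `]c, d]) = (b - a) * Num.max 0 (d - c).
Proof.
move=> t0 ab; rewrite -(area_boxE c d t0 ab).
by apply: area_box_itv => //; rewrite !lebesgue_measure_itv.
Qed.

Section Local.
Variables x y r : R.
Hypotheses (x0 : 0 <= x) (xy : x <= y) (y2 : y < pi / 2) (yx : y - x <= 1 / 2) (r0 : 0 < r).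
Let p4 : pi / 2 < 2 :> R. Proof. exact: pihalf_lt2. Qed.

(** The areas of the inner and outer rectangles of [parallel_sub_box] and
    [box_sub_parallel] differ from Steiner's values by [O((y - x)^2)]. *)
Lemma parallel_area_local :
  area (local_parallel_set K r `]x, y]%classic) - (r * (G y - G x) + r ^+ 2 * (y - x))
    <= 2 * L * (L + r) * (y - x) ^+ 2 /\
  r * (G y - G x) - area (local_parallel_set K r `]x, y]%classic)
    <= (r * L + 4 * L ^+ 2 + 2 * B * r) * (y - x) ^+ 2.
Proof.
have := (x0, xy, y2, yx, r0, L1, B1, p4) => -[[[[[[[x0' xy'] y2'] yx'] r0'] L1'] B1'] p4'].
have cx : 0 < cos x by apply: cos_gt0_acute; lra.
set th := y - x in yx' *; have th0 : 0 <= th by rewrite subr_ge0.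
set S := G y - G x.
have S0 : 0 <= S.
  rewrite subr_ge0; apply: (G_mono bK dH (B := B)) => //; lra.
have SL : S <= L * th by exact: Glip.
have mP := parallel_oc_measurable bK x y r.
have bP := parallel_bounded bK r `]x, y]%classic.
have th2 : th ^+ 2 <= th * (1 / 2) by rewrite expr2 ler_wpM2l.
have t20 : 0 <= th ^+ 2 by exact: sqr_ge0.
have Lt : 0 <= 2 * L * th ^+ 2 by rewrite !mulr_ge0//; lra.
split.
  have sub := @parallel_sub_box _ _ _ _ _ bK dH B1 hlip dvlip uniq L1 Glip x y r x0 xy y2 yx.
  have := area_disjoint_ge mP measurable0 (@measurable_box R x _ _ (measurable_itv _) (measurable_itv _))
    (bounded_box _ _ _ _ _) sub (sub0set _) (setI0 _).
  rewrite area_boxE//; last by rewrite -/h -/th; lra.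
  have -> : area (set0 : set (R * R)) = 0 by rewrite /area /area_measure measure0.
  rewrite addr0 -/h -/th -/S => /le_trans le1.
  rewrite lerBlDr; apply: le1.
  have -> : h x + r - (h x - 2 * L * th ^+ 2) = r + 2 * L * th ^+ 2 by ring.
  have -> : omega K x + S + r * th - omega K x = S + r * th by ring.
  have rt : 0 <= r * th by rewrite mulr_ge0// ltW.
  rewrite max_r; last by apply: addr_ge0.
  have : 2 * L * th ^+ 2 * (S + r * th) <= 2 * L * th ^+ 2 * (L + r).
    have thL : L * th <= L * (1 / 2) by rewrite ler_wpM2l//; lra.
    have thr : r * th <= r * (1 / 2) by rewrite ler_wpM2l//; lra.
    by rewrite ler_wpM2l//; lra.
  by rewrite (expr2 r); lra.
have sub2 := box_sub_parallel bK dH B1 hlip dvlip hB L1 Glip x0 xy y2 yx r0.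
have [x10 y10] : - 10 < x /\ y < 10 by split; lra.
have [_ up] := dv_H_increment bK dH B1 hlip dvlip (vplus_edge y bK).1 x10 xy y10.
have {}up : S - 2 * B * th ^+ 2 <= dv (vplus K y) x - omega K x.
  by have := up (vplus_edge y bK); rewrite /S /arclength /omega /th; lra.
have cth : 1 - th <= cos th := cos_ge1B th0.
have c1 := cos_le1 th.
have Bt : 0 <= B * th ^+ 2 by rewrite mulr_ge0//; lra.
have a0 : 0 <= area (local_parallel_set K r `]x, y]%classic) by apply: fine_ge0.
have L2 : L * th <= L * (1 / 2) by rewrite ler_wpM2l//; lra.
set rho := r * cos th - 2 * L * th ^+ 2.
have LL : L * th ^+ 2 * S <= L * th ^+ 2 * (2 * L).
  by rewrite ler_wpM2l//; [rewrite mulr_ge0//; lra|lra].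
have rS : r * (1 - cos th) * S <= r * th * (L * th).
  by rewrite -!mulrA ler_pM2l// ler_pM// ?subr_ge0//; lra.
have [rho0|rho0] := leP 0 rho; last first.
  have rc : r * (1 / 2) <= 2 * L * th ^+ 2.
    have : r * (1 / 2) <= r * cos th by rewrite ler_pM2l//; lra.
    by rewrite /rho in rho0; lra.
  have : r * S <= 4 * L * th ^+ 2 * S by rewrite ler_wpM2r//; lra.
  have : 0 <= r * L * th ^+ 2 by rewrite !mulr_ge0//; lra.
  have : L * th ^+ 2 * S <= L * th ^+ 2 * L.
    by rewrite ler_wpM2l//; [rewrite mulr_ge0//; lra|lra].
  have : 0 <= B * r * th ^+ 2 by rewrite !mulr_ge0//; lra.
  rewrite (expr2 L); lra.
have := area_disjoint_ge (@measurable_box R x _ _ (measurable_itv _) (measurable_itv _))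
  measurable0 mP bP sub2 (sub0set _) (setI0 _).
rewrite -/th -/rho area_box_oc//; last by rewrite lerDl.
have -> : area (set0 : set (R * R)) = 0 by rewrite /area /area_measure measure0.
have -> : supp K x + rho - supp K x = rho by ring.
rewrite addr0 => le1.
have le2 : rho * (S - 2 * B * th ^+ 2) <= area (local_parallel_set K r `]x, y]%classic).
  apply: le_trans le1; rewrite ler_wpM2l// (le_trans up)// le_max lexx orbT//.
have le3 : rho * (B * th ^+ 2) <= r * (B * th ^+ 2).
  by rewrite ler_wpM2r// /rho; have : r * cos th <= r by [rewrite ler_piMr// ltW]; lra.
have le4 : 0 <= L ^+ 2 * th ^+ 2 by rewrite mulr_ge0// sqr_ge0.
rewrite /rho in le2 le3; rewrite expr2 in le4 LL rS le2 le3 *; lra.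
Qed.
End Local.

(** The quadratic errors of [parallel_area_local] vanish under subdivision. *)
Lemma parallel_area_bounds a b r : 0 <= a -> a <= b -> b < pi / 2 -> 0 < r ->
  r * (G b - G a) <= area (local_parallel_set K r `]a, b]%classic)
    <= r * (G b - G a) + r ^+ 2 * (b - a).
Proof.
move=> a0 ab b2 r0.
have [A AE] : exists A : R -> R, forall z, A z = area (local_parallel_set K r `]a, z]%classic).
  by exists (fun z => area (local_parallel_set K r `]a, z]%classic)).
have AB x y : a <= x -> x <= y -> y <= b ->
    area (local_parallel_set K r `]x, y]%classic) = A y - A x.
  move=> ax xy yb; apply/esym/eqP; rewrite subr_eq addrC; apply/eqP; rewrite !AE.
  have fE u v := areaE (parallel_oc_measurable bK u v r) (parallel_bounded bK r `]u, v]%classic).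
  apply: EFin_inj; apply: (etrans (fE a y)); rewrite EFinD.
  apply: (etrans _ (esym (congr2 adde (fE a x) (fE x y)))).
  have -> : `]a, y]%classic = `]a, x]%classic `|` `]x, y]%classic :> set R.
    apply/seteqP; split => z /=; rewrite !in_itv/=.
      move=> /andP[az zy]; have [zx|xz] := leP z x; [left|right].
        by rewrite az.
      by rewrite zy.
    by move=> [/andP[az zx]|/andP[xz zy]]; apply/andP; split; lra.
  rewrite parallel_setU [LHS](measureU mu2)//; do ?exact: parallel_oc_measurable.
  apply/seteqP; split => // p [[t [q [s [ht e1 s0 pE]]]] [t' [q' [s' [ht' e2 s0' pE']]]]].
  move: ht ht'; rewrite /= !in_itv/= => /andP[at_ tx] /andP[xt' t'y].
  have tt' : t = t'.
    apply: (@parallel_angle_unique R K bK r t t' p).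
    - by rewrite ltr_norml; apply/andP; split; lra.
    - by exists t, q, s.
    - by exists t', q', s'.
  lra.
have Aa : A a = 0.
  suff e0 : local_parallel_set K r `]a, a]%classic = set0.
    by rewrite AE e0 /area /area_measure measure0.
  apply/seteqP; split => // p [t [q [s [+ _ _ _]]]].
  by rewrite /= in_itv/= => /andP[at_ ta]; lra.
have h20 : 0 < 1 / 2 :> R by lra.
rewrite -AE; apply/andP; split.
  have := @quadratic_increment R (fun z => r * G z - A z) a b (1 / 2)
    (r * L + 4 * L ^+ 2 + 2 * B * r) ab h20.
  rewrite Aa => Q.
  suff : r * G b - A b <= r * G a - 0 by move: (G a) (G b) (A b) => u v w; lra.
  apply: Q => x y ax xy yb yx.
  have [_] := @parallel_area_local x y r (le_trans a0 ax) xy (le_lt_trans yb b2) yx r0.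
  rewrite (AB _ _ ax xy yb); move: (G x) (G y) (A x) (A y) => u v w z; lra.
have := @quadratic_increment R (fun z => A z - (r * G z + r ^+ 2 * z)) a b (1 / 2)
    (2 * L * (L + r)) ab h20.
rewrite Aa => Q.
suff : A b - (r * G b + r ^+ 2 * b) <= 0 - (r * G a + r ^+ 2 * a).
  by move: (G a) (G b) (A b) => u v w; lra.
apply: Q => x y ax xy yb yx.
have [+ _] := @parallel_area_local x y r (le_trans a0 ax) xy (le_lt_trans yb b2) yx r0.
rewrite (AB _ _ ax xy yb); move: (G x) (G y) (A x) (A y) => u v w z; lra.
Qed.

End Steiner.

(** * Surface area measure *)
Section Surface.
Context {R : realType}.
Notation mu := (@lebesgue_measure R).
Notation mu2 := (mu \x mu)%E.
Notation MR := (measurableTypeR R).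
Implicit Types (K : set (R * R)) (a b r s : R) (X : set R).

(** The limit is the infimum of the values of [phi]. *)
Lemma lim_almost_monotone (phi : R -> R) (I V : R) : 0 <= V ->
  (forall r, 0 < r -> 0 <= phi r) ->
  (forall r s, 0 < r -> 0 < s -> phi r <= phi s + r * V) ->
  (forall r, 0 < r -> phi r <= I + r * V) ->
  (lim ((phi r)%:E @[r --> 0^'+]) <= I%:E)%E.
Proof.
move=> V0 p0 pm pI.
pose S := [set phi r | r in [set r | 0 < r]].
have hS : has_inf S.
  split; first by exists (phi 1), 1 => //=; exact: ltr01.
  by exists 0 => _ [r r0 <-]; exact: p0.
have lS r : 0 < r -> inf S <= phi r.
  by move=> r0; apply: ge_inf; [exact: hS.2|exists r].
have uS r : 0 < r -> phi r <= inf S + r * V.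
  move=> r0; rewrite -lerBlDr; apply: lb_le_inf; first exact: hS.1.
  by move=> _ [s s0 <-]; rewrite lerBlDr pm.
have cv : phi r @[r --> 0^'+] --> inf S.
  apply: (@squeeze_cvgr _ _ _ _ (fun=> inf S) (fun r => inf S + r * V)).
  - near=> r; have r0 : 0 < r by [].
    by rewrite lS ?uS.
  - exact: cvg_cst.
  - rewrite -[X in _ --> X]addr0 -[X in _ --> _ + X](mul0r V).
    apply: cvgD; first exact: cvg_cst.
    apply: cvgM; last exact: cvg_cst.
    by apply: cvg_at_right_filter; exact: cvg_id.
have -> : lim ((phi r)%:E @[r --> 0^'+])%E = (inf S)%:E.
  by apply: cvg_lim => //; apply: cvg_EFin; [exact: nearW|exact: cv].
rewrite lee_fin; apply/ler_addgt0Pr => e e0.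
have e1 : 0 < e / (V + 1) by rewrite divr_gt0// ltr_wpDl.
rewrite (le_trans (lS _ e1))// (le_trans (pI _ e1))// lerD2l.
rewrite -mulrA ler_piMr//; first exact: ltW.
by rewrite mulrC ler_pdivrMr ?ltr_wpDl// mul1r lerDl.
Unshelve. all: by end_near. Qed.

Lemma integral_measure_ex (f : R -> R) : measurable_fun setT f -> (forall x, 0 <= f x) ->
  exists m : {measure set MR -> \bar R}, forall X, m X = (\int[mu]_(t in X) (f t)%:E)%E.
Proof.
move=> mf f0.
have mf' : measurable_fun setT (EFin \o f) by exact/measurable_EFinP.
have f0' x : (0 <= (EFin \o f) x)%E by rewrite lee_fin.
pose nu (X : set MR) : \bar R := (\int[mu]_(t in X) (EFin \o f) t)%E.
have nu0 : nu set0 = 0%E by exact: integral_set0.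
have nu_ge0 X : (0 <= nu X)%E by apply: integral_ge0 => x _; exact: f0'.
have nuS := @semi_sigma_additive_nng_induced _ MR R mu _ mf' f0'.
by exists (HB.pack_for {measure set MR -> \bar R} (nu : set MR -> \bar R)
  (isMeasure.Build _ MR R nu nu0 nu_ge0 nuS)).
Qed.

Lemma measure_lin (k l : R) (m1 m2 : {measure set MR -> \bar R}) : 0 <= k -> 0 <= l ->
  exists m : {measure set MR -> \bar R}, forall X, m X = (k%:E * m1 X + l%:E * m2 X)%E.
Proof.
move=> k0 l0.
pose n1 : {measure set MR -> \bar R} := mscale (NngNum k0) m1.
pose n2 : {measure set MR -> \bar R} := mscale (NngNum l0) m2.
pose n3 : {measure set MR -> \bar R} := measure_add n1 n2.
by exists n3 => X; exact: measure_addE.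
Qed.

Lemma lebesgue_measure_oc a b : a <= b -> mu (`]a, b]%classic : set R) = (b - a)%:E.
Proof.
move=> ab; rewrite lebesgue_measure_itv/= lte_fin.
by case: ltP => // ba; rewrite (@le_anti _ _ a b) ?subrr ?ab.
Qed.

(** [G] is the arc length as a function of the direction of the normal. *)
Lemma balanced_steiner K : balanced_maximum_cap K -> exists2 G : R -> R,
  (forall a b, 0 <= a -> a <= b -> b < pi / 2 ->
    ((G b - G a)%:E <= \int[mu]_(t in `]a, b]) (k0 (gplus K t))%:E)%E) &
  (forall a b r, 0 <= a -> a <= b -> b < pi / 2 -> 0 < r ->
    r * (G b - G a) <= area (local_parallel_set K r `]a, b]%classic)
      <= r * (G b - G a) + r ^+ 2 * (b - a)).
Proof.
move=> balK; have [[bK _ _ _] _] := balK.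
have [H dH] := @antiderivative_ex R (supp K) 10 (supp_continuous bK).
have [B B1 [hB hlip _ dvlip]] := body_constant bK.
have [L L1 fL] := k0_gplus_bounded bK.
have mf := k0_gplus_measurable bK.
have GF a b : 0 <= a -> a <= b -> b < pi / 2 -> arclength K H b - arclength K H a <=
    primitive (fun t => k0 (gplus K t)) b - primitive (fun t => k0 (gplus K t)) a.
  move=> a0 ab b2.
  have := edge_increment balK dH a0 ab b2 (vplus_edge b bK) (vplus_edge a bK).
  by rewrite /arclength /omega; lra.
have Glip a b : 0 <= a -> a <= b -> b < pi / 2 ->
    arclength K H b - arclength K H a <= L * (b - a).
  by move=> a0 ab b2; rewrite (le_trans (GF a b a0 ab b2))// primitive_lip.
exists (arclength K H) => [a b a0 ab b2|a b r a0 ab b2 r0].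
  by rewrite -(primitiveE mf fL a0 ab) lee_fin GF.
have uniq t p : 0 <= t -> t < pi / 2 -> edge K t p -> p = vplus K t.
  by move=> t0 t2 ep; exact: (edge_unique balK t0 t2 ep (vplus_edge t bK)).
exact: (@parallel_area_bounds R K H B L bK dH B1 hlip dvlip hB uniq L1 Glip).
Qed.


Section Comparison.
Variable K : set (R * R).
Hypothesis balK : balanced_maximum_cap K.
Let bK : convex_body K. Proof. by have [[]] := balK. Qed.

Lemma parallel_oc_area a b r :
  area_measure (local_parallel_set K r `]a, b]%classic) =
  (area (local_parallel_set K r `]a, b]%classic))%:E.
Proof.
by apply/esym/areaE; [exact: parallel_oc_measurable|exact: parallel_bounded].
Qed.

Lemma inv_mul_bound r (x S t : R) : 0 < r -> r * S <= x <= r * S + r ^+ 2 * t ->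
  S <= r^-1 * x <= S + r * t.
Proof.
move=> r0 /andP[h1 h2]; rewrite ler_pdivlMl// ler_pdivrMl// h1 mulrDr mulrA -expr2.
exact: h2.
Qed.

(** On the arcs [ ]a, b] ] both [parallel_area_bounds] and [edge_increment] are
    available; [measure_le_oo] extends the result. *)
Lemma parallel_le_integral r X : 0 < r -> measurable X -> X `<=` `]0, pi / 2[%classic ->
  ((r^-1)%:E * area_measure (local_parallel_set K r X) <=
    \int[mu]_(t in X) (k0 (gplus K t))%:E + r%:E * mu X)%E.
Proof.
move=> r0 mX X2; have r00 := ltW r0.
have ri0 : 0 <= r^-1 by rewrite invr_ge0.
have [G GF GA] := balanced_steiner balK.
have [L L1 fL] := k0_gplus_bounded bK.
have mf := k0_gplus_measurable bK.
have [m mE] := parallel_measure bK r.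
have [n nE] := integral_measure_ex mf (fun t => k0_ge0 (gplus K t)).
have [m1 m1E] := measure_lin (mu : {measure set MR -> \bar R}) m (lexx 0) ri0.
have [m2 m2E] := measure_lin n (mu : {measure set MR -> \bar R}) ler01 r00.
rewrite -mE//.
have -> : ((r^-1)%:E * m X = m1 X)%E by rewrite m1E mul0e add0e.
rewrite -nE -[n X]mul1e -m2E.
apply: (@measure_le_oo R m1 m2 0 (pi / 2) (L + r)) => // a b a0 ab b2.
  rewrite m1E m2E mul0e add0e mul1e nE mE; last first.
    by move=> t /=; rewrite !in_itv/= => /andP[h1 h2]; apply/andP; split; lra.
  rewrite parallel_oc_area -EFinM.
  have /(inv_mul_bound r0)/andP[_ h] := GA a b r a0 ab b2 r0.
  have GF' := GF a b a0 ab b2.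
  apply: (@le_trans _ _ ((G b - G a)%:E + (r * (b - a))%:E)%E).
    by rewrite -EFinD lee_fin.
  apply: leeD; first exact: GF'.
  by rewrite EFinM -(lebesgue_measure_oc ab).
have nL : (n (`]a, b]%classic : set R) <= (L * (b - a))%:E)%E.
  by rewrite nE -(primitiveE mf fL a0 ab) lee_fin primitive_lip.
rewrite m2E mul1e mulrDl EFinD; apply: leeD; first exact: nL.
by rewrite EFinM -(lebesgue_measure_oc ab).
Qed.

(** On the arcs [ ]a, b] ] both terms are within Steiner's bounds of the same
    increment of [G]. *)
Lemma parallel_le_parallel r s X : 0 < r -> 0 < s -> measurable X -> X `<=` `]0, pi / 2[%classic ->
  ((r^-1)%:E * area_measure (local_parallel_set K r X) <=
    (s^-1)%:E * area_measure (local_parallel_set K s X) + r%:E * mu X)%E.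
Proof.
move=> r0 s0 mX X2; have r00 := ltW r0.
have ri0 : 0 <= r^-1 by rewrite invr_ge0.
have si0 : 0 <= s^-1 by rewrite invr_ge0 ltW.
have [G GF GA] := balanced_steiner balK.
have [L L1 fL] := k0_gplus_bounded bK.
have mf := k0_gplus_measurable bK.
have [m mE] := parallel_measure bK r.
have [n nE] := parallel_measure bK s.
have [m1 m1E] := measure_lin (mu : {measure set MR -> \bar R}) m (lexx 0) ri0.
have [m2 m2E] := measure_lin n (mu : {measure set MR -> \bar R}) si0 r00.
rewrite -mE// -nE//.
have -> : ((r^-1)%:E * m X = m1 X)%E by rewrite m1E mul0e add0e.
rewrite -m2E.
have oc a b : 0 <= a -> b < pi / 2 -> (`]a, b] : set R) `<=` `]0, pi / 2[.
  by move=> a0 b2 t /=; rewrite !in_itv/= => /andP[h1 h2]; apply/andP; split; lra.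
apply: (@measure_le_oo R m1 m2 0 (pi / 2) (L + s + r)) => // a b a0 ab b2.
  rewrite m1E m2E mul0e add0e (nE _ (oc a b a0 b2)) (mE _ (oc a b a0 b2)).
  rewrite !parallel_oc_area -!EFinM.
  have /(inv_mul_bound r0)/andP[_ h] := GA a b r a0 ab b2 r0.
  have /(inv_mul_bound s0)/andP[h' _] := GA a b s a0 ab b2 s0.
  apply: (@le_trans _ _ ((G b - G a)%:E + (r * (b - a))%:E)%E).
    by rewrite -EFinD lee_fin.
  apply: leeD; first by rewrite lee_fin.
  by rewrite EFinM -(lebesgue_measure_oc ab).
have GL : G b - G a <= L * (b - a).
  rewrite -lee_fin (le_trans (GF a b a0 ab b2))//.
  by rewrite -(primitiveE mf fL a0 ab) lee_fin primitive_lip.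
rewrite m2E (nE _ (oc a b a0 b2)) parallel_oc_area -EFinM mulrDl EFinD; apply: leeD.
  have /(inv_mul_bound s0)/andP[_ h] := GA a b s a0 ab b2 s0.
  by rewrite lee_fin (le_trans h)// mulrDl lerD2r.
by rewrite EFinM -(lebesgue_measure_oc ab).
Qed.

(** The edge at [0] is a point, so that its normals form a segment. *)
Lemma area_parallel_zero r : area_measure (local_parallel_set K r [set 0]) = 0%E.
Proof.
have p2 := @pi2_gt0 R.
pose J : set R := [set omega K 0].
have [b hb] := parallel_bounded bK r [set 0].
have sub : local_parallel_set K r [set 0] `<=` box 0 setT J.
  move=> p [_ [q [s [-> eq s0 ->]]]]; split => //=.
  have -> := edge_unique balK (lexx 0) p2 eq (vplus_edge 0 bK).
  by rewrite dvD dvZ dv_uvec subrr sin0 oppr0 mulr0 addr0.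
have mJ : measurable J by exact: measurable_set1.
have mB : measurable (box 0 (setT : set R) J) by apply: measurable_box => //; exact: measurableT.
have c0 : 0 < cos 0 :> R by rewrite cos0.
have B0 : mu2 (box 0 setT J) = 0%E.
  by rewrite (area_box c0 measurableT mJ) lebesgue_measure_set1 mule0.
have mL : measurable (local_parallel_set K r [set 0]).
  have := parallel_cc_measurable bK 0 0 r.
  by rewrite set_itv1.
by apply/eqP; rewrite eq_le measure_ge0 andbT -B0 le_measure ?inE.
Qed.

End Comparison.

End Surface.

Theorem theorem6p4p3 (R : realType) (K : set (R * R)) :
  balanced_maximum_cap K ->
  forall X : set R, measurable X -> X `<=` `[0, pi / 2[ ->
  (surface_area K X <=
     \int[lebesgue_measure]_(t in X) (k0 (gplus K t))%:E)%E.
Proof.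
move=> balK X mX X2; have [[bK _ _ _] _] := balK.
have mf := k0_gplus_measurable bK.
have [L L1 fL] := k0_gplus_bounded bK.
have [n nE] := integral_measure_ex mf (fun t => k0_ge0 (gplus K t)).
(* the direction [0] is split off: the measures above live on the open interval *)
pose Y := X `&` `]0, pi / 2[%classic.
have mY : measurable Y by apply: measurableI.
have Y2 : Y `<=` `]0, pi / 2[ by move=> t [].
pose P r := local_parallel_set K r Y.
have mP r : measurable (P r) by exact: parallel_measurable.
have Pfin r : area_measure (P r) = (area (P r))%:E.
  by apply/esym/areaE => //; exact: parallel_bounded.
have XE : X = Y `|` (X `&` [set 0]).
  apply/seteqP; split => [t Xt|t [[]|[]]//].
  have := X2 t Xt; rewrite /= in_itv/= => /andP[t0 t2].
  have [te|tn0] := eqVneq t 0; first by right; split.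
  by left; split => //=; rewrite in_itv/= t2 lt_neqAle eq_sym tn0 t0.
have XY r : area_measure (local_parallel_set K r X) = area_measure (P r).
  rewrite {1}XE parallel_setU.
  have [->|->] : X `&` [set 0] = set0 \/ X `&` [set 0] = [set 0].
  - by apply: subset_set1 => t [].
  - have -> : local_parallel_set K r set0 = set0.
      by apply/seteqP; split => // p [t [q [s []]]].
    by rewrite setU0.
  - have mZ : measurable (local_parallel_set K r [set 0]).
      by rewrite -set_itv1; exact: parallel_cc_measurable.
    exact: (@measureU0 _ _ _ (@lebesgue_measure R \x @lebesgue_measure R)%E _ _ (mP r) mZ (area_parallel_zero balK r)).
have p2 := ltW (@pi2_gt0 R).
have Yoc : Y `<=` `]0, pi / 2].
  by move=> t /Y2 /=; rewrite !in_itv/= => /andP[-> /ltW ->].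
have muY : (@lebesgue_measure R Y <= (pi / 2)%:E)%E.
  rewrite -[pi / 2]subr0 -lebesgue_measure_oc//; apply: le_measure => //; rewrite inE//.
have muYf : lebesgue_measure Y \is a fin_num by rewrite ge0_fin_numE// (le_lt_trans muY)// ltry.
have nY : (n Y <= (L * (pi / 2))%:E)%E.
  apply: (@le_trans _ _ (n (`]0, pi / 2]%classic : set R))).
    by apply: le_measure => //; rewrite inE//; exact: measurable_itv.
  rewrite nE -(primitiveE mf fL (lexx 0) p2) lee_fin -[X in L * X]subr0.
  exact: primitive_lip.
have nYf : n Y \is a fin_num by rewrite ge0_fin_numE// (le_lt_trans nY)// ltry.
apply: (@le_trans _ _ (n Y)); last first.
  by rewrite -nE; apply: le_measure; rewrite ?inE// => t [].
rewrite /surface_area.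
have -> : (fun r => (r^-1)%:E * area_measure (local_parallel_set K r X))%E =
    (fun r => (r^-1 * area (P r))%:E).
  by apply/funext => r; rewrite XY Pfin EFinM.
rewrite -(fineK nYf); apply: (@lim_almost_monotone R _ _ (fine (@lebesgue_measure R Y))).
- exact: fine_ge0.
- by move=> r r0; rewrite mulr_ge0 ?invr_ge0 ?(ltW r0)//; exact: fine_ge0.
- move=> r s r0 s0; have := parallel_le_parallel balK r0 s0 mY Y2.
  by rewrite -/(P r) -/(P s) !Pfin -{1}(fineK muYf) -!EFinM -EFinD lee_fin.
- move=> r r0; have := parallel_le_integral balK r0 mY Y2.
  by rewrite -/(P r) Pfin -nE -{1}(fineK muYf) -{1}(fineK nYf) -!EFinM -EFinD lee_fin.
Qed.
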